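(* Let the tangent set be a convex cone $\tilde{\mathcal G}$ such that $\bar\kappa\ne\tilde\kappa$. Then there is some tangent $g_0\in\tilde{\mathcal G}$ such that $\langle\kappa|g_0\rangle>0$ and $$\inf_{t>0}\ \lim_{n\to\infty}P^n_{n,t,g_0}\bigl\{\breve S_n\le T(P_{n,t,g_0})\bigr\}=0$$ for all estimator sequences $(\breve S_n)$ satisfying $$\sqrt n\,\bigl(\breve S_n-T(P)\bigr)_+=\Bigl(\frac1{\sqrt n}\sum_{i=1}^n\tilde\kappa(x_i)\Bigr)_++o_{P^n}(n^0).$$
   Context: Model and tangents. $\mathcal P$ is a set of probability measures on a sample space, $P\in\mathcal P$ is fixed, $T:\mathcal P\to\mathbb R$ is a functional. $\langle\cdot|\cdot\rangle$ and $\Vert\cdot\Vert$ are the inner product and norm of $L_2(P)$. A path in $\mathcal P$ with tangent $g\in L_2(P)$ at $P$ is a family $(P_{g,s})_{s>0}$ in $\mathcal P$ such that $\sqrt{dP_{g,s}}=(1+\tfrac12 s g)\sqrt{dP}+o(s)$ as $s\downarrow0$ in the Hilbert space of square root densities (i.e. the $L_2$-norm of the remainder, with respect to a dominating measure, is $o(s)$). Such $g$ necessarily have $\int g\,dP=0$. The tangent set of $\mathcal P$ at $P$ is the set of all such tangents; here it is assumed to be a convex cone $\tilde{\mathcal G}$ ($\gamma_1g_1+\gamma_2g_2\in\tilde{\mathcal G}$ for $g_i\in\tilde{\mathcal G}$, $\gamma_i\ge0$). For each $g\in\tilde{\mathcal G}$ let $(P_{g,s})_{s>0}$ be a (fixed,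 arbitrary) path in $\mathcal P$ with tangent $g$, and put $P_{n,t,g}=P_{g,t/\sqrt n}$ for $t\in(0,\infty)$; $P_{n,t,g}^n$ is its $n$-fold product. Differentiability of $T$. There is $\kappa\in L_2(P)$ such that for every $g\in\tilde{\mathcal G}$ and any path $(P_{g,s})$ in $\mathcal P$ with tangent $g$: $T(P_{g,s})=T(P)+s\langle\kappa|g\rangle+o(s)$ as $s\downarrow0$. Projections. $\tilde\kappa$ is the projection (unique closest element) of $\kappa$ on the $L_2(P)$-closure of the convex cone $\tilde{\mathcal G}$; $\bar\kappa$ is the orthogonal projection of $\kappa$ on the closed linear span of $\tilde{\mathcal G}$ in $L_2(P)$. It is assumed throughout that $\tilde\kappa\ne0$ and $\bar\kappa\ne0$. Estimators. An estimator sequence $(S_n)$ is any sequence of real-valued measurable functions $S_n$ of the observations $(x_1,\dots,x_n)$ (they may depend on the fixed $P$). $o_{P^n}(n^0)$ denotes a term tending to $0$ in $P^n$-probability as $n\to\infty$; $x_+=\max(x,0)$. *)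

(* Defs.v *)
From HB Require Import structures.
From mathcomp Require Import all_boot all_order all_algebra.
From mathcomp Require Import all_classical all_reals all_analysis.

Set Implicit Arguments.
Unset Strict Implicit.
Unset Printing Implicit Defensive.

Import Order.TTheory GRing.Theory Num.Theory.
Import numFieldNormedType.Exports.

Local Open Scope classical_set_scope.
Local Open Scope ring_scope.

Section product_power.
Context {d : measure_display} {X : measurableType d} {R : realType}.

Definition cons_pair (n : nat) (p : X * n.-tuple X) : n.+1.-tuple X :=
  [the n.+1.-tuple X of p.1 :: p.2].

Lemma measurable_cons_pair (n : nat) :
  measurable_fun [set: X * n.-tuple X] (@cons_pair n).
Proof. exact: measurable_cons. Qed.

HB.instance Definition _ (n : nat) :=
  isMeasurableFun.Build _ _ _ _ (@cons_pair n) (@measurable_cons_pair n).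

Fixpoint prob_power (P : probability X R) (n : nat) :
    probability (n.-tuple X) R :=
  match n with
  | 0%N => \d_([tuple] : 0.-tuple X)
  | m.+1 => distribution (P \x prob_power P m)%E (@cons_pair m)
  end.

Lemma prob_power_box (P : probability X R) (n : nat) (A : 'I_n -> set X) :
  (forall i, measurable (A i)) ->
  prob_power P n [set x | forall i, A i (tnth x i)] =
  (\prod_(i < n) P (A i))%E.
Proof.
elim: n A => [|n IH] A mA.
  by rewrite big_ord0 /= diracE mem_set//=; case.
rewrite big_ord_recl -IH//= /distribution /pushforward.
rewrite -product_measure1E//; last first.
  rewrite (_ : [set x | _] = \bigcap_(i in [set: 'I_n])
      ((fun x : n.-tuple X => tnth x i) @^-1` A (lift ord0 i))).
    apply: fin_bigcap_measurable => // i _.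
    by rewrite -[X in measurable X]setTI; exact: measurable_tnth.
  by apply/seteqP; split=> x /= h i; [move=> _|]; exact: h.
have tc (a : X) (b : n.-tuple X) i :
    tnth (cons_pair (a, b)) (lift ord0 i) = tnth b i.
  by rewrite !(tnth_nth a).
congr ((P \x _)%E _); apply/seteqP; split=> -[a b] /= h.
  by split=> [|i]; [exact: (h ord0)|rewrite -(tc a b); exact: h].
move: h => [h0 h1] i; case: (unliftP ord0 i) => [j ->|->]; last exact: h0.
by rewrite (tc a b); exact: h1.
Qed.

End product_power.

(* Elements of L_2(P) are represented by functions f with f \in Lfun P 2; the
   notions below are invariant under P-a.e. equality, and equality in L_2(P)
   is f = g %[ae P]. *)

Section L2.
Context {d : measure_display} {X : measurableType d} {R : realType}.
Variable P : probability X R.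

Definition dotL2 (f g : X -> R) : R := \int[P]_x (f x * g x).

Definition normL2 (f : X -> R) : \bar R := 'N[P]_2%:E[EFin \o f].

Definition closureL2 (A : set (X -> R)) : set (X -> R) :=
  [set h | h \in Lfun P 2%:E /\
    forall e : R, 0 < e -> exists2 g, A g & (normL2 (h \- g)%R < e%:E)%E].

Definition convex_cone (A : set (X -> R)) : Prop :=
  forall (g1 g2 : X -> R) (c1 c2 : R), A g1 -> A g2 -> 0 <= c1 -> 0 <= c2 ->
    A (fun x => c1 * g1 x + c2 * g2 x).

Definition linear_span (A : set (X -> R)) : set (X -> R) :=
  [set h | exists (n : nat) (c : 'I_n -> R) (g : 'I_n -> X -> R),
    (forall i, A (g i)) /\ h = (fun x => \sum_(i < n) c i * g i x)].

Definition is_projection (C : set (X -> R)) (f h : X -> R) : Prop :=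
  C h /\ forall k, C k -> (normL2 (f \- h)%R <= normL2 (f \- k)%R)%E.

Definition is_orthogonal_projection (V : set (X -> R)) (f h : X -> R) : Prop :=
  V h /\ forall v, V v -> dotL2 (f \- h) v = 0.

End L2.

Section tangents.
Context {d : measure_display} {X : measurableType d} {R : realType}.

Section sum_of_probabilities.
Variables P Q : probability X R.

Definition prob_add : set X -> \bar R := measure_add P Q.

HB.instance Definition _ := Measure.on prob_add.

Lemma prob_add_finite : fin_num_fun prob_add.
Proof.
by move=> A mA; rewrite /prob_add measure_addE fin_numD !fin_num_measure.
Qed.

HB.instance Definition _ := Measure_isFinite.Build _ _ _ prob_add
  prob_add_finite.

Lemma prob_add_dominatesl : P `<< prob_add.
Proof.
move=> B hB C mC CB; have /eqP := hB C mC CB.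
by rewrite /prob_add /= measure_addE padde_eq0// => /andP[/eqP].
Qed.

Lemma prob_add_dominatesr : Q `<< prob_add.
Proof.
move=> B hB C mC CB; have /eqP := hB C mC CB.
by rewrite /prob_add /= measure_addE padde_eq0// => /andP[_ /eqP].
Qed.

(* Only used for M = P and M = Q, which are dominated by P + Q. *)
Definition sqrt_density (M : probability X R) : X -> R :=
  fun x => Num.sqrt (fine (Radon_Nikodym (charge_of_finite_measure M)
                                         prob_add x)).

End sum_of_probabilities.

(* The norm of sqrt(dQ) - (1 + s g / 2) sqrt(dP) does not depend on the
   dominating measure; P + Q is used. A single measure dominating a whole path
   need not exist. *)
Definition sqrt_remainder (P Q : probability X R) (g : X -> R) (s : R) :
    \bar R :=
  'N[prob_add P Q]_2%:E[EFin \o (fun x =>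
     sqrt_density P Q Q x - (1 + s * g x / 2) * sqrt_density P Q P x)].

(* Only the values of Q at s > 0 matter. *)
Definition is_path (PP : set (probability X R)) (P : probability X R)
    (g : X -> R) (Q : R -> probability X R) : Prop :=
  [/\ g \in Lfun P 2%:E,
      forall s : R, 0 < s -> PP (Q s) &
      (sqrt_remainder P (Q s) g s * (s^-1)%:E)%E @[s --> 0^'+] --> 0%E].

Definition tangent_set (PP : set (probability X R)) (P : probability X R) :
    set (X -> R) :=
  [set g | exists Q, is_path PP P g Q].

(* T is total, but only its values on PP occur. *)
Definition is_gradient (PP : set (probability X R)) (P : probability X R)
    (T : probability X R -> R) (kappa : X -> R) : Prop :=
  kappa \in Lfun P 2%:E /\
  forall (g : X -> R) (Q : R -> probability X R), is_path PP P g Q ->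
    (fun s : R => T (Q s) - (T P + s * dotL2 P kappa g))
      =o_ (0^'+) (fun s : R => s).

End tangents.

Section estimators.
Context {d : measure_display} {X : measurableType d} {R : realType}.

(* Y_n = o_{P^n}(n^0) *)
Definition tends_to_0_in_prob (P : probability X R)
    (Y : forall n : nat, n.-tuple X -> R) : Prop :=
  forall e : R, 0 < e ->
    prob_power P n [set x | e < `|Y n x|] @[n --> \oo] --> 0%E.

Definition positive_part (x : R) : R := Num.max x 0.

Definition local_alternative (Pg : R -> probability X R) (t : R) (n : nat) :
    probability X R :=
  Pg (t / Num.sqrt n%:R).

End estimators.

(* Main.v *)
Require Import Defs.
From HB Require Import structures.
From mathcomp Require Import all_boot all_order all_algebra.
From mathcomp Require Import all_classical all_reals all_analysis.
From mathcomp Require Import measurable_realfun ring lra.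

Set Implicit Arguments.
Unset Strict Implicit.
Unset Printing Implicit Defensive.

Import Order.TTheory GRing.Theory Num.Theory.
Import numFieldNormedType.Exports.

Local Open Scope classical_set_scope.
Local Open Scope ring_scope.

(** By the projection inequality on a convex cone, [<kappa - kappa_tilde | g> <= 0]
    for every tangent [g], and [kappa - kappa_tilde] is orthogonal to
    [kappa_tilde]. If [kappa - kappa_tilde] were orthogonal to all tangents,
    [kappa_tilde] would be the projection on the linear span; so some tangent
    satisfies [<kappa | g> < <kappa_tilde | g>], and adding a tangent close to
    [kappa_tilde] makes [<kappa | g0>] positive as well. Under the local
    alternatives [n^(-1/2) sum kappa_tilde(x_i)] is asymptotically normal with
    mean [t <kappa_tilde | g0>] and variance [|kappa_tilde|^2], so the error
    probability tends to
    [Phi (- t (<kappa_tilde | g0> - <kappa | g0>) / |kappa_tilde|)], which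
    vanishes as [t] grows.

    The central limit theorem is proved directly under the alternatives by
    Lindeberg replacement with the test functions [Phi (w / sqrt theta)]: they
    solve the heat equation, so a replacement step is a Taylor expansion and no
    sum of independent normal variables is needed. With
    [sqrt q = (1 + h) sqrt p], Hellinger differentiability says that [h] is close
    to [s g / 2]; cutting off where [1 < h] costs mass [o(1/n)] and leaves a
    density bounded by 4, whose second moment [1 + O(1/n)] yields contiguity. *)

(** * Real-valued integrals and square integrable functions *)

(** The estimator is controlled only under [P] and only through positive parts. Contiguity carries
    the first control over to the alternatives. The second suffices because a positive derivative of
    [T] along [g0] makes the value of [T] at the alternative exceed [T P] for large [n], so that the
    positive part decides the event. This is why [g0] must satisfy both inequalities. The test
    functions start at a variance [eta > 0], since an indicator cannot be expanded; all constants
    depend on [eta], which is fixed before [n]. It is taken as the fourth power of the margin around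
    the threshold, so that smoothing is finer than the margin. Alternatives may have a part singular
    to [P], and [g] and [kappa_tilde] are merely square integrable. Hence the bounded density comes
    with an additive mass [beta] such that [n * beta] vanishes, and moment estimates truncate at a
    level [K] fixed before [n]. The limit theorem needs a centred [kappa_tilde]; that tangents have
    mean 0 follows from the same Hellinger expansion, by comparing total masses. *)

Section real_integrals.
Context d (T : measurableType d) (R : realType).
Implicit Types (mu : {measure set T -> \bar R}) (f g : T -> R).

Lemma integrable_dom mu f g : measurable_fun setT f ->
  mu.-integrable setT (EFin \o g) -> (forall x, `|f x| <= g x) ->
  mu.-integrable setT (EFin \o f).
Proof.
move=> mf ig fg; apply: le_integrable ig => //.
  exact/measurable_EFinP.
move=> x _ /=; rewrite lee_fin (le_trans (fg x))//; exact: ler_norm.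
Qed.

(** Linear combinations as lists of coefficient-function pairs: an integral identity or inequality
    then splits into integrability conditions, which compute to a conjunction, and a pointwise claim
    left to [ring] or [nra]. *)
Fixpoint lincomb (s : seq (R * (T -> R))) (x : T) : R :=
  if s is p :: s' then p.1 * p.2 x + lincomb s' x else 0.

Fixpoint integrable_all mu (s : seq (R * (T -> R))) : Prop :=
  if s is p :: s' then mu.-integrable setT (EFin \o p.2) /\ integrable_all mu s'
  else True.

Fixpoint lincomb_int mu (s : seq (R * (T -> R))) : R :=
  if s is p :: s' then p.1 * (\int[mu]_x p.2 x) + lincomb_int mu s' else 0.

Lemma integrable_lincomb mu s : integrable_all mu s ->
  mu.-integrable setT (EFin \o lincomb s).
Proof.
elim: s => [_|[c f] s IH /= [f1 /IH s1]] /=; first exact: integrable0.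
rewrite (_ : _ \o _ = (fun x => c%:E * (f x)%:E) \+ (EFin \o lincomb s))%E//.
by apply: integrableD => //; exact: integrableZl.
Qed.

Lemma Rintegral_lincomb mu s : integrable_all mu s ->
  \int[mu]_x lincomb s x = lincomb_int mu s.
Proof.
elim: s => [_|[c f] s IH /= [f1 s1]] /=.
  by rewrite /Rintegral integral0.
rewrite RintegralD//; last exact: integrable_lincomb.
  by rewrite RintegralZl// IH.
by have := integrableZl measurableT c f1.
Qed.

Lemma eq_Rintegral_lincomb mu f s : integrable_all mu s ->
  (forall x, f x = lincomb s x) -> \int[mu]_x f x = lincomb_int mu s.
Proof.
by move=> si fs; rewrite -Rintegral_lincomb//; apply: eq_Rintegral => x _.
Qed.

Lemma eq_integrable_lincomb mu f s : integrable_all mu s ->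
  (forall x, f x = lincomb s x) -> mu.-integrable setT (EFin \o f).
Proof.
by move=> si /funext ->; exact: integrable_lincomb.
Qed.

Lemma le_Rintegral_lincomb mu f s : mu.-integrable setT (EFin \o f) ->
  integrable_all mu s -> (forall x, f x <= lincomb s x) ->
  \int[mu]_x f x <= lincomb_int mu s.
Proof.
move=> fi si fs; rewrite -Rintegral_lincomb//.
by apply: le_Rintegral => //; exact: integrable_lincomb.
Qed.

(** Membership in [Lfun mu 2%:E] (see [Lfun2P]), in the form that linear combinations of integrals
    consume. *)
Definition L2 mu f := measurable_fun setT f /\
  mu.-integrable setT (EFin \o (fun x => f x ^+ 2)).

Lemma L2_dom mu f g : measurable_fun setT f -> L2 mu g ->
  (forall x, `|f x| <= `|g x|) -> L2 mu f.
Proof.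
move=> mf [mg ig] fg; split => //; apply: integrable_dom ig _.
  exact: measurable_funX.
move=> x; rewrite normrX -[leRHS]ger0_norm ?sqr_ge0// normrX.
by rewrite ler_sqr ?nnegrE.
Qed.

Lemma L2_mul mu f g : L2 mu f -> L2 mu g ->
  mu.-integrable setT (EFin \o (fun x => f x * g x)).
Proof.
move=> [mf fi] [mg gi].
apply: (@integrable_dom _ _
  (lincomb [:: (1, fun x => f x ^+ 2); (1, fun x => g x ^+ 2)])).
- exact: measurable_funM.
- exact: integrable_lincomb.
- move=> x /=; rewrite !mul1r addr0 ler_norml.
  have := sqr_ge0 (f x + g x); have := sqr_ge0 (f x - g x).
  have := sqr_ge0 (f x); have := sqr_ge0 (g x).
  by nra.
Qed.

Lemma L2D mu f g a b : L2 mu f -> L2 mu g -> L2 mu (fun x => a * f x + b * g x).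
Proof.
move=> fi gi; have fg := L2_mul fi gi; split.
  by apply: measurable_funD; apply: measurable_funM => //; [case: fi|case: gi].
apply: (@eq_integrable_lincomb _ _ [:: (a ^+ 2, fun x => f x ^+ 2);
  (b ^+ 2, fun x => g x ^+ 2); (2 * a * b, fun x => f x * g x)]) => /=.
  by case: fi; case: gi.
by move=> x; ring.
Qed.

Lemma L2Z mu f a : L2 mu f -> L2 mu (fun x => a * f x).
Proof.
move=> fi; have := L2D a 0 fi fi.
by rewrite (_ : (fun x => _ + _) = (fun x => a * f x))//; apply/funext => x; ring.
Qed.

Lemma L2B mu f g : L2 mu f -> L2 mu g -> L2 mu (fun x => f x - g x).
Proof.
move=> fi gi; have := L2D 1 (-1) fi gi.
by rewrite (_ : (fun x => _ + _) = (fun x => f x - g x))//; apply/funext => x; ring.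
Qed.

Lemma L2_normL2 mu f : L2 mu f ->
  ('N[mu]_2%:E[EFin \o f])%E = (Num.sqrt (\int[mu]_x f x ^+ 2))%:E.
Proof.
move=> [mf fi]; rewrite unlock.
under eq_integral do rewrite /= powR_mulrn// -normrX ger0_norm ?sqr_ge0//.
rewrite -[(\int[_]_x _)%E]fineK; last exact: (integrable_fin_num _ fi).
by rewrite poweR_EFin powR12_sqrt// Rintegral_ge0// => x _; exact: sqr_ge0.
Qed.

Lemma Lfun2P mu f : f \in Lfun mu 2%:E <-> L2 mu f.
Proof.
split=> [fL|fL].
  split; last exact: Lfun2_integrable_sqr.
  by move: fL; rewrite inE => /andP[+ _]; rewrite inE.
rewrite inE; apply/andP; split; rewrite inE /=; first by case: fL.
by rewrite /finite_norm L2_normL2// ltry.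
Qed.

End real_integrals.

Section finite_measure_integrals.
Context d (T : measurableType d) (R : realType).
Implicit Types (mu : {finite_measure set T -> \bar R}) (f g : T -> R).

Lemma integrable_cst mu (c : R) : mu.-integrable setT (EFin \o cst c).
Proof. exact: finite_measure_integrable_cst. Qed.

Lemma L2_cst mu (c : R) : L2 mu (cst c).
Proof. by split => //; exact: (integrable_cst mu (c ^+ 2)). Qed.

Lemma L2_integrable mu f : L2 mu f -> mu.-integrable setT (EFin \o f).
Proof.
move=> fi; have := L2_mul fi (L2_cst mu 1).
by rewrite (_ : (fun x => _ * _) = f)//; apply/funext => x; rewrite mulr1.
Qed.

Lemma integrable_bounded mu f (c : R) : measurable_fun setT f ->
  (forall x, `|f x| <= c) -> mu.-integrable setT (EFin \o f).
Proof. by move=> mf; exact: integrable_dom (integrable_cst mu c). Qed.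

End finite_measure_integrals.

(** * The normal distribution function and the heat equation *)

Section standard_normal.
Context {R : realType}.
Notation mu := (@lebesgue_measure R).

(** [cdf] takes a random variable; the identity under the standard normal law gives access to the
    monotonicity and the limits of distribution functions. *)
Let id_R : measurableTypeR R -> R := idfun.

HB.instance Definition _ :=
  @isMeasurableFun.Build _ _ _ _ id_R (@measurable_id _ _ setT).

Definition gauss_pdf (x : R) : R := normal_pdf 0 1 x.

Definition gauss_cdf (x : R) : R :=
  fine (cdf (id_R : {RV (normal_prob (0:R) 1) >-> R}) x).

Lemma gauss_pdfE x : gauss_pdf x = normal_peak 1 * expR (- (x ^+ 2 / 2)).
Proof.
by rewrite /gauss_pdf normal_pdfE ?oner_neq0// /normal_fun subr0 expr1n mulNr.
Qed.

Lemma EFin_gauss_cdf x :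
  (gauss_cdf x)%:E = cdf (id_R : {RV (normal_prob (0:R) 1) >-> R}) x.
Proof. by rewrite /gauss_cdf fineK// fin_num_measure. Qed.

Lemma gauss_cdf_ge0 x : 0 <= gauss_cdf x.
Proof. by rewrite -lee_fin EFin_gauss_cdf cdf_ge0. Qed.

Lemma gauss_cdf_le1 x : gauss_cdf x <= 1.
Proof. by rewrite -lee_fin EFin_gauss_cdf cdf_le1. Qed.

Lemma gauss_cdf_nondecreasing : {homo gauss_cdf : x y / x <= y}.
Proof. by move=> x y xy; rewrite -lee_fin !EFin_gauss_cdf cdf_nondecreasing. Qed.

Lemma gauss_cdf_cvgy : gauss_cdf x @[x --> +oo] --> (1:R).
Proof.
by apply: fine_cvg; exact: (cvg_cdfy1 (id_R : {RV (normal_prob (0:R) 1) >-> R})).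
Qed.

Lemma gauss_cdf_cvgNy : gauss_cdf x @[x --> -oo] --> (0:R).
Proof.
by apply: fine_cvg; exact: (cvg_cdfNy0 (id_R : {RV (normal_prob (0:R) 1) >-> R})).
Qed.

Lemma is_derive_gauss_cdf (x : R) : is_derive x (1:R) gauss_cdf (gauss_pdf x).
Proof.
pose F (y : R) := \int[mu]_(t in [set` Interval -oo%O (BRight y)]) gauss_pdf t.
(* Pointwise the two sides are convertible: the normal law is defined by integrating its density. *)
have -> : gauss_cdf = F by apply/funext.
have xlt : x < x + 1 by rewrite ltrDl.
have int : mu.-integrable [set` Interval -oo%O (BRight (x + 1))]
    (EFin \o gauss_pdf).
  by apply: integrableS (integrable_normal_pdf _ _) => //; exact: measurable_itv.
have cont : {for x, continuous gauss_pdf}.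
  exact: (@continuous_normal_pdf _ 0 1 (oner_neq0 _)).
have [dF F'] := @continuous_FTC1 R gauss_pdf -oo%O x (x + 1) xlt int (ltNyr _) cont.
by apply: DeriveDef; [exact: dF|rewrite -derive1E; exact: F'].
Qed.

Lemma is_derive_gauss_pdf (x : R) :
  is_derive x (1:R) gauss_pdf (- x * gauss_pdf x).
Proof.
rewrite (_ : gauss_pdf = (fun x => normal_peak 1 * expR (- (x ^+ 2 / 2)))); last first.
  by apply/funext => y; rewrite gauss_pdfE.
apply: is_derive_eq.
by rewrite /GRing.scale /=; field.
Qed.

Lemma gauss_pdf_ge0 x : 0 <= gauss_pdf x.
Proof. exact: normal_pdf_ge0. Qed.

(** Powers of [|x|] up to the third are at most [1 + x ^+ 4], and
    [x ^+ 4 * expR (- (x ^+ 2 / 2)) <= 16] is the square of [y <= expR y] at [y = x ^+ 2 / 4]; hence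
    17. *)
Lemma gauss_pdf_bound : exists2 B : R, 0 <= B & forall x,
  [/\ gauss_pdf x <= B, `|x * gauss_pdf x| <= B,
      x ^+ 2 * gauss_pdf x <= B & `|x ^+ 3 * gauss_pdf x| <= B].
Proof.
have p0 : 0 <= normal_peak 1 :> R by exact: normal_peak_ge0.
exists (17 * normal_peak 1) => [|x]; first by rewrite mulr_ge0.
pose e := expR (- (x ^+ 2 / 2)).
have e0 : 0 <= e by exact: expR_ge0.
have x20 : 0 <= x ^+ 2 by exact: sqr_ge0.
have e1 : e <= 1 by rewrite -expR0 ler_expR oppr_le0 divr_ge0.
have x4e : x ^+ 4 * e <= 16.
  have -> : e = (expR (x ^+ 2 / 4) ^+ 2)^-1.
    by rewrite -expRM_natl -expRN; congr expR; by field.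
  rewrite ler_pdivrMr ?exprn_gt0 ?expR_gt0//.
  have : x ^+ 2 / 4 <= expR (x ^+ 2 / 4).
    by rewrite (le_trans _ (expR_ge1Dx _))// lerDr.
  rewrite -(@ler_pXn2r _ 2) ?nnegrE ?divr_ge0// ?expR_ge0//.
  by rewrite expr_div_n -exprM; lra.
have key a : `|a| <= 1 + x ^+ 4 -> `|a * gauss_pdf x| <= 17 * normal_peak 1.
  move=> ax; rewrite gauss_pdfE -/e mulrCA normrM mulrC (ger0_norm p0).
  rewrite ler_wpM2r// normrM (ger0_norm e0).
  by rewrite (le_trans (ler_wpM2r e0 ax))//; lra.
have h4 : x ^+ 4 = x ^+ 2 * x ^+ 2 by rewrite -exprD.
have nx : `|x| ^+ 2 = x ^+ 2 by rewrite real_normK// num_real.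
have n0 : 0 <= `|x| by [].
split.
- have := key 1; rewrite mul1r normr1 ger0_norm ?gauss_pdf_ge0//; apply.
  by rewrite lerDl exprn_even_ge0.
- apply: key; rewrite h4 -nx; move: n0; move: (`|x|) => y y0.
  by have := sqr_ge0 (y - 1); have := sqr_ge0 (y ^+ 2 - 1); nra.
- have := key (x ^+ 2); rewrite (ger0_norm x20) (ger0_norm (mulr_ge0 x20 (gauss_pdf_ge0 x))).
  by apply; rewrite h4; nra.
- apply: key; rewrite normrX h4 -nx; move: n0; move: (`|x|) => y y0.
  by have := sqr_ge0 (y ^+ 2 - y); have := sqr_ge0 (y ^+ 2 - 1); have := sqr_ge0 (y - 1); nra.
Qed.

End standard_normal.

(** * Taylor expansions with explicit remainder *)

Section taylor.
Context {R : realType}.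
Implicit Types (F : R -> R) (a b M : R).

(** Hypotheses on the ball of radius [|b - a|] around [a], rather than on the segment, do not depend
    on the order of [a] and [b] and restrict by transitivity to every [x] of the ball; the next two
    lemmas iterate on this. *)
Lemma mvt_bound F F' a b M :
  (forall x, `|x - a| <= `|b - a| -> is_derive x (1:R) F (F' x)) ->
  (forall x, `|x - a| <= `|b - a| -> `|F' x| <= M) ->
  `|F b - F a| <= M * `|b - a|.
Proof.
move=> dF F'M.
have main (c d : R) : c <= d ->
   (forall x, c <= x <= d -> is_derive x (1:R) F (F' x)) ->
   (forall x, c <= x <= d -> `|F' x| <= M) -> `|F d - F c| <= M * `|d - c|.
  move=> cd dF1 F'M1.
  have [||x xcd ->] := @MVT_segment R F F' c d cd.
  - by move=> x xcd; apply: dF1; move: xcd; rewrite in_itv/= => /andP[/ltW-> /ltW->].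
  - apply: derivable_within_continuous => x xcd.
    by have [] : is_derive x (1:R) F (F' x) by apply: dF1; move: xcd; rewrite in_itv.
  - by rewrite normrM ler_wpM2r//; apply: F'M1; move: xcd; rewrite in_itv.
have [ab|ba] := leP a b.
  have h x : a <= x <= b -> `|x - a| <= `|b - a|.
    by move=> /andP[ax xb]; rewrite !ger0_norm ?subr_ge0// lerD2r.
  by apply: main => // x /h; [exact: dF|exact: F'M].
rewrite distrC (distrC b).
have h x : b <= x <= a -> `|x - a| <= `|b - a|.
  move=> /andP[bx xa]; rewrite !ler0_norm ?subr_le0// ?lerN2 ?lerD2r//.
  exact: ltW.
by apply: main => [|x /h|x /h]; [exact: ltW|exact: dF|exact: F'M].
Qed.

Lemma taylor1_bound F F' F'' a b M :
  (forall x, `|x - a| <= `|b - a| -> is_derive x (1:R) F (F' x)) ->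
  (forall x, `|x - a| <= `|b - a| -> is_derive x (1:R) F' (F'' x)) ->
  (forall x, `|x - a| <= `|b - a| -> `|F'' x| <= M) ->
  `|F b - F a - F' a * (b - a)| <= M * (b - a) ^+ 2.
Proof.
move=> dF dF' F''M.
have := @mvt_bound (fun x => F x - F' a * x) (fun x => F' x - F' a) a b
  (M * `|b - a|).
rewrite -mulrA -expr2 real_normK ?num_real//.
rewrite (_ : F b - F' a * b - (F a - F' a * a) = F b - F a - F' a * (b - a)); last by ring.
apply=> x xab.
  have dFx := dF x xab; apply: is_derive_eq.
  by rewrite /GRing.scale/=; ring.
apply: le_trans (_ : M * `|x - a| <= _).
  by apply: mvt_bound => y yx; [apply: dF'|apply: F''M]; exact: le_trans yx xab.
by rewrite ler_wpM2l// (le_trans _ (F''M a _))// subrr normr0.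
Qed.

(** The mean value bound applied to [F] minus its quadratic part, whose derivative is the remainder
    treated by [taylor1_bound]. The usual factor 1/6 is given up. *)
Lemma taylor2_bound F F' F'' F''' a b M :
  (forall x, `|x - a| <= `|b - a| -> is_derive x (1:R) F (F' x)) ->
  (forall x, `|x - a| <= `|b - a| -> is_derive x (1:R) F' (F'' x)) ->
  (forall x, `|x - a| <= `|b - a| -> is_derive x (1:R) F'' (F''' x)) ->
  (forall x, `|x - a| <= `|b - a| -> `|F''' x| <= M) ->
  `|F b - F a - F' a * (b - a) - F'' a * (b - a) ^+ 2 / 2| <= M * `|b - a| ^+ 3.
Proof.
move=> dF dF' dF'' F'''M.
have M0 : 0 <= M by rewrite (le_trans _ (F'''M a _))// subrr normr0.
have dG x : `|x - a| <= `|b - a| -> is_derive x (1:R)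
    (fun x => F x - F' a * x - F'' a / 2 * (x - a) ^+ 2)
    (F' x - F' a - F'' a * (x - a)).
  move=> xab; have dFx := dF x xab; apply: is_derive_eq.
  by rewrite /GRing.scale/=; field.
have bG x : `|x - a| <= `|b - a| ->
    `|F' x - F' a - F'' a * (x - a)| <= M * (b - a) ^+ 2.
  move=> xab; apply: le_trans (_ : M * (x - a) ^+ 2 <= _).
    by apply: (taylor1_bound (F'' := F''')) => y yx;
      [apply: dF'|apply: dF''|apply: F'''M]; exact: le_trans yx xab.
  rewrite ler_wpM2l// -(real_normK (num_real (x - a))).
  by rewrite -(real_normK (num_real (b - a))) ler_sqr ?nnegrE.
have := mvt_bound dG bG.
have -> : M * (b - a) ^+ 2 * `|b - a| = M * `|b - a| ^+ 3.
  by rewrite -(real_normK (num_real (b - a))); ring.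
congr (`|_| <= _); rewrite subrr expr0n/=; by field.
Qed.

End taylor.

(** * Gaussian smoothing of an indicator as a heat flow *)

Section heat_function.
Context {R : realType}.
Implicit Types (theta w y delta eta : R).

(* [heat] solves d/dtheta = (1/2) d^2/dw^2; [heat1], [heat2] are its first two
   derivatives in [w]. *)
Definition heat theta w : R := gauss_cdf (w / Num.sqrt theta).

Definition heat1 theta w : R :=
  gauss_pdf (w / Num.sqrt theta) / Num.sqrt theta.

Definition heat2 theta w : R :=
  - (w / Num.sqrt theta * gauss_pdf (w / Num.sqrt theta)) / theta.

(** Uniformity in [w] and in [theta >= eta] is essential, as both move during the replacement. The
    remainder in [w] is bounded in two ways: by [y ^+ 2], for large values of the summand, and by
    [|y| ^+ 3], for the others. The last clause is the heat equation in integrated form. *)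
Lemma heat_bound eta : 0 < eta -> exists2 C : R, 0 <= C &
  forall theta w, eta <= theta -> [/\ `|heat1 theta w| <= C, `|heat2 theta w| <= C,
   (forall y, `|heat theta (w + y) - heat theta w - heat1 theta w * y
     - heat2 theta w * y ^+ 2 / 2| <= C * y ^+ 2),
   (forall y, `|heat theta (w + y) - heat theta w - heat1 theta w * y
     - heat2 theta w * y ^+ 2 / 2| <= C * `|y| ^+ 3) &
   (forall delta, 0 <= delta <= eta ->
     `|heat (theta + delta) w - heat theta w - heat2 theta w / 2 * delta|
       <= C * delta ^+ 2)].
Proof.
move=> eta0; have [B B0 pB] := @gauss_pdf_bound R.
pose c := (Num.sqrt eta)^-1.
have c0 : 0 <= c by rewrite invr_ge0.
(* In order: [heat1]; [heat2] and the quadratic remainder; the cubic remainder; the increment in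
   [theta]. *)
exists (B * c + 2 * B * c ^+ 2 + B * c ^+ 3 + 6 * B * c ^+ 4).
  by rewrite !addr_ge0// !mulr_ge0// ?exprn_ge0.
move=> theta w et.
have theta0 : 0 < theta by exact: lt_le_trans et.
pose z := w / Num.sqrt theta.
pose r := (Num.sqrt theta)^-1.
have s0 : 0 < Num.sqrt theta by rewrite sqrtr_gt0.
have r0 : 0 <= r by rewrite invr_ge0.
have rc : r <= c by rewrite lef_pV2 ?posrE ?sqrtr_gt0// ler_sqrt// ltW.
have r2 : theta^-1 = r ^+ 2 by rewrite exprVn sqr_sqrtr// ltW.
have c2 : c ^+ 2 = eta^-1 by rewrite exprVn sqr_sqrtr// ltW.
have rc2 : r ^+ 2 <= c ^+ 2 by rewrite ler_sqr ?nnegrE.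
have rc3 : r ^+ 3 <= c ^+ 3 by rewrite lerXn2r ?nnegrE.
have [pz1 pz2 pz3 pz4] := pB z.
have c1 : 0 <= B * c by rewrite mulr_ge0.
have c22 : 0 <= B * c ^+ 2 by rewrite mulr_ge0 ?exprn_ge0.
have c3 : 0 <= B * c ^+ 3 by rewrite mulr_ge0 ?exprn_ge0.
have c4 : 0 <= B * c ^+ 4 by rewrite mulr_ge0 ?exprn_ge0.
have h1E : heat1 theta w = gauss_pdf z * r by [].
have h2E : heat2 theta w = - (z * gauss_pdf z) * r ^+ 2 by rewrite /heat2 r2.
have dpdf (x : R) : is_derive x (1:R) (fun x => - x * gauss_pdf x)
    ((x ^+ 2 - 1) * gauss_pdf x).
  have dp := is_derive_gauss_pdf x; apply: is_derive_eq.
  by rewrite /GRing.scale/=; ring.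
have wyE y : (w + y) / Num.sqrt theta = z + r * y by rewrite /z /r; ring.
have yr y : (r * y) ^+ 2 <= c ^+ 2 * y ^+ 2.
  by rewrite exprMn ler_wpM2r ?sqr_ge0.
have B2 x : `|- x * gauss_pdf x| <= B by have [] := pB x; rewrite mulNr normrN.
split.
- rewrite h1E normrM !ger0_norm ?gauss_pdf_ge0//.
  apply: le_trans (_ : B * c <= _); last by lra.
  by rewrite ler_pM ?gauss_pdf_ge0.
- rewrite h2E normrM normrN (ger0_norm (sqr_ge0 _)).
  apply: le_trans (_ : B * c ^+ 2 <= _); last by lra.
  by rewrite ler_pM ?sqr_ge0.
- move=> y.
  have -> : heat theta (w + y) - heat theta w - heat1 theta w * y -
      heat2 theta w * y ^+ 2 / 2 = gauss_cdf (z + r * y) - gauss_cdf z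
      - gauss_pdf z * (z + r * y - z) - (- z * gauss_pdf z) * (r * y) ^+ 2 / 2.
    by rewrite h1E h2E /heat wyE -/z; ring.
  have t1 := @taylor1_bound R gauss_cdf gauss_pdf (fun x => - x * gauss_pdf x)
    z (z + r * y) B (fun x _ => is_derive_gauss_cdf x)
    (fun x _ => is_derive_gauss_pdf x) (fun x _ => B2 x).
  have t2 : `|(- z * gauss_pdf z) * (r * y) ^+ 2 / 2| <= B * (r * y) ^+ 2.
    rewrite -mulrA normrM ler_pM//.
    rewrite ger0_norm ?divr_ge0 ?sqr_ge0//; have := sqr_ge0 (r * y); lra.
  apply: le_trans (ler_normB _ _) _.
  apply: le_trans (lerD t1 t2) _; rewrite (addrC z) addrK.
  have : B * (r * y) ^+ 2 <= B * (c ^+ 2 * y ^+ 2) by rewrite ler_wpM2l.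
  by have := sqr_ge0 y; nra.
- move=> y.
  have -> : heat theta (w + y) - heat theta w - heat1 theta w * y -
      heat2 theta w * y ^+ 2 / 2 = gauss_cdf (z + r * y) - gauss_cdf z
      - gauss_pdf z * (z + r * y - z)
      - (- z * gauss_pdf z) * (z + r * y - z) ^+ 2 / 2.
    by rewrite h1E h2E /heat wyE -/z; ring.
  have B3 x : `|(x ^+ 2 - 1) * gauss_pdf x| <= B.
    have [? _ ? _] := pB x; have ? := gauss_pdf_ge0 x; have ? := sqr_ge0 x.
    have ? : 0 <= x ^+ 2 * gauss_pdf x by rewrite mulr_ge0.
    by rewrite ler_norml; apply/andP; split; lra.
  have := @taylor2_bound R gauss_cdf gauss_pdf (fun x => - x * gauss_pdf x)
    (fun x => (x ^+ 2 - 1) * gauss_pdf x)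
    z (z + r * y) B (fun x _ => is_derive_gauss_cdf x)
    (fun x _ => is_derive_gauss_pdf x) (fun x _ => dpdf x) (fun x _ => B3 x).
  move=> /le_trans; apply; rewrite (addrC z) addrK normrM (ger0_norm r0) exprMn.
  rewrite mulrA ler_wpM2r ?exprn_ge0//.
  by have := ler_wpM2l B0 rc3; lra.
- move=> delta /andP[d0 de].
  (* With [q = (1 + e)^(-1/2)] the new argument is [z * q], so the increment in [theta] becomes an
     expansion of [x |-> gauss_cdf (z * x)] between 1 and [q]. Its linear term matches [heat2]
     because [q - 1] is [- e / 2] up to order [e ^+ 2]. *)
  pose e := delta / theta; pose q := Num.sqrt theta / Num.sqrt (theta + delta).
  have td0 : 0 < theta + delta by rewrite ltr_wpDr.
  have std0 : 0 < Num.sqrt (theta + delta) by rewrite sqrtr_gt0.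
  have e0 : 0 <= e by rewrite divr_ge0// ltW.
  have e1 : e <= 1 by rewrite ler_pdivrMr// mul1r; exact: le_trans et.
  have q0 : 0 <= q by rewrite divr_ge0// ltW.
  have q2 : q ^+ 2 * (1 + e) = 1.
    rewrite /q /e expr_div_n !sqr_sqrtr ?ltW//; field.
    by rewrite !gt_eqF.
  have q1 : q <= 1 by rewrite leNgt; apply/negP => q1; nra.
  have q12 : 1 / 2 <= q by rewrite leNgt; apply/negP => q1'; nra.
  have qe : 1 - q <= e by nra.
  have qe2 : `|(q - 1) + e / 2| <= 2 * e ^+ 2.
    have ee : e * (1 - q) <= e ^+ 2 by rewrite expr2 ler_wpM2l.
    have E : (q - 1 + e / 2) * (1 + q) = e / 2 * (1 - q) * (1 + 2 * q).
      have : q ^+ 2 * e = 1 - q ^+ 2 by lra.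
      by nra.
    have E0 : 0 <= q - 1 + e / 2 by nra.
    by rewrite ger0_norm//; nra.
  have -> : heat (theta + delta) w - heat theta w - heat2 theta w / 2 * delta =
     (gauss_cdf (z * q) - gauss_cdf (z * 1) - z * gauss_pdf (z * 1) * (q - 1)) +
     (z * gauss_pdf z * ((q - 1) + e / 2)).
    rewrite /heat -/z (_ : w / Num.sqrt (theta + delta) = z * q); last first.
      by rewrite /z /q; field; rewrite !gt_eqF.
    by rewrite h2E !mulr1 -r2 /e; field; rewrite gt_eqF.
  have rng x : `|x - 1| <= `|q - 1| -> 1 / 2 <= x.
    by rewrite (ler0_norm (_ : q - 1 <= 0)) ?subr_le0// ler_norml => /andP[]; lra.
  have dz (x : R) : is_derive x (1:R) (fun x => z * x) z.
    by apply: is_derive_eq; rewrite /GRing.scale/=; ring.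
  have dF (x : R) : is_derive x (1:R) (fun x => gauss_cdf (z * x)) (z * gauss_pdf (z * x)).
    rewrite mulrC.
    exact: (@is_derive1_comp _ gauss_cdf (fun x => z * x) _ _ _
      (is_derive_gauss_cdf (z * x)) (dz x)).
  have dF' (x : R) : is_derive x (1:R) (fun x => z * gauss_pdf (z * x))
     (z ^+ 2 * (- (z * x) * gauss_pdf (z * x))).
    have dp := @is_derive1_comp _ gauss_pdf (fun x => z * x) _ _ _
      (is_derive_gauss_pdf (z * x)) (dz x).
    by apply: is_derive_eq; rewrite /GRing.scale/=; ring.
  (* Uniform in [z]: for [x >= 1 / 2] the factor [z ^+ 2] is at most [4 * (z * x) ^+ 2], which
     leaves the cubic bound on the normal density. *)
  have F2 x : 1 / 2 <= x -> `|z ^+ 2 * (- (z * x) * gauss_pdf (z * x))| <= 4 * B.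
    move=> x12; have [_ _ _ p4] := pB (z * x).
    rewrite mulNr mulrN normrN normrM (ger0_norm (sqr_ge0 z)).
    apply: le_trans (_ : 4 * `|(z * x) ^+ 3 * gauss_pdf (z * x)| <= _); last by lra.
    have -> : (z * x) ^+ 3 * gauss_pdf (z * x) =
      (z * x) ^+ 2 * (z * x * gauss_pdf (z * x)) by ring.
    rewrite [X in _ <= _ * X]normrM (ger0_norm (sqr_ge0 (z * x))) mulrA ler_wpM2r//.
    have x2 : 1 <= 4 * x ^+ 2 by nra.
    by have := ler_wpM2l (sqr_ge0 z) x2; rewrite [(z * x) ^+ 2]exprMn; lra.
  have t1 : `|gauss_cdf (z * q) - gauss_cdf (z * 1) - z * gauss_pdf (z * 1) * (q - 1)|
      <= 4 * B * (q - 1) ^+ 2.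
    exact: (@taylor1_bound R (fun x => gauss_cdf (z * x))
      (fun x => z * gauss_pdf (z * x))
      (fun x => z ^+ 2 * (- (z * x) * gauss_pdf (z * x)))
      1 q (4 * B) (fun x _ => dF x) (fun x _ => dF' x)
      (fun x xq => F2 x (rng x xq))).
  have t2 : `|z * gauss_pdf z * ((q - 1) + e / 2)| <= B * (2 * e ^+ 2).
    by rewrite normrM ler_pM.
  apply: le_trans (ler_normD _ _) _.
  apply: le_trans (lerD t1 t2) _.
  have qe3 : (q - 1) ^+ 2 <= e ^+ 2 by rewrite -sqrrN opprB ler_sqr ?nnegrE// subr_ge0.
  have ec : e ^+ 2 <= c ^+ 4 * delta ^+ 2.
    rewrite /e expr_div_n mulrC ler_wpM2r ?sqr_ge0// -exprVn r2 -exprM.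
    by rewrite lerXn2r ?nnegrE.
  have : 4 * B * (q - 1) ^+ 2 <= 4 * B * e ^+ 2 by rewrite ler_wpM2l// mulr_ge0.
  have : B * e ^+ 2 <= B * (c ^+ 4 * delta ^+ 2) by rewrite ler_wpM2l.
  by have := sqr_ge0 delta; nra.
Qed.

Lemma heat_ge0 theta w : 0 <= heat theta w.
Proof. exact: gauss_cdf_ge0. Qed.

Lemma heat_le1 theta w : heat theta w <= 1.
Proof. exact: gauss_cdf_le1. Qed.

Lemma measurable_heat theta : measurable_fun setT (heat theta).
Proof.
apply: (@measurableT_comp _ _ _ _ _ _ gauss_cdf); last exact: measurable_funM.
apply: nondecreasing_measurable => //; exact: gauss_cdf_nondecreasing.
Qed.

Lemma continuous_gauss_cdf : continuous (@gauss_cdf R).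
Proof.
move=> x; apply: differentiable_continuous; apply/derivable1_diffP.
by have [] := is_derive_gauss_cdf x.
Qed.

End heat_function.

(** * Integrals over product powers *)

Section product_power_integrals.
Context d (X : measurableType d) (R : realType).
Implicit Types (P Q : probability X R) (k q : X -> R) (n : nat).

Lemma tnth_cons_pair0 n (x : X) (y : n.-tuple X) :
  tnth (cons_pair (x, y)) ord0 = x.
Proof. by []. Qed.

Lemma tnth_cons_pairS n (x : X) (y : n.-tuple X) i :
  tnth (cons_pair (x, y)) (lift ord0 i) = tnth y i.
Proof. by rewrite !(tnth_nth x). Qed.

Lemma sum_cons_pair n (x : X) (y : n.-tuple X) k :
  \sum_(i < n.+1) k (tnth (cons_pair (x, y)) i) =
  k x + \sum_(i < n) k (tnth y i).
Proof.
rewrite big_ord_recl tnth_cons_pair0; congr (_ + _).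
by apply: eq_bigr => i _; rewrite tnth_cons_pairS.
Qed.

Lemma prod_cons_pair n (x : X) (y : n.-tuple X) k :
  \prod_(i < n.+1) k (tnth (cons_pair (x, y)) i) =
  k x * \prod_(i < n) k (tnth y i).
Proof.
rewrite big_ord_recl tnth_cons_pair0; congr (_ * _).
by apply: eq_bigr => i _; rewrite tnth_cons_pairS.
Qed.

Lemma measurable_cons_pair_comp n (F : n.+1.-tuple X -> \bar R) :
  measurable_fun setT F -> measurable_fun setT (F \o @cons_pair _ X n).
Proof. by move=> mF; apply: measurableT_comp => //; exact: measurable_cons_pair. Qed.

Lemma measurable_cons_pair2 n (x : X) :
  measurable_fun setT (fun y : n.-tuple X => cons_pair (x, y)).
Proof.
apply: (measurableT_comp (@measurable_cons_pair _ X n)).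
exact: measurable_pair1.
Qed.

Lemma measurable_sum_tnth n k : measurable_fun setT k ->
  measurable_fun setT (fun x : n.-tuple X => \sum_(i < n) k (tnth x i)).
Proof.
move=> mk; apply: measurable_sum => i.
by apply: measurableT_comp => //; exact: measurable_tnth.
Qed.

Lemma measurable_prod_tnth n k : measurable_fun setT k ->
  measurable_fun setT (fun x : n.-tuple X => \prod_(i < n) k (tnth x i)).
Proof.
move=> mk; apply: measurable_prod => i _.
by apply: measurableT_comp => //; exact: measurable_tnth.
Qed.

Lemma ge0_integral_prob_powerS P n (F : n.+1.-tuple X -> \bar R) :
  measurable_fun setT F -> (forall x, 0 <= F x)%E ->
  (\int[prob_power P n.+1]_x F x =
   \int[P]_x \int[prob_power P n]_y F (cons_pair (x, y)))%E.
Proof.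
move=> mF F0.
rewrite [LHS]ge0_integral_distribution// fubini_tonelli1//.
  exact: measurable_cons_pair_comp.
by move=> x; exact: F0.
Qed.

Lemma measurable_integral_prob_power P n (F : n.+1.-tuple X -> \bar R) :
  measurable_fun setT F -> (forall x, 0 <= F x)%E ->
  measurable_fun setT (fun x => \int[prob_power P n]_y F (cons_pair (x, y)))%E.
Proof.
move=> mF F0; apply: (@measurable_fun_fubini_tonelli_F _ _ _ _ _
  (prob_power P n) (F \o @cons_pair _ X n)) => //.
  exact: measurable_cons_pair_comp.
by move=> x; exact: F0.
Qed.

Lemma integral_prob_power0 P (F : 0.-tuple X -> \bar R) :
  measurable_fun setT F -> (forall x, 0 <= F x)%E ->
  (\int[prob_power P 0]_x F x = F [tuple])%E.
Proof. by move=> mF F0; rewrite /= integral_dirac// diracT mul1e. Qed.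

(* Lindeberg's replacement scheme: the functions [v m] are the successive
   smoothings of the test function [v 0]. *)
Lemma prob_power_sum_le Q k (v : nat -> R -> R) (e : R) : 0 <= e ->
  measurable_fun setT k -> (forall m, measurable_fun setT (v m)) ->
  (forall m w, 0 <= v m w) ->
  (forall m w, \int[Q]_x (v m (w + k x))%:E <= (v m.+1 w + e)%:E)%E ->
  forall n w, (\int[prob_power Q n]_x (v 0%N (w + \sum_(i < n) k (tnth x i)))%:E
    <= (v n w + n%:R * e)%:E)%E.
Proof.
move=> e0 mk mv v0 vQ; elim=> [|n IH] w.
  rewrite integral_prob_power0//.
  - by rewrite big_ord0 mul0r !addr0.
  - apply/measurable_EFinP/measurableT_comp => //; apply: measurable_funD => //.
    exact: measurable_sum_tnth.
  - by move=> x; rewrite lee_fin.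
rewrite ge0_integral_prob_powerS//; last 2 first.
- apply/measurable_EFinP/measurableT_comp => //; apply: measurable_funD => //.
  exact: measurable_sum_tnth.
- by move=> x; rewrite lee_fin.
(* The first coordinate is peeled off: the other [n] are replaced with starting point [w + k x], and
   [vQ] at index [n] then treats the first. *)
apply: (@le_trans _ _ (\int[Q]_x (v n (w + k x) + n%:R * e)%:E)%E).
  apply: ge0_le_integral => //.
  - by move=> x _; apply: integral_ge0 => y _; rewrite lee_fin.
  - apply: (@measurable_integral_prob_power Q n
      (fun x => (v 0 (w + \sum_(i < n.+1) k (tnth x i)))%:E)) => //.
    + apply/measurable_EFinP/measurableT_comp => //; apply: measurable_funD => //.
      exact: measurable_sum_tnth.
    + by move=> x; rewrite lee_fin.
  - apply/measurable_EFinP; apply: measurable_funD => //.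
    by apply: measurableT_comp => //; exact: measurable_funD.
  - move=> x _; under eq_integral do rewrite sum_cons_pair addrA.
    exact: IH.
under eq_integral do rewrite EFinD.
rewrite ge0_integralD//.
- rewrite integral_cst//= probability_setT mule1.
  apply: le_trans (leeD (vQ _ _) (lexx _)) _.
  by rewrite -EFinD lee_fin -natr1; lra.
- by move=> x _; rewrite lee_fin.
- by apply/measurable_EFinP/measurableT_comp => //; exact: measurable_funD.
- by move=> x _; rewrite lee_fin mulr_ge0.
Qed.

Lemma integral_prob_power_prod_le P q (c : R) : measurable_fun setT q ->
  (forall x, 0 <= q x) -> (\int[P]_x (q x)%:E <= c%:E)%E ->
  forall n, (\int[prob_power P n]_x (\prod_(i < n) q (tnth x i))%:E
    <= (c ^+ n)%:E)%E.
Proof.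
move=> mq q0 qc; have p0 n (x : n.-tuple X) : 0 <= \prod_(i < n) q (tnth x i).
  by apply: prodr_ge0.
have c0 : 0 <= c.
  by rewrite -lee_fin (le_trans _ qc)// integral_ge0// => x _; rewrite lee_fin.
elim=> [|n IH].
  rewrite integral_prob_power0//; first by rewrite big_ord0 expr0.
  - by apply/measurable_EFinP; exact: measurable_prod_tnth.
  - by move=> x; rewrite lee_fin.
rewrite ge0_integral_prob_powerS//; last 2 first.
- by apply/measurable_EFinP; exact: measurable_prod_tnth.
- by move=> x; rewrite lee_fin.
apply: (@le_trans _ _ (\int[P]_x ((q x)%:E * (c ^+ n)%:E))%E).
  apply: ge0_le_integral => //.
  - by move=> x _; apply: integral_ge0 => y _; rewrite lee_fin.
  - apply: (@measurable_integral_prob_power P n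
      (fun x => (\prod_(i < n.+1) q (tnth x i))%:E)) => //.
    + by apply/measurable_EFinP; exact: measurable_prod_tnth.
    + by move=> x; rewrite lee_fin.
  - by apply/measurable_EFinP; exact: measurable_funM.
  - move=> x _; under eq_integral do rewrite prod_cons_pair EFinM.
    rewrite ge0_integralZl//; first by rewrite lee_wpmul2l// lee_fin.
    + by apply/measurable_EFinP; exact: measurable_prod_tnth.
    + by move=> y _; rewrite lee_fin.
    + by rewrite lee_fin.
rewrite ge0_integralZr//.
- by rewrite exprS EFinM lee_wpmul2r// lee_fin exprn_ge0.
- exact/measurable_EFinP.
- by move=> x _; rewrite lee_fin.
- by rewrite lee_fin exprn_ge0.
Qed.

(** Tensorization: the inner integral over the last coordinates is again a test function with values
    in [0, 1], so each coordinate costs [beta] once, and a [q] of mass at most 1 does not amplify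
    the error collected so far. *)
Lemma integral_prob_power_dom P Q q (beta : R) : 0 <= beta ->
  measurable_fun setT q -> (forall x, 0 <= q x) ->
  (\int[P]_x (q x)%:E <= 1)%E ->
  (forall F : X -> R, measurable_fun setT F -> (forall x, 0 <= F x <= 1) ->
    (\int[Q]_x (F x)%:E <= \int[P]_x (F x * q x)%:E + beta%:E)%E) ->
  forall n (F : n.-tuple X -> R), measurable_fun setT F ->
   (forall x, 0 <= F x <= 1) ->
   (\int[prob_power Q n]_x (F x)%:E <=
    \int[prob_power P n]_x (F x * \prod_(i < n) q (tnth x i))%:E
    + (n%:R * beta)%:E)%E.
Proof.
move=> b0 mq q0 q1 Qq; have p0 n (x : n.-tuple X) : 0 <= \prod_(i < n) q (tnth x i).
  by apply: prodr_ge0.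
elim=> [|n IH] F mF F01.
  have F0 x : 0 <= F x by have /andP[] := F01 x.
  rewrite !integral_prob_power0//.
  - by rewrite big_ord0 mul0r mulr1 adde0.
  - apply/measurable_EFinP; apply: measurable_funM => //.
    exact: measurable_prod_tnth.
  - by move=> x; rewrite lee_fin mulr_ge0.
  - exact/measurable_EFinP.
have F0 x : 0 <= F x by have /andP[] := F01 x.
have mFc : measurable_fun setT (fun x => (F x)%:E) by exact/measurable_EFinP.
rewrite ge0_integral_prob_powerS//.
pose G x := (\int[prob_power Q n]_y (F (cons_pair (x, y)))%:E)%E.
have G0 x : (0 <= G x)%E by apply: integral_ge0 => y _; rewrite lee_fin.
have mF2 x : measurable_fun setT (fun y : n.-tuple X => F (cons_pair (x, y))).
  by apply: measurableT_comp => //; exact: measurable_cons_pair2.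
have G1 x : (G x <= 1)%E.
  apply: (@le_trans _ _ (\int[prob_power Q n]_y (cst 1%E y))%E); last first.
    by rewrite integral_cst// mul1e probability_le1.
  apply: ge0_le_integral => //.
  - by move=> y _; rewrite lee_fin.
  - exact/measurable_EFinP.
  - by move=> y _; rewrite lee_fin; have /andP[] := F01 (cons_pair (x, y)).
have Gfin x : G x \is a fin_num.
  by rewrite ge0_fin_numE// (le_lt_trans (G1 x))// ltry.
have mG : measurable_fun setT G.
  by apply: (@measurable_integral_prob_power Q n (EFin \o F)) => // x; rewrite lee_fin.
have -> : (\int[Q]_x G x = \int[Q]_x (fine (G x))%:E)%E.
  by apply: eq_integral => x _; rewrite fineK.
have mfG : measurable_fun setT (fine \o G) by apply: measurableT_comp.
apply: le_trans (Qq (fine \o G) mfG _) _.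
  by move=> x; rewrite -!lee_fin /= fineK// G0 G1.
rewrite -natr1 mulrDl mul1r EFinD addeA leeD2r//.
rewrite ge0_integral_prob_powerS//; last 2 first.
- by apply/measurable_EFinP/measurable_funM => //; exact: measurable_prod_tnth.
- by move=> x; rewrite lee_fin mulr_ge0.
pose H x := (\int[prob_power P n]_y (F (cons_pair (x, y)) *
  \prod_(i < n.+1) q (tnth (cons_pair (x, y)) i))%:E)%E.
have mH : measurable_fun setT H.
  apply: (@measurable_integral_prob_power P n
    (fun x => (F x * \prod_(i < n.+1) q (tnth x i))%:E)) => //.
  - by apply/measurable_EFinP/measurable_funM => //; exact: measurable_prod_tnth.
  - by move=> x; rewrite lee_fin mulr_ge0.
have H0 x : (0 <= H x)%E by apply: integral_ge0 => y _; rewrite lee_fin mulr_ge0.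
apply: (@le_trans _ _ (\int[P]_x (H x + (q x)%:E * (n%:R * beta)%:E))%E).
  apply: ge0_le_integral => //.
  - by move=> x _; rewrite lee_fin mulr_ge0// fine_ge0.
  - by apply/measurable_EFinP/measurable_funM.
  - by apply: emeasurable_funD => //; apply/measurable_EFinP; exact: measurable_funM.
  - move=> x _; rewrite EFinM /= fineK// muleC.
    have := IH (fun y => F (cons_pair (x, y))) (mF2 x) (fun y => F01 _).
    rewrite -/(G x) => /(lee_wpmul2l (q0 x : (0 <= (q x)%:E)%E)).
    move=> /le_trans; apply; rewrite ge0_muleDr//; last 2 first.
      by apply: integral_ge0 => y _; rewrite lee_fin mulr_ge0.
      by rewrite lee_fin mulr_ge0.
    rewrite leeD2r// -ge0_integralZl//; last 3 first.
      apply/measurable_EFinP; apply: measurable_funM => //.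
      exact: measurable_prod_tnth.
      by move=> y _; rewrite lee_fin mulr_ge0.
      by rewrite lee_fin.
    rewrite le_eqVlt; apply/orP; left; apply/eqP; apply: eq_integral => y _.
    by rewrite prod_cons_pair -EFinM mulrCA.
rewrite ge0_integralD//; last 2 first.
- by move=> x _; rewrite -EFinM lee_fin !mulr_ge0.
- by apply/measurable_EFinP; exact: measurable_funM.
rewrite leeD2l// ge0_integralZr//; last 3 first.
- exact/measurable_EFinP.
- by move=> x _; rewrite lee_fin.
- by rewrite lee_fin mulr_ge0.
by rewrite -[leRHS]mul1e lee_wpmul2r// lee_fin mulr_ge0.
Qed.

(* [1_A z <= L 1_A + z^2 / L] replaces the Cauchy-Schwarz inequality. *)
Lemma prob_power_dom P Q q (beta c L : R) : 0 <= beta -> 0 < L ->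
  measurable_fun setT q -> (forall x, 0 <= q x) ->
  (\int[P]_x (q x)%:E <= 1)%E -> (\int[P]_x (q x ^+ 2)%:E <= c%:E)%E ->
  (forall F : X -> R, measurable_fun setT F -> (forall x, 0 <= F x <= 1) ->
    (\int[Q]_x (F x)%:E <= \int[P]_x (F x * q x)%:E + beta%:E)%E) ->
  forall n (A : set (n.-tuple X)), measurable A ->
   (prob_power Q n A <=
    L%:E * prob_power P n A + (c ^+ n / L + n%:R * beta)%:E)%E.
Proof.
move=> b0 L0 mq q0 q1 q2 Qq n A mA.
have mI : measurable_fun setT (\1_A : n.-tuple X -> R) by exact: measurable_indic.
have I01 x : 0 <= (\1_A : n.-tuple X -> R) x <= 1.
  by rewrite indicE; case: (_ \in _); rewrite /= ?lexx ?ler01.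
have := integral_prob_power_dom b0 mq q0 q1 Qq mI I01.
rewrite integral_indic// setIT => /le_trans; apply.
rewrite EFinD addeA leeD2r//.
have -> : (L%:E * prob_power P n A)%E =
    (\int[prob_power P n]_x (L%:E * (\1_A x)%:E))%E.
  rewrite ge0_integralZl//.
  - by rewrite integral_indic// setIT.
  - exact/measurable_EFinP.
  - by rewrite lee_fin ltW.
have p0 (x : n.-tuple X) : 0 <= \prod_(i < n) q (tnth x i) by apply: prodr_ge0.
pose Z x := \prod_(i < n) q (tnth x i) ^+ 2.
have Z0 (x : n.-tuple X) : 0 <= Z x by apply: prodr_ge0 => i _; exact: sqr_ge0.
have mZ : measurable_fun setT Z.
  by apply: (measurable_prod_tnth (k := fun x => q x ^+ 2)); exact: measurable_funX.
apply: (@le_trans _ _ (\int[prob_power P n]_x (L%:E * (\1_A x)%:E) +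
    \int[prob_power P n]_x (L^-1%:E * (Z x)%:E))%E); last first.
  rewrite leeD2l// ge0_integralZl//; last 3 first.
    exact/measurable_EFinP.
    by move=> x _; rewrite lee_fin.
    by rewrite lee_fin invr_ge0 ltW.
  rewrite mulrC EFinM lee_wpmul2l// ?lee_fin ?invr_ge0 ?(ltW L0)//.
  apply: (integral_prob_power_prod_le (q := fun x => q x ^+ 2)) => //.
  - exact: measurable_funX.
  - by move=> x; exact: sqr_ge0.
rewrite -ge0_integralD//; last 4 first.
- by move=> x _; rewrite -EFinM lee_fin mulr_ge0 ?(ltW L0).
- by apply/measurable_EFinP/measurable_funM.
- by move=> x _; rewrite -EFinM lee_fin mulr_ge0 ?invr_ge0 ?(ltW L0).
- by apply/measurable_EFinP/measurable_funM.
apply: ge0_le_integral => //.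
- by move=> x _; rewrite lee_fin mulr_ge0.
- by apply/measurable_EFinP/measurable_funM => //; exact: measurable_prod_tnth.
- by apply/measurable_EFinP/measurable_funD; exact: measurable_funM.
move=> x _; rewrite -!EFinM -EFinD lee_fin.
rewrite /Z prodrXl; move: (p0 x); move: (\prod_(i < n) _) => z z0.
have iL : 0 <= L^-1 by rewrite invr_ge0 ltW.
rewrite indicE; case: (x \in A) => /=; rewrite ?mul0r ?mulr0 ?mul1r ?mulr1 ?add0r.
  have := mulfV (lt0r_neq0 L0); have [zL|Lz] := leP z L; first nra.
  have : z * 1 <= z * (L^-1 * z) by rewrite ler_wpM2l// mulrC ler_pdivlMr// mul1r ltW.
  by nra.
by rewrite mulr_ge0// sqr_ge0.
Qed.

End product_power_integrals.

(** * Hellinger expansions *)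

Section nonnegative_Rintegral.
Context d (T : measurableType d) (R : realType).
Variable mu : {measure set T -> \bar R}.
Implicit Types f g : T -> R.

Lemma EFin_Rintegral f : mu.-integrable setT (EFin \o f) ->
  (\int[mu]_x f x)%:E = (\int[mu]_x (f x)%:E)%E.
Proof. by move=> fi; rewrite /Rintegral fineK//; exact: integrable_fin_num. Qed.

Lemma ge0_integrable_le f (c : R) : measurable_fun setT f ->
  (forall x, 0 <= f x) -> (\int[mu]_x (f x)%:E <= c%:E)%E ->
  mu.-integrable setT (EFin \o f).
Proof.
move=> mf f0 fc; apply/integrableP; split; first exact/measurable_EFinP.
apply: le_lt_trans (ltry c); apply: le_trans fc.
by under eq_integral do rewrite /= ger0_norm//.
Qed.

Lemma ge0_le_integralR f g : measurable_fun setT f -> measurable_fun setT g ->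
  (forall x, 0 <= f x <= g x) ->
  (\int[mu]_x (f x)%:E <= \int[mu]_x (g x)%:E)%E.
Proof.
move=> mf mg fg; apply: ge0_le_integral => //.
- by move=> x _; rewrite lee_fin; have /andP[] := fg x.
- exact/measurable_EFinP.
- exact/measurable_EFinP.
- by move=> x _; rewrite lee_fin; have /andP[] := fg x.
Qed.

End nonnegative_Rintegral.

Section sqrt_density_theory.
Context d (X : measurableType d) (R : realType).
Implicit Types (P Q M : probability X R).

Lemma measurable_sqrt_density P Q M : M `<< prob_add P Q ->
  measurable_fun setT (sqrt_density P Q M).
Proof.
move=> MPQ; apply: (@measurableT_comp _ _ _ _ _ _ (@Num.sqrt R)).
  exact: (continuous_measurable_fun (@sqrt_continuous R)).
by apply: measurableT_comp => //; apply: measurable_int.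
Qed.

Lemma sqrt_density_ge0 P Q M x : 0 <= sqrt_density P Q M x.
Proof. exact: sqrtr_ge0. Qed.

Lemma ge0_integral_sqrt_density P Q M (F : X -> R) : M `<< prob_add P Q ->
  measurable_fun setT F -> (forall x, 0 <= F x) ->
  (\int[M]_x (F x)%:E =
   \int[prob_add P Q]_x (F x * sqrt_density P Q M x ^+ 2)%:E)%E.
Proof.
move=> MPQ mF F0; have ma := measurable_sqrt_density MPQ.
(* Change of variables speaks of the derivative between measures, finite and nonnegative everywhere;
   the charge derivative inside [sqrt_density] agrees with it only almost everywhere. *)
rewrite -(@Radon_Nikodym_SigmaFinite.change_of_variables _ _ _ M (prob_add P Q))//; last first.
  exact/measurable_EFinP.
have mRN : measurable_fun setT (Radon_Nikodym_SigmaFinite.f M (prob_add P Q)).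
  exact: measurable_int (Radon_Nikodym_SigmaFinite.f_integrable _).
apply: ae_eq_integral => //.
- by apply: emeasurable_funM => //; exact/measurable_EFinP.
- by apply/measurable_EFinP/measurable_funM => //; exact: measurable_funX.
have := ae_eq_Radon_Nikodym_SigmaFinite MPQ (@measurableT _ X).
apply: filterS => x /= /(_ I) E _.
rewrite EFinM /sqrt_density -E sqr_sqrtr ?fine_ge0 ?Radon_Nikodym_SigmaFinite.f_ge0//.
by rewrite fineK//; exact: Radon_Nikodym_SigmaFinite.f_fin_num.
Qed.

End sqrt_density_theory.

Section hellinger.
Context d (X : measurableType d) (R : realType).
Implicit Types (P Q : probability X R) (g h : X -> R).

Lemma integral1_probability P : (\int[P]_x (1 : R)%:E = 1)%E.
Proof. by rewrite integral_cst// mul1e; exact: probability_setT. Qed.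

(** For [-1 <= h], the density [(1 + h)^2] set to 0 where it exceeds 4. Boundedness makes its
    square, and its product with [k ^+ 2], integrable. *)
Definition cut_density h x : R := if h x <= 1 then (1 + h x) ^+ 2 else 0.

(** Its integral, multiplied by [2 * s ^+ 2], bounds the mass lost to the cut up to a multiple of
    the squared Hellinger remainder. *)
Definition cut_tail h g x : R := if 1 < h x then g x ^+ 2 else 0.

Lemma measurable_cut_density h : measurable_fun setT h ->
  measurable_fun setT (cut_density h).
Proof.
move=> mh; apply: measurable_fun_ifT => //.
  exact: measurable_fun_ler.
by apply: measurable_funX; exact: measurable_funD.
Qed.

Lemma measurable_cut_tail h g : measurable_fun setT h -> measurable_fun setT g ->
  measurable_fun setT (cut_tail h g).
Proof.
move=> mh mg; apply: measurable_fun_ifT => //.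
  exact: measurable_fun_ltr.
exact: measurable_funX.
Qed.

Lemma cut_density_ge0 h x : 0 <= cut_density h x.
Proof. by rewrite /cut_density; case: ifPn => // _; exact: sqr_ge0. Qed.

(* With [a], [b] the square root densities of [P], [Q], take [h = b / a - 1]
   (equal to [-1] where [a = 0]). *)
Lemma hellinger_density P Q g (s : R) : L2 P g ->
  exists2 rho : R, sqrt_remainder P Q g s = (Num.sqrt rho)%:E & 0 <= rho /\
  exists h, [/\ L2 P h, forall x, -1 <= h x,
   \int[P]_x (h x - s * g x / 2) ^+ 2 <= rho,
   \int[P]_x (1 + h x) ^+ 2 <= 1 &
   forall F : X -> R, measurable_fun setT F -> (forall x, 0 <= F x <= 1) ->
     \int[P]_x (F x * cut_density h x) <= \int[Q]_x F x /\
     \int[Q]_x F x <= \int[P]_x (F x * cut_density h x)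
        + (8 * rho + 2 * s ^+ 2 * \int[P]_x cut_tail h g x)].
Proof.
move=> gL2; have [mg ig] := gL2.
pose nu := prob_add P Q.
pose a := sqrt_density P Q P; pose b := sqrt_density P Q Q.
have PN := @prob_add_dominatesl _ _ _ P Q.
have QN := @prob_add_dominatesr _ _ _ P Q.
have ma : measurable_fun setT a := measurable_sqrt_density PN.
have mb : measurable_fun setT b := measurable_sqrt_density QN.
have a0 x : 0 <= a x by exact: sqrt_density_ge0.
have b0 x : 0 <= b x by exact: sqrt_density_ge0.
have cP F := @ge0_integral_sqrt_density _ _ _ P Q P F PN.
have cQ F := @ge0_integral_sqrt_density _ _ _ P Q Q F QN.
pose r x := b x - (1 + s * g x / 2) * a x.
have L2a : L2 nu a.
  split => //; apply: (@ge0_integrable_le _ _ _ nu _ 1).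
  - exact: measurable_funX.
  - by move=> x; exact: sqr_ge0.
  - have := cP (cst 1) (measurable_cst _) (fun=> ler01).
    rewrite /= integral1_probability => ->.
    by under [leRHS]eq_integral do rewrite mul1r.
have L2b : L2 nu b.
  split => //; apply: (@ge0_integrable_le _ _ _ nu _ 1).
  - exact: measurable_funX.
  - by move=> x; exact: sqr_ge0.
  - have := cQ (cst 1) (measurable_cst _) (fun=> ler01).
    rewrite /= integral1_probability => ->.
    by under [leRHS]eq_integral do rewrite mul1r.
have L2ga : L2 nu (fun x => g x * a x).
  split; first exact: measurable_funM.
  apply: (@ge0_integrable_le _ _ _ nu _ (\int[P]_x g x ^+ 2)).
  - by apply: measurable_funX; exact: measurable_funM.
  - by move=> x; exact: sqr_ge0.
  - rewrite EFin_Rintegral// cP//; last 2 first.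
      exact: measurable_funX.
      by move=> x; exact: sqr_ge0.
    by under eq_integral do rewrite exprMn.
have L2r : L2 nu r.
  have := L2D 1 (- (s / 2)) (L2B L2b L2a) L2ga.
  by congr L2; apply/funext => x; rewrite /r; field.
exists (\int[nu]_x r x ^+ 2).
  by rewrite /sqrt_remainder -/nu L2_normL2.
split; first by apply: Rintegral_ge0 => x _; exact: sqr_ge0.
pose h x := b x / a x - 1.
have mh : measurable_fun setT h.
  rewrite (_ : h = (fun x => b x * a x `^ (-1) - 1)).
    apply: measurable_funB => //; apply: measurable_funM => //.
    exact: (measurableT_comp (measurable_powR (-1))).
  by apply/funext => x; rewrite /h powR_inv1.
have h1 x : -1 <= h x by rewrite lerBrDr addNr divr_ge0.
(* An equality off [a = 0]; on that set the left side vanishes, while [b] carries the part of [Q]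
   singular to [P]. *)
have hb x : (1 + h x) ^+ 2 * a x ^+ 2 <= b x ^+ 2.
  rewrite /h addrC subrK; have [->|an0] := eqVneq (a x) 0.
    by rewrite expr0n/= mulr0 sqr_ge0.
  by rewrite expr_div_n divfK// expf_neq0.
have i1 : (\int[P]_x ((1 + h x) ^+ 2)%:E <= 1)%E.
  have m1 : measurable_fun setT (fun x => (1 + h x) ^+ 2).
    by apply: measurable_funX; exact: measurable_funD.
  rewrite cP//; last by move=> x; exact: sqr_ge0.
  rewrite -(integral1_probability Q).
  rewrite (cQ (cst 1))//; apply: ge0_le_integralR.
  - by apply: measurable_funM => //; exact: measurable_funX.
  - by apply: measurable_funM => //; exact: measurable_funX.
  - by move=> x; rewrite mul1r mulr_ge0 ?sqr_ge0//= hb.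
have L2h1 : L2 P (fun x => 1 + h x).
  split; first exact: measurable_funD.
  apply: (ge0_integrable_le (c := 1)) => //.
    by apply: measurable_funX; exact: measurable_funD.
  by move=> x; exact: sqr_ge0.
have L2h : L2 P h.
  have := L2B L2h1 (L2_cst P 1).
  by congr L2; apply/funext => x /=; ring.
have hr x : (h x - s * g x / 2) ^+ 2 * a x ^+ 2 <= r x ^+ 2.
  have [->|an0] := eqVneq (a x) 0; first by rewrite expr0n/= mulr0 sqr_ge0.
  rewrite le_eqVlt; apply/orP; left; apply/eqP; rewrite -exprMn; congr (_ ^+ 2).
  by rewrite /h /r; field.
exists h; split => //.
- rewrite -lee_fin !EFin_Rintegral//; last 2 first.
    by case: L2r.
    have [_] := L2B L2h (L2Z (s / 2) gL2).
    by congr (integrable _ _ _); apply/funext => x /=; congr ((_ - _) ^+ 2)%:E; ring.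
  have m2 : measurable_fun setT (fun x => (h x - s * g x / 2) ^+ 2).
    apply: measurable_funX; apply: measurable_funB => //.
    by apply: measurable_funM => //; exact: measurable_funM.
  rewrite cP//; last by move=> x; exact: sqr_ge0.
  apply: ge0_le_integralR.
  - by apply: measurable_funM => //; exact: measurable_funX.
  - by apply: measurable_funX; case: L2r.
  - by move=> x; rewrite mulr_ge0 ?sqr_ge0//= hr.
- by rewrite -lee_fin EFin_Rintegral//; case: L2h1.
move=> F mF F01.
have F0 x : 0 <= F x by have /andP[] := F01 x.
have mc := measurable_cut_density mh.
have mt := measurable_cut_tail mh mg.
have c0 := cut_density_ge0 h.
have t0 x : 0 <= cut_tail h g x.
  by rewrite /cut_tail; case: ifPn => // _; exact: sqr_ge0.
have cb x : cut_density h x * a x ^+ 2 <= b x ^+ 2.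
  by rewrite /cut_density; case: ifPn => // _; rewrite mul0r sqr_ge0.
(* Where [1 < h], [b > 2 * a] gives [b ^+ 2 <= 4 * (b - a) ^+ 2], and [b - a = s * g / 2 * a + r]
   yields the constants 8 and 2. Where [a = 0], [r = b], so the singular part is paid for by the
   remainder. *)
have bc x : b x ^+ 2 <= cut_density h x * a x ^+ 2 + 8 * r x ^+ 2 +
    2 * s ^+ 2 * (cut_tail h g x * a x ^+ 2).
  rewrite /cut_density /cut_tail; have [hx|hx] := leP (h x) 1.
    have [ax|ax] := eqVneq (a x) 0.
      by rewrite /r ax !mulr0 expr0n/= !mulr0 subr0; have := sqr_ge0 (b x); lra.
    have -> : (1 + h x) ^+ 2 * a x ^+ 2 = b x ^+ 2.
      by rewrite /h addrC subrK expr_div_n divfK// expf_neq0.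
    by rewrite mul0r mulr0 addr0 lerDl mulr_ge0// sqr_ge0.
  rewrite mul0r add0r.
  have ax : 0 < a x.
    rewrite lt_neqAle a0 andbT; apply/eqP => ax; move: hx.
    by rewrite /h -ax invr0 mulr0; lra.
  have ba : 2 * a x < b x by move: hx; rewrite /h -ltr_pdivlMr//; lra.
  have E : b x - a x = s * g x / 2 * a x + r x by rewrite /r; ring.
  have : b x ^+ 2 <= 4 * (b x - a x) ^+ 2 by have := a0 x; nra.
  rewrite E; have := sqr_ge0 (s * g x / 2 * a x - r x); nra.
have iF : Q.-integrable setT (EFin \o F).
  by apply: (@integrable_bounded _ _ _ _ _ 1) => // x; rewrite ger0_norm//; have /andP[] := F01 x.
have ic : P.-integrable setT (EFin \o (fun x => F x * cut_density h x)).
  apply: (@integrable_bounded _ _ _ _ _ 4) => [|x]; first exact: measurable_funM.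
  rewrite normrM !ger0_norm// -[4]mul1r ler_pM//; first by have /andP[] := F01 x.
  by rewrite /cut_density; case: ifPn => // hx; have := h1 x; nra.
have it : P.-integrable setT (EFin \o cut_tail h g).
  apply: (@integrable_dom _ _ _ _ _ (fun x => g x ^+ 2)) => // x.
  by rewrite ger0_norm// /cut_tail; case: ifPn => // _; exact: sqr_ge0.
have mFc : measurable_fun setT (fun x => F x * cut_density h x * a x ^+ 2).
  by apply: measurable_funM => //; [exact: measurable_funM|exact: measurable_funX].
have mFb : measurable_fun setT (fun x => F x * b x ^+ 2).
  by apply: measurable_funM => //; exact: measurable_funX.
split.
  rewrite -lee_fin !EFin_Rintegral// cP//; last 2 first.
    exact: measurable_funM.
    by move=> x; rewrite mulr_ge0.
  rewrite cQ//; apply: ge0_le_integralR => // x.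
  rewrite -mulrA ler_wpM2l// andbT !mulr_ge0 ?sqr_ge0//.
rewrite -lee_fin !EFinD !EFinM !EFin_Rintegral//; last by case: L2r.
rewrite cQ// cP//; last 2 first.
  exact: measurable_funM.
  by move=> x; rewrite mulr_ge0.
rewrite (cP (cut_tail h g))//.
have mr2 : measurable_fun setT (fun x => r x ^+ 2).
  by apply: measurable_funX; case: L2r.
have mta : measurable_fun setT (fun x => cut_tail h g x * a x ^+ 2).
  by apply: measurable_funM => //; exact: measurable_funX.
have s20 : 0 <= 2 * s ^+ 2 :> R := mulr_ge0 (ler0n _ 2) (sqr_ge0 s).
have ta0 x : 0 <= cut_tail h g x * a x ^+ 2 := mulr_ge0 (t0 x) (sqr_ge0 _).
have sta0 x : 0 <= 2 * s ^+ 2 * (cut_tail h g x * a x ^+ 2) := mulr_ge0 s20 (ta0 x).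
have r20 x : 0 <= 8 * r x ^+ 2 := mulr_ge0 (ler0n _ 8) (sqr_ge0 (r x)).
have Fca0 x : 0 <= F x * cut_density h x * a x ^+ 2.
  exact: mulr_ge0 (mulr_ge0 (F0 x) (c0 x)) (sqr_ge0 _).
rewrite -ge0_integralZl//; last 2 first.
- exact/measurable_EFinP.
- by move=> x _; rewrite lee_fin sqr_ge0.
rewrite -!EFinM -ge0_integralZl//; last 2 first.
- exact/measurable_EFinP.
- by move=> x _; rewrite lee_fin; exact: ta0.
rewrite -ge0_integralD//; last 4 first.
- by move=> x _; rewrite lee_fin; exact: r20.
- by apply/measurable_EFinP/measurable_funM.
- by move=> x _; rewrite lee_fin; exact: sta0.
- by apply/measurable_EFinP/measurable_funM.
rewrite -ge0_integralD//; last 4 first.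
- by move=> x _; rewrite lee_fin; exact: Fca0.
- exact/measurable_EFinP.
- by move=> x _; rewrite lee_fin; exact: addr_ge0 (r20 x) (sta0 x).
- by apply/measurable_EFinP/measurable_funD; exact: measurable_funM.
apply: ge0_le_integralR => //.
  apply: measurable_funD => //.
  by apply/measurable_funD; exact: measurable_funM.
move=> x; rewrite mulr_ge0 ?sqr_ge0//=.
have /andP[_ F1] := F01 x.
have := ler_wpM2l (F0 x) (bc x); have := sqr_ge0 (r x).
have := ler_wpM2r (r20 x) F1; have := ler_wpM2r (sta0 x) F1.
rewrite !mulrDr !mul1r -!mulrA -/a -/b; lra.
Qed.

End hellinger.

(** * Moments of the cut density *)

Section tails.
Context d (X : measurableType d) (R : realType).
Variable P : probability X R.
Implicit Types (g h k : X -> R).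

Definition sq_tail (K : R) k x : R := if K < `|k x| then k x ^+ 2 else 0.

Lemma sq_tail_ge0 K k x : 0 <= sq_tail K k x.
Proof. by rewrite /sq_tail; case: ifPn => // _; exact: sqr_ge0. Qed.

Lemma measurable_sq_tail K k : measurable_fun setT k ->
  measurable_fun setT (sq_tail K k).
Proof.
move=> mk; apply: measurable_fun_ifT => //.
  by apply: measurable_fun_ltr => //; exact: measurableT_comp.
exact: measurable_funX.
Qed.

Lemma integrable_sq_tail K k : L2 P k ->
  P.-integrable setT (EFin \o sq_tail K k).
Proof.
move=> [mk ik]; apply: (integrable_dom _ ik); first exact: measurable_sq_tail.
move=> x; rewrite ger0_norm ?sq_tail_ge0// /sq_tail.
by case: ifPn => // _; exact: sqr_ge0.
Qed.

(** Lindeberg's condition for one fixed function, by dominated convergence: each [x] leaves the tail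
    as soon as [n >= |k x|]. *)
Lemma sq_tail_small k (e : R) : L2 P k -> 0 < e ->
  exists2 K, 0 <= K & \int[P]_x sq_tail K k x <= e.
Proof.
move=> k2 e0; have [mk ik] := k2.
have f_f : {ae P, forall x, [set: X] x ->
    (sq_tail n%:R k x)%:E @[n --> \oo] --> (0 : \bar R)}.
  apply: nearW => x _; apply: cvg_near_cst.
  near=> n; rewrite /sq_tail ifF//; apply/negbTE; rewrite -leNgt.
  near: n; exact: nbhs_infty_ger.
have f_g : {ae P, forall x n, [set: X] x ->
    (`|(sq_tail n%:R k x)%:E| <= (k x ^+ 2)%:E)%E}.
  apply: nearW => x n _; rewrite /= lee_fin ger0_norm ?sq_tail_ge0// /sq_tail.
  by case: ifPn => // _; exact: sqr_ge0.
have [_ _] := dominated_convergence measurableT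
   (fun n => (measurable_EFinP _ _).2 (measurable_sq_tail n%:R mk))
   (measurable_cst _) f_f ik f_g.
rewrite integral0 => cv.
have {}cv : (\int[P]_x sq_tail n%:R k x) @[n --> \oo] --> (0 : R).
  by apply: fine_cvg.
have : \forall n \near \oo, \int[P]_x sq_tail n%:R k x <= e.
  near=> n; apply: ltW; near: n.
  by apply: (cvgr_lt _ cv).
by move=> [N _ /(_ N (leqnn N)) HN]; exists N%:R.
Unshelve. all: by end_near. Qed.

End tails.

Section cut_density_estimates.
Context d (X : measurableType d) (R : realType).
Variables (P : probability X R) (h g k : X -> R).
Hypotheses (h2 : L2 P h) (g2 : L2 P g) (k2 : L2 P k).
Hypothesis h1 : forall x, -1 <= h x.
Let q := cut_density h.
Let H := \int[P]_x h x ^+ 2.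

Let mh : measurable_fun setT h. Proof. by case: h2. Qed.
Let mg : measurable_fun setT g. Proof. by case: g2. Qed.
Let mk : measurable_fun setT k. Proof. by case: k2. Qed.
Let ih2 : P.-integrable setT (EFin \o (fun x => h x ^+ 2)). Proof. by case: h2. Qed.
Let ig2 : P.-integrable setT (EFin \o (fun x => g x ^+ 2)). Proof. by case: g2. Qed.
Let ik2 : P.-integrable setT (EFin \o (fun x => k x ^+ 2)). Proof. by case: k2. Qed.
Let ih : P.-integrable setT (EFin \o h). Proof. exact: L2_integrable. Qed.
Let ik : P.-integrable setT (EFin \o k). Proof. exact: L2_integrable. Qed.
Let ikh : P.-integrable setT (EFin \o (fun x => k x * h x)). Proof. exact: L2_mul. Qed.
Let i1 : P.-integrable setT (EFin \o cst 1). Proof. exact: integrable_cst. Qed.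

Lemma Rintegral1_probability (Q : probability X R) : \int[Q]_x (1 : R) = 1.
Proof. by rewrite /Rintegral integral1_probability. Qed.

Let mq : measurable_fun setT q. Proof. exact: measurable_cut_density. Qed.

Lemma cut_density_le4 x : 0 <= q x <= 4.
Proof.
by rewrite cut_density_ge0/= /q /cut_density; case: ifPn => // hx; have := h1 x; nra.
Qed.

Let q4 x : `|q x| <= 4.
Proof. by rewrite ger0_norm ?cut_density_ge0//; have /andP[] := cut_density_le4 x. Qed.

Lemma integrable_cut_density : P.-integrable setT (EFin \o q).
Proof. exact: integrable_bounded q4. Qed.

Lemma L2_cut_density : L2 P q.
Proof. by apply: L2_dom (L2_cst P 4) _ => // x /=; rewrite [leRHS]ger0_norm. Qed.

Lemma integrable_mul_cut_density (f : X -> R) :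
  P.-integrable setT (EFin \o f) -> P.-integrable setT (EFin \o (fun x => f x * q x)).
Proof.
move=> fi; have mf : measurable_fun setT f.
  by apply/measurable_EFinP; exact: measurable_int fi.
apply: (integrable_dom (g := fun x => 4 * `|f x|)).
- exact: measurable_funM.
- have := integrableZl measurableT 4 (integrable_norm fi).
  by [].
- by move=> x; rewrite normrM mulrC ler_wpM2r.
Qed.

(** For [|h| <= 1], [(1 + h)^4 = 1 + 4 h + h^2 (6 + 4 h + h^2)] with a bracket at most 11. The
    linear term keeps its sign: along a path [\int h] is at most [- H / 2], whereas the integral of
    [|h|] is controlled only to order [n^(-1/2)]. *)
Lemma cut_density_sq_le : \int[P]_x q x ^+ 2 <= 1 + 4 * (\int[P]_x h x) + 11 * H.
Proof.
have := @le_Rintegral_lincomb _ _ _ P (fun x => q x ^+ 2)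
  [:: (1, cst 1); (4, h); (11, fun x => h x ^+ 2)] _ _ _.
rewrite /= Rintegral1_probability !addr0 mulr1 addrA; apply.
- by case: L2_cut_density.
- by do 3 split => //.
- move=> x; rewrite /q /cut_density; case: ifPn => hx; have := h1 x; last by nra.
  move=> h1x; have hh : h x ^+ 2 <= 1 by nra.
  have := sqr_ge0 (h x); move: hx h1x hh; move: (h x) => y y1 y2 y3 y4.
  have -> : (1 + y) ^+ 2 ^+ 2 = 1 + 4 * y + 6 * y ^+ 2 + y ^+ 2 * (4 * y + y ^+ 2) by ring.
  have : y ^+ 2 * (4 * y + y ^+ 2) <= y ^+ 2 * 5 by rewrite ler_wpM2l//; lra.
  lra.
Qed.

(** A Chebyshev bound: where [1 < h] and [|g| <= K], [g ^+ 2] is at most [K ^+ 2 * h ^+ 2]. *)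
Lemma cut_tail_le (K : R) : 0 <= K ->
  \int[P]_x cut_tail h g x <= \int[P]_x sq_tail K g x + K ^+ 2 * H.
Proof.
move=> K0; have := @le_Rintegral_lincomb _ _ _ P (cut_tail h g)
  [:: (1, sq_tail K g); (K ^+ 2, fun x => h x ^+ 2)] _ _ _.
rewrite /= !addr0 mul1r; apply.
- apply: (integrable_dom _ ig2); first exact: measurable_cut_tail.
  by move=> x; rewrite /cut_tail; case: ifPn => _; rewrite ?normr0 ?ger0_norm ?sqr_ge0.
- by split; [exact: integrable_sq_tail|].
- move=> x; rewrite mul1r /cut_tail /sq_tail addr0; case: ifPn => hx; last first.
    apply: addr_ge0; last exact: mulr_ge0 (sqr_ge0 _) (sqr_ge0 _).
    by case: ifPn => // _; exact: sqr_ge0.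
  case: ifPn => gK; first by rewrite lerDl; exact: mulr_ge0 (sqr_ge0 _) (sqr_ge0 _).
  rewrite add0r; rewrite -leNgt in gK; apply: le_trans (_ : K ^+ 2 * 1 <= _).
    by rewrite mulr1 -(real_normK (num_real (g x))) ler_sqr ?nnegrE.
  by rewrite ler_wpM2l ?sqr_ge0//; nra.
Qed.

(** The linearization error is [h ^+ 2] below the cut and [1 + 2 * h] above it. The linear bound
    serves on the tail of [k], the quadratic one where [k] is bounded. *)
Let q12 x : `|q x - 1 - 2 * h x| <= 3 * `|h x| /\
  `|q x - 1 - 2 * h x| <= 3 * h x ^+ 2.
Proof.
rewrite /q /cut_density; have := h1 x; move: (h x) => y y1; case: ifPn => y2.
  have -> : (1 + y) ^+ 2 - 1 - 2 * y = y ^+ 2 by ring.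
  rewrite ger0_norm ?sqr_ge0//; split; last by have := sqr_ge0 y; lra.
  have y3 : `|y| <= 1 by rewrite ler_norml y1.
  rewrite -(real_normK (num_real y)); move: (normr_ge0 y) y3.
  by move: `|y| => z z0 z1; nra.
rewrite -ltNge in y2.
have -> : `|0 - 1 - 2 * y| = 1 + 2 * y by rewrite ler0_norm; lra.
have -> : `|y| = y by rewrite ger0_norm//; lra.
by have := sqr_ge0 (y - 1); split; nra.
Qed.

Let q1 x : `|q x - 1| <= 3 /\ `|q x - 1| <= 3 * `|h x|.
Proof.
split; first by have := cut_density_le4 x; rewrite ler_norml; lra.
rewrite /q /cut_density; have := h1 x; move: (h x) => y y1; case: ifPn => y2.
  have -> : (1 + y) ^+ 2 - 1 = y * (y + 2) by ring.
  rewrite normrM mulrC ler_wpM2r// ger0_norm; lra.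
rewrite -ltNge in y2.
by rewrite sub0r normrN normr1 ger0_norm; lra.
Qed.

(** Where [|k| <= K] the quadratic bound of [q12] gives [K * h ^+ 2]; on the tail the product
    [|k| * |h|] is split with weight [a]. The weight is left free because the two parts have
    different orders in [n]; it is later proportional to [Num.sqrt n%:R]. *)
Lemma cut_density_moment1 (K a : R) : 0 <= K -> 0 < a ->
  `|\int[P]_x (k x * q x) - \int[P]_x k x - 2 * (\int[P]_x (k x * h x))|
   <= 3 * (K * H + (\int[P]_x sq_tail K k x) / a + a * H).
Proof.
move=> K0 a0.
have ikq := integrable_mul_cut_density ik.
pose f x := k x * (q x - 1 - 2 * h x).
have fE x : f x = lincomb [:: (1, fun x => k x * q x); (-1, k); (-2, fun x => k x * h x)] x.
  by rewrite /f /=; ring.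
have fi : P.-integrable setT (EFin \o f) by apply: eq_integrable_lincomb fE => /=.
have -> : \int[P]_x (k x * q x) - \int[P]_x k x - 2 * (\int[P]_x (k x * h x)) =
   \int[P]_x f x.
  by rewrite (eq_Rintegral_lincomb _ fE)//=; ring.
apply: le_trans (le_normr_Rintegral _ fi) _ => //.
have := @le_Rintegral_lincomb _ _ _ P (fun x => `|f x|)
  [:: (3 * K + 3 * a, fun x => h x ^+ 2); (3 / a, sq_tail K k)] _ _ _.
rewrite /= addr0 -/H => le; apply: le_trans (le _ _ _) _.
- exact: integrable_norm fi.
- by split=> //; split=> //; exact: integrable_sq_tail.
- move=> x; have [u1 u2] := q12 x; rewrite /f normrM /sq_tail addr0.
  have hn := real_normK (num_real (h x)); have kn := real_normK (num_real (k x)).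
  move: u1 u2; rewrite -hn -kn; move: (normr_ge0 (k x)) (normr_ge0 (h x)).
  move: (normr_ge0 (q x - 1 - 2 * h x)).
  move: `|k x| `|h x| `|q x - _ - _| => kx hx u u0 k0 h0 u1 u2.
  case: ifPn => [Kk|]; last first.
    rewrite -leNgt mulr0 addr0 => kK.
    apply: le_trans (_ : K * (3 * hx ^+ 2) <= _); first exact: ler_pM.
    by have : 0 <= a * hx ^+ 2 := mulr_ge0 (ltW a0) (sqr_ge0 _); lra.
  apply: le_trans (_ : kx * (3 * hx) <= _); first exact: ler_wpM2l.
  have : 0 <= K * hx ^+ 2 := mulr_ge0 K0 (sqr_ge0 _).
  have -> : 3 / a * kx ^+ 2 = 3 * (kx ^+ 2 / a) by ring.
  have : 0 <= (kx - a * hx) ^+ 2 / a by rewrite divr_ge0 ?sqr_ge0// ltW.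
  have -> : (kx - a * hx) ^+ 2 / a = kx ^+ 2 / a - 2 * (kx * hx) + a * hx ^+ 2.
    by field; rewrite gt_eqF.
  have : 0 <= kx ^+ 2 / a by rewrite divr_ge0 ?sqr_ge0// ltW.
  by have := sqr_ge0 hx; nra.
- by rewrite le_eqVlt; apply/orP; left; apply/eqP; ring.
Qed.

(** [|q - 1|] is at most 3 on the tail of [k]; elsewhere it is at most [3 * |h|], and
    [|h| <= a + h ^+ 2 / a] avoids the square root of [H]. *)
Lemma cut_density_moment2 (K a : R) : 0 <= K -> 0 < a ->
  `|\int[P]_x (k x ^+ 2 * q x) - \int[P]_x k x ^+ 2|
   <= 3 * (\int[P]_x sq_tail K k x) + 3 * K ^+ 2 * (a + H / a).
Proof.
move=> K0 a0.
have ikq := integrable_mul_cut_density ik2.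
pose f x := k x ^+ 2 * (q x - 1).
have fE x : f x = lincomb [:: (1, fun x => k x ^+ 2 * q x); (-1, fun x => k x ^+ 2)] x.
  by rewrite /f /=; ring.
have fi : P.-integrable setT (EFin \o f) by apply: eq_integrable_lincomb fE => /=.
have -> : \int[P]_x (k x ^+ 2 * q x) - \int[P]_x k x ^+ 2 = \int[P]_x f x.
  by rewrite (eq_Rintegral_lincomb _ fE)//=; ring.
apply: le_trans (le_normr_Rintegral _ fi) _ => //.
have := @le_Rintegral_lincomb _ _ _ P (fun x => `|f x|)
  [:: (3, sq_tail K k); (3 * K ^+ 2 * a, cst 1); (3 * K ^+ 2 / a, fun x => h x ^+ 2)] _ _ _.
rewrite /= addr0 -/H Rintegral1_probability => le; apply: le_trans (le _ _ _) _.
- exact: integrable_norm fi.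
- by split; [exact: integrable_sq_tail|].
- move=> x; have [u1 u2] := q1 x; rewrite /f normrM /sq_tail addr0 mulr1.
  rewrite (ger0_norm (sqr_ge0 _)).
  have hn := real_normK (num_real (h x)); have kn := real_normK (num_real (k x)).
  move: u1 u2; rewrite -hn -kn; move: (normr_ge0 (k x)) (normr_ge0 (h x)).
  move: (normr_ge0 (q x - 1)).
  move: `|k x| `|h x| `|q x - _| => kx hx u u0 k0 h0 u1 u2.
  have haE : 3 * K ^+ 2 * a + 3 * K ^+ 2 / a * hx ^+ 2 =
     3 * K ^+ 2 * (a + hx ^+ 2 / a) by ring.
  have a1 : 0 <= hx ^+ 2 / a by rewrite divr_ge0 ?sqr_ge0// ltW.
  have a2 : 0 <= 3 * K ^+ 2 * (a + hx ^+ 2 / a).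
    exact: mulr_ge0 (mulr_ge0 (ler0n _ 3) (sqr_ge0 K)) (addr_ge0 (ltW a0) a1).
  rewrite haE; case: ifPn => [Kk|].
    by have := ler_wpM2l (sqr_ge0 kx) u1; lra.
  rewrite -leNgt mulr0 add0r => kK.
  apply: le_trans (_ : K ^+ 2 * (3 * hx) <= _).
    by apply: ler_pM => //; rewrite ?sqr_ge0 ?ler_sqr ?nnegrE//; apply: le_trans u2.
  have : hx <= a + hx ^+ 2 / a.
    have : 0 <= (a - hx) ^+ 2 / a by rewrite divr_ge0 ?sqr_ge0// ltW.
    have -> : (a - hx) ^+ 2 / a = a - 2 * hx + hx ^+ 2 / a by field; rewrite gt_eqF.
    lra.
  by move=> /(ler_wpM2l (sqr_ge0 K)); nra.
- by rewrite le_eqVlt; apply/orP; left; apply/eqP; ring.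
Qed.

End cut_density_estimates.

(** * The Lindeberg replacement step *)

Section one_step.
Context d (X : measurableType d) (R : realType).
Implicit Types (P Q : probability X R) (h k : X -> R).

(** The cut density is a minorant of [Q], missing at most the mass [beta]; test functions express
    this without decomposing [Q] into absolutely continuous and singular parts. *)
Definition local_density P Q h (beta : R) := [/\ L2 P h, forall x, -1 <= h x &
  forall F : X -> R, measurable_fun setT F -> (forall x, 0 <= F x <= 1) ->
    \int[P]_x (F x * cut_density h x) <= \int[Q]_x F x <=
    \int[P]_x (F x * cut_density h x) + beta].

Lemma local_density_mass P Q h beta : local_density P Q h beta ->
  \int[P]_x cut_density h x <= 1 <= \int[P]_x cut_density h x + beta.
Proof.
move=> [_ _ /(_ (cst 1) (measurable_cst _))].
have -> : \int[P]_x (cst 1 x * cut_density h x) = \int[P]_x cut_density h x.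
  by apply: eq_Rintegral => x _; rewrite mul1r.
by rewrite /= Rintegral1_probability; apply => _; rewrite ler01 lexx.
Qed.

(** The summands are: the mass missing from the cut density, counted for the test function and for
    the constant term; the mean and the variance defects of the step [c * k - c ^+ 2 * mu]; the
    Lindeberg remainder, where 4 bounds the cut density; the error of the heat equation over the
    time [c ^+ 2 * sigma2]. *)
Definition one_step_error P h k (C beta mu sigma2 c K : R) : R :=
  let m0 := \int[P]_x cut_density h x in
  let m1 := \int[P]_x (k x * cut_density h x) in
  let m2 := \int[P]_x (k x ^+ 2 * cut_density h x) in
  2 * beta + C * `|c * m1 - c ^+ 2 * mu * m0|
  + C / 2 * `|c ^+ 2 * m2 - 2 * c ^+ 3 * mu * m1 + c ^+ 4 * mu ^+ 2 * m0
             - c ^+ 2 * sigma2|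
  + 4 * C * (2 * c ^+ 2 * (\int[P]_x sq_tail K k x) + 2 * c ^+ 4 * mu ^+ 2
     + c * (K + `|mu|) * (2 * c ^+ 2 * (\int[P]_x k x ^+ 2) + 2 * c ^+ 4 * mu ^+ 2))
  + C * (c ^+ 2 * sigma2) ^+ 2.

(** With [c = n^(-1/2)] each observation carries a share [c ^+ 2 * mu] of the mean shift, which
    centres the step approximately. Its variance is then traded for an increase of [theta]. *)
Lemma heat_one_step (eta : R) : 0 < eta -> exists2 C : R, 0 <= C &
  forall P Q h k beta mu sigma2 c K theta w, local_density P Q h beta ->
   L2 P k -> 0 <= K -> 0 <= c <= 1 -> 0 <= c ^+ 2 * sigma2 <= eta ->
   eta <= theta ->
   `|\int[Q]_x heat theta (w + (c * k x - c ^+ 2 * mu))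
     - heat (theta + c ^+ 2 * sigma2) w| <=
     one_step_error P h k C beta mu sigma2 c K.
Proof.
move=> eta0; have [C C0 HC] := heat_bound eta0; exists C => //.
move=> P Q h k beta mu sigma2 c K theta w ld k2 K0 /andP[c0 c1] seta etatheta.
have [H1 H2 H3 H4 /(_ _ seta) H5] := HC theta w etatheta.
have /andP[m01 m0b] := local_density_mass ld.
have [h2 h1 QP] := ld; rewrite /one_step_error.
set q := cut_density h; set m0 := \int[P]_x q x.
set m1 := \int[P]_x (k x * q x); set m2 := \int[P]_x (k x ^+ 2 * q x).
have iq : P.-integrable setT (EFin \o q) := integrable_cut_density h2 h1.
have ik1q : P.-integrable setT (EFin \o (fun x => k x * q x)).
  by apply: integrable_mul_cut_density => //; exact: L2_integrable.
have ik2q : P.-integrable setT (EFin \o (fun x => k x ^+ 2 * q x)).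
  by apply: (integrable_mul_cut_density h2 h1 (f := fun x => k x ^+ 2)); case: k2.
have mk : measurable_fun setT k by case: k2.
pose Y x := c * k x - c ^+ 2 * mu.
have mY : measurable_fun setT Y by apply: measurable_funB => //; exact: measurable_funM.
pose f x := heat theta (w + Y x).
have mf : measurable_fun setT f.
  by apply: (measurableT_comp (measurable_heat theta)); exact: measurable_funD.
have f01 x : 0 <= f x <= 1 by rewrite heat_ge0 heat_le1.
have ifq : P.-integrable setT (EFin \o (fun x => f x * q x)).
  apply: (integrable_mul_cut_density h2 h1 (f := f)).
  by apply: (@integrable_bounded _ _ _ _ _ 1) => // x; rewrite ger0_norm; case/andP: (f01 x).
pose rem x := f x - heat theta w - heat1 theta w * Y x - heat2 theta w * Y x ^+ 2 / 2.
pose s := [:: (1, fun x => f x * q x);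
    (- heat theta w + heat1 theta w * c ^+ 2 * mu -
      heat2 theta w / 2 * c ^+ 4 * mu ^+ 2, q);
    (- heat1 theta w * c + heat2 theta w * c ^+ 3 * mu, fun x => k x * q x);
    (- heat2 theta w / 2 * c ^+ 2, fun x => k x ^+ 2 * q x)].
have si : integrable_all P s by [].
have remE x : rem x * q x = lincomb s x by rewrite /rem /Y /=; field.
have irem : P.-integrable setT (EFin \o (fun x => rem x * q x)).
  exact: eq_integrable_lincomb si remE.
have Erem := eq_Rintegral_lincomb si remE.
rewrite /= -/m0 -/m1 -/m2 in Erem.
have Brem : `|\int[P]_x (rem x * q x)| <= 4 * C * (2 * c ^+ 2 * (\int[P]_x sq_tail K k x)
     + 2 * c ^+ 4 * mu ^+ 2
     + c * (K + `|mu|) * (2 * c ^+ 2 * (\int[P]_x k x ^+ 2) + 2 * c ^+ 4 * mu ^+ 2)).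
  apply: le_trans (le_normr_Rintegral _ irem) _ => //.
  have := @le_Rintegral_lincomb _ _ _ P (fun x => `|rem x * q x|)
    [:: (4 * C * (2 * c ^+ 2), sq_tail K k);
        (4 * C * (c * (K + `|mu|) * (2 * c ^+ 2)), fun x => k x ^+ 2);
        (4 * C * (2 * c ^+ 4 * mu ^+ 2 + c * (K + `|mu|) * (2 * c ^+ 4 * mu ^+ 2)), cst 1)] _ _ _.
  rewrite /= Rintegral1_probability => le; apply: le_trans (le _ _ _) _.
  - exact: integrable_norm irem.
  - split; first exact: integrable_sq_tail.
    by split; [case: k2|split => //; exact: integrable_cst].
  - move=> x; rewrite normrM (ger0_norm (cut_density_ge0 h x)).
    have /andP[q0 q4] := cut_density_le4 h1 x.
    have Y2 : Y x ^+ 2 <= 2 * c ^+ 2 * k x ^+ 2 + 2 * c ^+ 4 * mu ^+ 2.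
      have := sqr_ge0 (c * k x + c ^+ 2 * mu).
      by rewrite /Y; nra.
    have rb : `|rem x| <= C * (2 * c ^+ 2 * sq_tail K k x + 2 * c ^+ 4 * mu ^+ 2 +
        c * (K + `|mu|) * (2 * c ^+ 2 * k x ^+ 2 + 2 * c ^+ 4 * mu ^+ 2)).
      have cK0 : 0 <= c * (K + `|mu|) by rewrite mulr_ge0// addr_ge0.
      have Yb0 : 0 <= 2 * c ^+ 2 * k x ^+ 2 + 2 * c ^+ 4 * mu ^+ 2.
        exact: le_trans (sqr_ge0 _) Y2.
      have cY0 := mulr_ge0 cK0 Yb0.
      rewrite /sq_tail; case: ifPn => [Kk|].
        apply: le_trans (H3 (Y x)) _; rewrite ler_wpM2l//; lra.
      rewrite -leNgt => kK; apply: le_trans (H4 (Y x)) _; rewrite ler_wpM2l//.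
      rewrite mulr0 add0r.
      have YK : `|Y x| <= c * (K + `|mu|).
        apply: le_trans (ler_normB _ _) _; rewrite !normrM (ger0_norm c0) mulrDr.
        apply: lerD; first by rewrite ler_wpM2l.
        by rewrite ler_wpM2r// ler_piMr.
      rewrite exprSr real_normK ?num_real// mulrC.
      have : `|Y x| * Y x ^+ 2 <= c * (K + `|mu|) *
          (2 * c ^+ 2 * k x ^+ 2 + 2 * c ^+ 4 * mu ^+ 2).
        by apply: ler_pM => //; exact: sqr_ge0.
      have : 0 <= 2 * c ^+ 4 * mu ^+ 2.
        exact: mulr_ge0 (mulr_ge0 (ler0n _ 2) (exprn_ge0 4 c0)) (sqr_ge0 mu).
      lra.
    apply: le_trans (ler_pM _ q0 rb q4) _ => //.
    by rewrite le_eqVlt; apply/orP; left; apply/eqP; rewrite /=; ring.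
  - by rewrite le_eqVlt; apply/orP; left; apply/eqP; ring.
have /andP[Q1 Q2] := QP f mf f01.
have -> : \int[Q]_x heat theta (w + (c * k x - c ^+ 2 * mu)) = \int[Q]_x f x by [].
have v0 := heat_ge0 theta w; have v1 := heat_le1 theta w.
have hm0 : `|heat theta w * (m0 - 1)| <= beta.
  rewrite normrM (ger0_norm v0) ler0_norm ?subr_le0//.
  by move: m0b m01; rewrite -/q -/m0; nra.
have b1 : `|heat1 theta w * (c * m1 - c ^+ 2 * mu * m0)| <=
    C * `|c * m1 - c ^+ 2 * mu * m0| by rewrite normrM ler_wpM2r.
have b2 : `|heat2 theta w / 2 * (c ^+ 2 * m2 - 2 * c ^+ 3 * mu * m1 + c ^+ 4 * mu ^+ 2 * m0
             - c ^+ 2 * sigma2)| <=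
    C / 2 * `|c ^+ 2 * m2 - 2 * c ^+ 3 * mu * m1 + c ^+ 4 * mu ^+ 2 * m0
             - c ^+ 2 * sigma2|.
  rewrite normrM ler_wpM2r// normrM (ger0_norm (_ : 0 <= 2^-1)) ?invr_ge0//.
  by rewrite ler_wpM2r// invr_ge0.
have Q12 : `|\int[Q]_x f x - \int[P]_x (f x * q x)| <= beta.
  by rewrite ger0_norm ?subr_ge0//; move: Q2; rewrite -/q; lra.
(* The term [heat2 theta w / 2 * (c ^+ 2 * sigma2)] is subtracted in [a4] and restored by [- a5]:
   this is how the heat equation absorbs the variance of the step. *)
pose a1 := \int[Q]_x f x - \int[P]_x (f x * q x).
pose a2 := heat theta w * (m0 - 1).
pose a3 := heat1 theta w * (c * m1 - c ^+ 2 * mu * m0).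
pose a4 := heat2 theta w / 2 * (c ^+ 2 * m2 - 2 * c ^+ 3 * mu * m1 +
  c ^+ 4 * mu ^+ 2 * m0 - c ^+ 2 * sigma2).
pose a5 := heat (theta + c ^+ 2 * sigma2) w - heat theta w -
  heat2 theta w / 2 * (c ^+ 2 * sigma2).
have -> : \int[Q]_x f x - heat (theta + c ^+ 2 * sigma2) w =
    a1 + a2 + a3 + a4 + \int[P]_x (rem x * q x) - a5.
  by rewrite Erem /a1 /a2 /a3 /a4 /a5; field.
apply: le_trans (ler_normB _ _) _; apply: lerD => //.
apply: le_trans (ler_normD _ _) _; apply: lerD => //.
apply: le_trans (ler_normD _ _) _; apply: lerD => //.
apply: le_trans (ler_normD _ _) _; apply: lerD => //.
apply: le_trans (ler_normD _ _) _.
by apply: le_trans (lerD Q12 hm0) _; lra.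
Qed.

End one_step.

(** * Local asymptotics *)

(* follows the shape of the limit *)
Ltac cvg_arith :=
  lazymatch goal with
  | |- cvg_to _ (_ (_ + _)) => apply: cvgD; cvg_arith
  | |- cvg_to _ (_ (- _)) => apply: cvgN; cvg_arith
  | |- cvg_to _ (_ (_ * _)) => apply: cvgM; cvg_arith
  | |- cvg_to _ (_ `|_|) => apply: cvg_norm; cvg_arith
  | _ => try first [assumption | exact: cvg_cst]
  end.

Section sequences.
Context {R : realType}.

(** The quantifier order of truncation arguments: cut-off level and weights are fixed from [e], and
    only then does the remaining error [v] vanish in [n]. *)
Lemma cvg0_param (u : nat -> R) :
  (forall e, 0 < e -> exists2 v : nat -> R, v n @[n --> \oo] --> (0 : R) &
    \forall n \near \oo, `|u n| <= e + v n) ->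
  u n @[n --> \oo] --> (0 : R).
Proof.
move=> H; apply/cvgrPdist_le => e e0.
have [|v cv uv] := H (e / 2); first by rewrite divr_gt0.
have v2 : \forall n \near \oo, v n <= e / 2.
  by apply: (cvgr_le _ cv); rewrite divr_gt0.
near=> n; rewrite sub0r normrN.
have : `|u n| <= e + v n - e / 2.
  have : `|u n| <= e / 2 + v n by near: n.
  by move=> /le_trans; apply; lra.
have : v n <= e / 2 by near: n.
lra.
Unshelve. all: by end_near. Qed.

Definition rsqrt (n : nat) : R := (Num.sqrt n%:R)^-1.

Lemma rsqrt_ge0 n : 0 <= rsqrt n. Proof. by rewrite invr_ge0. Qed.

Lemma rsqrt_sq n : (0 < n)%N -> n%:R * rsqrt n ^+ 2 = 1.
Proof. by move=> n0; rewrite exprVn sqr_sqrtr// mulfV// pnatr_eq0 -lt0n. Qed.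

Lemma rsqrt_inv n : (0 < n)%N -> n%:R * rsqrt n = Num.sqrt n%:R.
Proof.
move=> n0; have s0 : Num.sqrt n%:R != 0 :> R by rewrite gt_eqF// sqrtr_gt0 ltr0n.
by rewrite -[in LHS](@sqr_sqrtr R n%:R)// expr2 /rsqrt mulfK.
Qed.

Lemma rsqrt_le1 n : rsqrt n <= 1.
Proof.
case: n => [|n]; first by rewrite /rsqrt sqrtr0 invr0.
rewrite invf_le1 ?sqrtr_gt0 ?ltr0n//.
by rewrite -[leLHS]sqrtr1 ler_sqrt// ler1n.
Qed.

Lemma cvg_rsqrt : rsqrt n @[n --> \oo] --> (0 : R).
Proof.
apply/cvgrPdist_le => e e0; near=> n.
rewrite sub0r normrN ger0_norm ?rsqrt_ge0// /rsqrt.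
have n0 : (0 < n)%N by near: n; exact: nbhs_infty_gt.
rewrite -[leRHS]invrK lef_pV2 ?posrE ?invr_gt0 ?sqrtr_gt0 ?ltr0n//.
have e20 : 0 <= e^-1 by rewrite invr_ge0 ltW.
have -> : e^-1 = Num.sqrt (e^-1 ^+ 2) by rewrite sqrtr_sqr ger0_norm.
rewrite ler_sqrt//.
near: n; exact: nbhs_infty_ger.
Unshelve. all: by end_near. Qed.

End sequences.

(** The weighted form of Cauchy-Schwarz, from [(b * |k| - |f|)^2 / b >= 0]; the free [b] absorbs
    powers of [n] and no square root of an integral appears. *)
Lemma Rintegral_young d (X : measurableType d) (R : realType)
    (P : probability X R) (f k : X -> R) (b : R) : L2 P f -> L2 P k -> 0 < b ->
  `|2 * \int[P]_x (k x * f x)| <= b * (\int[P]_x k x ^+ 2) + (\int[P]_x f x ^+ 2) / b.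
Proof.
move=> f2 k2 b0; have ikf := L2_mul k2 f2.
rewrite normrM ger0_norm//.
apply: le_trans (ler_wpM2l _ (le_normr_Rintegral _ ikf)) _ => //.
have := @le_Rintegral_lincomb _ _ _ P (fun x => `|k x * f x|)
  [:: (b / 2, fun x => k x ^+ 2); (b^-1 / 2, fun x => f x ^+ 2)]
  (integrable_norm ikf) (conj k2.2 (conj f2.2 I)) _.
rewrite /= addr0 => le; apply: le_trans (ler_wpM2l _ (le _)) _ => //.
  move=> x; rewrite addr0 normrM.
  rewrite -(real_normK (num_real (k x))) -(real_normK (num_real (f x))).
  move: `|k x| `|f x| => u v.
  have : 0 <= (b * u - v) ^+ 2 / b by rewrite divr_ge0 ?sqr_ge0// ltW.
  have -> : (b * u - v) ^+ 2 / b = b * u ^+ 2 - 2 * (u * v) + b^-1 * v ^+ 2.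
    by field; rewrite gt_eqF.
  lra.
by rewrite le_eqVlt; apply/orP; left; apply/eqP; field; rewrite gt_eqF.
Qed.

Section local_asymptotics.
Context d (X : measurableType d) (R : realType).
Variables (P : probability X R) (Q : nat -> probability X R).
Variables (g k : X -> R) (t : R) (h : nat -> X -> R) (rho : nat -> R).
Hypotheses (g2 : L2 P g) (k2 : L2 P k) (k0 : \int[P]_x k x = 0).
Let c := @rsqrt R.
Let beta n := 8 * rho n + 2 * (t * c n) ^+ 2 * \int[P]_x cut_tail (h n) g x.
Hypothesis rho0 : forall n, (0 < n)%N -> 0 <= rho n.
Hypothesis hQ : forall n, (0 < n)%N -> local_density P (Q n) (h n) (beta n).
Hypothesis hg : forall n, (0 < n)%N ->
  \int[P]_x (h n x - t * c n * g x / 2) ^+ 2 <= rho n.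
Hypothesis h_le1 : forall n, (0 < n)%N -> \int[P]_x (1 + h n x) ^+ 2 <= 1.
Hypothesis nrho : n%:R * rho n @[n --> \oo] --> (0 : R).

Let H n := \int[P]_x h n x ^+ 2.
Let G := \int[P]_x g x ^+ 2.

Let G0 : 0 <= G. Proof. by apply: Rintegral_ge0 => x _; exact: sqr_ge0. Qed.

Let H0 n : 0 <= H n. Proof. by apply: Rintegral_ge0 => x _; exact: sqr_ge0. Qed.

Let h2 n : (0 < n)%N -> L2 P (h n). Proof. by move=> /hQ[]. Qed.

Let h_ge n : (0 < n)%N -> forall x, -1 <= h n x. Proof. by move=> /hQ[]. Qed.

Let remL2 n : (0 < n)%N -> L2 P (fun x => h n x - t * c n * g x / 2).
Proof.
move=> n0; have := L2D 1 (- (t * c n / 2)) (h2 n0) g2.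
by congr L2; apply/funext => x; field.
Qed.

Lemma perturbation_sq_le n : (0 < n)%N ->
  n%:R * H n <= t ^+ 2 / 2 * G + 2 * (n%:R * rho n).
Proof.
move=> n0; have := @le_Rintegral_lincomb _ _ _ P (fun x => h n x ^+ 2)
   [:: ((t * c n) ^+ 2 / 2, fun x => g x ^+ 2);
       (2, fun x => (h n x - t * c n * g x / 2) ^+ 2)] (h2 n0).2
   (conj g2.2 (conj (remL2 n0).2 I)) _.
rewrite /= addr0 -/G => le.
have {}le : H n <= (t * c n) ^+ 2 / 2 * G + 2 * rho n.
  apply: le_trans (le _) _; last by rewrite lerD2l ler_wpM2l// hg.
  move=> x; rewrite addr0.
  by have := sqr_ge0 (h n x - t * c n * g x); nra.
have := ler_wpM2l (ler0n R n) le; have := @rsqrt_sq R n n0; rewrite -/c => E.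
by rewrite mulrDr exprMn (_ : n%:R * (_ / 2 * G) = (n%:R * c n ^+ 2) * (t ^+ 2 / 2 * G));
  [rewrite E; lra|ring].
Qed.

(** Normalization of the density, with inequality because of a possible singular part. It improves
    the upper bound on [\int h] from order [n^(-1/2)] to one that is nonpositive. *)
Lemma perturbation_mean_le n : (0 < n)%N -> 2 * (\int[P]_x h n x) + H n <= 0.
Proof.
move=> n0; have := h_le1 n0.
have -> : \int[P]_x (1 + h n x) ^+ 2 = 1 + 2 * (\int[P]_x h n x) + H n.
  rewrite (eq_Rintegral_lincomb (s := [:: (1, cst 1); (2, h n); (1, fun x => h n x ^+ 2)])).
  - by rewrite /= Rintegral1_probability -/(H n); ring.
  - split; first exact: integrable_cst.
    by split; [exact/L2_integrable/h2|split; [case: (h2 n0)|]].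
  - by move=> x /=; ring.
lra.
Qed.

(** An eventual bound on [n%:R * H n]: the summand 2 covers [2 * (n%:R * rho n)] once
    [n%:R * rho n <= 1]. *)
Let C := t ^+ 2 / 2 * G + 2.

Let C0 : 0 <= C. Proof.
exact: addr_ge0 (mulr_ge0 (divr_ge0 (sqr_ge0 t) (ler0n _ 2)) G0) (ler0n _ 2).
Qed.

Let nH : \forall n \near \oo, n%:R * H n <= C.
Proof.
near=> n; have n0 : (0 < n)%N by near: n; exact: nbhs_infty_gt.
apply: le_trans (perturbation_sq_le n0) _; rewrite lerD2l.
have : n%:R * rho n <= 1 by near: n; apply: (cvgr_le _ nrho).
lra.
Unshelve. all: by end_near. Qed.

Let cvg_rsqrt2 : c n ^+ 2 @[n --> \oo] --> (0 : R).
Proof.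
rewrite -[X in _ --> X](mulr0 (0 : R)).
by apply: (cvgM (f := c) (g := c)); exact: cvg_rsqrt.
Qed.

Let Hc : \forall n \near \oo, H n <= C * c n ^+ 2.
Proof.
near=> n; have n0 : (0 < n)%N by near: n; exact: nbhs_infty_gt.
have nHn : n%:R * H n <= C by near: n.
have := ler_wpM2r (sqr_ge0 (c n)) nHn.
by rewrite mulrAC rsqrt_sq// mul1r.
Unshelve. all: by end_near. Qed.

(** Since [n%:R * c n ^+ 2 = 1], the claim reduces to the vanishing of the integral of [cut_tail]:
    beyond a fixed level [K] the tail of [g] is small, and below it the Chebyshev bound is of the
    order of [H n]. *)
Lemma cvg_singular_mass : n%:R * beta n @[n --> \oo] --> (0 : R).
Proof.
apply: cvg0_param => e e0.
have T0 : 0 < 2 * t ^+ 2 + 1 by have := sqr_ge0 t; lra.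
have [|K K0 KT] := @sq_tail_small _ _ _ P g (e / (2 * t ^+ 2 + 1)) g2.
  by rewrite divr_gt0.
exists (fun n => 8 * (n%:R * rho n) + 2 * t ^+ 2 * (K ^+ 2 * (C * c n ^+ 2))).
  rewrite (_ : 0 = 8 * 0 + 2 * t ^+ 2 * (K ^+ 2 * (C * 0))); last by ring.
  by cvg_arith.
near=> n; have n0 : (0 < n)%N by near: n; exact: nbhs_infty_gt.
have tail := cut_tail_le (h2 n0) g2 K0.
have tail0 : 0 <= \int[P]_x cut_tail (h n) g x.
  by apply: Rintegral_ge0 => x _; rewrite /cut_tail; case: ifPn => // _; exact: sqr_ge0.
have HcC : H n <= C * c n ^+ 2 by near: n; exact: Hc.
have -> : n%:R * beta n = 8 * (n%:R * rho n) +
    2 * t ^+ 2 * (n%:R * c n ^+ 2) * \int[P]_x cut_tail (h n) g x.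
  by rewrite /beta; ring.
have t20 : 0 <= 2 * t ^+ 2 := mulr_ge0 (ler0n _ 2) (sqr_ge0 t).
rewrite rsqrt_sq// mulr1 ger0_norm; last first.
  exact: addr_ge0 (mulr_ge0 (ler0n _ 8) (mulr_ge0 (ler0n _ n) (rho0 n0)))
    (mulr_ge0 t20 tail0).
have tl : \int[P]_x cut_tail (h n) g x <= e / (2 * t ^+ 2 + 1) + K ^+ 2 * (C * c n ^+ 2).
  by apply: le_trans tail _; apply: lerD => //; rewrite ler_wpM2l ?sqr_ge0.
have := ler_wpM2l t20 tl.
have : 2 * t ^+ 2 * (e / (2 * t ^+ 2 + 1)) <= e.
  by rewrite mulrCA ler_piMr ?(ltW e0)// ler_pdivrMr// mul1r; lra.
by rewrite mulrDr; lra.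
Unshelve. all: by end_near. Qed.

Lemma cvg_density_mass :
  \int[P]_x cut_density (h n) x @[n --> \oo] --> (1 : R).
Proof.
have b1 : (1 - n%:R * beta n) @[n --> \oo] --> (1 : R).
  by rewrite -[X in _ --> X]subr0; apply: cvgB; [exact: cvg_cst|exact: cvg_singular_mass].
apply: (squeeze_cvgr _ b1 (cvg_cst _)).
near=> n; have n0 : (0 < n)%N by near: n; exact: nbhs_infty_gt.
have /andP[m1 m2] := local_density_mass (hQ n0).
rewrite m1 andbT.
have b0 : 0 <= beta n by lra.
have : 1 * beta n <= n%:R * beta n by rewrite ler_wpM2r// ler1n.
lra.
Unshelve. all: by end_near. Qed.

(** With the density close to [1 + 2 * h] and [h] close to [t * c n * g / 2], the factor
    [Num.sqrt n%:R] is harmless because [k] is centred. *)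
Lemma cvg_moment1 :
  Num.sqrt n%:R * \int[P]_x (k x * cut_density (h n) x) @[n --> \oo] -->
  t * \int[P]_x (k x * g x).
Proof.
pose S := \int[P]_x k x ^+ 2.
have S0 : 0 <= S by apply: Rintegral_ge0 => x _; exact: sqr_ge0.
apply/subr_cvg0; apply: cvg0_param => e e0.
(* One third of [e] each for the Hellinger remainder, the linearization error and the tail of [k].
   The weights actually used are [l * c n] and [a * Num.sqrt n%:R]. *)
pose l := e / (3 * (S + 1)); pose a := e / (9 * (C + 1)).
have l0 : 0 < l by rewrite divr_gt0// mulr_gt0// ltr_wpDl.
have a0 : 0 < a by rewrite divr_gt0// mulr_gt0// ltr_wpDl.
have frac (u : R) : 0 <= u -> u / (u + 1) * (e / 3) <= e / 3.
  move=> u0; rewrite -[leRHS]mul1r ler_wpM2r ?divr_ge0 ?(ltW e0)//.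
  by rewrite ler_pdivrMr ?ltr_wpDl// mul1r lerDl.
have lS : l * S <= e / 3.
  rewrite (_ : l * S = S / (S + 1) * (e / 3)); first exact: frac.
  by rewrite /l; field; rewrite gt_eqF// ltr_wpDl.
have aC : 3 * (a * C) <= e / 3.
  rewrite (_ : 3 * (a * C) = C / (C + 1) * (e / 3)); first exact: frac.
  by rewrite /a; field; rewrite gt_eqF// ltr_wpDl.
have [|K K0 KT] := @sq_tail_small _ _ _ P k (e / 9 * a) k2.
  by rewrite mulr_gt0// divr_gt0.
exists (fun n => (n%:R * rho n) / l + 3 * (K * (C * c n))).
  rewrite (_ : 0 = 0 / l + 3 * (K * (C * 0))); last by ring.
  by cvg_arith; exact: cvg_rsqrt.
near=> n; have n0 : (0 < n)%N by near: n; exact: nbhs_infty_gt.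
have sn0 : 0 < Num.sqrt n%:R :> R by rewrite sqrtr_gt0 ltr0n.
have nHn : n%:R * H n <= C by near: n.
have m1 := cut_density_moment1 (h2 n0) k2 (h_ge n0) K0 (mulr_gt0 a0 sn0).
rewrite k0 subr0 -/(H n) in m1.
have cs : c n * Num.sqrt n%:R = 1 by rewrite mulVf// gt_eqF.
have sE : n%:R = Num.sqrt n%:R * Num.sqrt n%:R :> R by rewrite -expr2 sqr_sqrtr.
have cn : n%:R * c n = Num.sqrt n%:R by exact: rsqrt_inv.
have lc0 : 0 < l * c n by rewrite mulr_gt0// invr_gt0.
have y := Rintegral_young (remL2 n0) k2 lc0.
have kE : \int[P]_x (k x * (h n x - t * c n * g x / 2)) =
    \int[P]_x (k x * h n x) - t * c n / 2 * \int[P]_x (k x * g x).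
  rewrite (eq_Rintegral_lincomb (s := [:: (1, fun x => k x * h n x);
    (- (t * c n / 2), fun x => k x * g x)])) /=; first by ring.
  - by split; [apply: L2_mul (h2 n0)|split => //; exact: L2_mul].
  - by move=> x; field.
set m := \int[P]_x (k x * cut_density (h n) x) in m1 *.
set kh := \int[P]_x (k x * h n x) in m1 kE *.
set kg := \int[P]_x (k x * g x) in kE *.
have -> : Num.sqrt n%:R * m - t * kg = Num.sqrt n%:R * (m - 2 * kh) +
   Num.sqrt n%:R * (2 * (kh - t * c n / 2 * kg)).
  rewrite (_ : t * kg = t * (c n * Num.sqrt n%:R) * kg); last by rewrite cs; ring.
  by field.
apply: le_trans (ler_normD _ _) _.
rewrite normrM (ger0_norm (ltW sn0)) [`|Num.sqrt _ * (2 * _)|]normrM (ger0_norm (ltW sn0)).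
rewrite -kE.
have b1 := ler_wpM2l (ltW sn0) m1; have b2 := ler_wpM2l (ltW sn0) y.
apply: le_trans (lerD b1 b2) _.
have hr := hg n0.
have -> : Num.sqrt n%:R * (l * c n * \int[P]_x k x ^+ 2 +
    (\int[P]_x (h n x - t * c n * g x / 2) ^+ 2) / (l * c n)) =
    l * S + n%:R * (\int[P]_x (h n x - t * c n * g x / 2) ^+ 2) / l.
  rewrite -/S /c /rsqrt {5}sE; field; by rewrite !gt_eqF.
have -> : Num.sqrt n%:R * (3 * (K * H n + (\int[P]_x sq_tail K k x) / (a * Num.sqrt n%:R)
   + a * Num.sqrt n%:R * H n)) = 3 * (K * (n%:R * H n * c n) +
   (\int[P]_x sq_tail K k x) / a + a * (n%:R * H n)).
  rewrite (mulrAC n%:R) cn {5}sE; field; by rewrite !gt_eqF.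
have t1 : n%:R * (\int[P]_x (h n x - t * c n * g x / 2) ^+ 2) / l <= n%:R * rho n / l.
  by rewrite ler_wpM2r ?invr_ge0 ?(ltW l0)// ler_wpM2l.
have t2 : (\int[P]_x sq_tail K k x) / a <= e / 9 by rewrite ler_pdivrMr.
have t3 : a * (n%:R * H n) <= a * C by rewrite ler_wpM2l// ltW.
have t4 : K * (n%:R * H n * c n) <= K * (C * c n).
  by rewrite ler_wpM2l// ler_wpM2r// rsqrt_ge0.
lra.
Unshelve. all: by end_near. Qed.

Lemma cvg_moment2 :
  \int[P]_x (k x ^+ 2 * cut_density (h n) x) @[n --> \oo] -->
  \int[P]_x k x ^+ 2.
Proof.
apply/subr_cvg0; apply: cvg0_param => e e0.
have [|K K0 KT] := @sq_tail_small _ _ _ P k (e / 6) k2; first by rewrite divr_gt0.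
pose a := e / (6 * (K ^+ 2 + 1)).
have a0 : 0 < a by rewrite divr_gt0// mulr_gt0// ltr_wpDl// sqr_ge0.
have aK : 3 * K ^+ 2 * a <= e / 2.
  have -> : 3 * K ^+ 2 * a = (K ^+ 2 / (K ^+ 2 + 1)) * (e / 2).
    by rewrite /a; field; rewrite gt_eqF// ltr_wpDl// sqr_ge0.
  rewrite -[leRHS]mul1r ler_wpM2r ?divr_ge0 ?(ltW e0)//.
  by rewrite ler_pdivrMr ?ltr_wpDl ?sqr_ge0// mul1r lerDl.
exists (fun n => 3 * K ^+ 2 / a * (C * c n ^+ 2)).
  rewrite (_ : 0 = 3 * K ^+ 2 / a * (C * 0)); last by ring.
  by cvg_arith.
near=> n; have n0 : (0 < n)%N by near: n; exact: nbhs_infty_gt.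
have HcC : H n <= C * c n ^+ 2 by near: n; exact: Hc.
apply: le_trans (cut_density_moment2 (h2 n0) k2 (h_ge n0) K0 a0) _.
rewrite -/(H n).
have K2 : 0 <= 3 * K ^+ 2 / a.
  exact: divr_ge0 (mulr_ge0 (ler0n _ 3) (sqr_ge0 _)) (ltW a0).
have := ler_wpM2l K2 HcC; lra.
Unshelve. all: by end_near. Qed.

Lemma density_sq_bound : exists B : R, \forall n \near \oo,
  \int[P]_x cut_density (h n) x ^+ 2 <= 1 + B / n%:R.
Proof.
(* [9 = 11 - 2], because [4 * \int h] is at most [- 2 * H n]. *)
exists (9 * C); near=> n; have n0 : (0 < n)%N by near: n; exact: nbhs_infty_gt.
apply: le_trans (cut_density_sq_le (h2 n0) (h_ge n0)) _.
have := perturbation_mean_le n0.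
have : n%:R * H n <= C by near: n.
rewrite mulrC -ler_pdivlMr ?ltr0n// => HC.
by rewrite -/(H n); lra.
Unshelve. all: by end_near. Qed.

(** Equality of the total masses of [P] and [Q n] gives [|2 * \int h| <= H n + beta n], of order
    [1 / n]. But [2 * \int h] is [t * c n * \int g] up to [o(c n)]; multiplying by [Num.sqrt n%:R]
    leaves [t * \int g] as the limit of a null sequence. *)
Lemma expansion_mean_zero : 0 < t -> \int[P]_x g x = 0.
Proof.
move=> t0; apply: (mulfI (lt0r_neq0 t0)); rewrite mulr0.
set D := t * _.
suff : (fun _ : nat => D) @ \oo --> (0 : R).
  by move=> /cvg_lim <-//; rewrite lim_cst.
apply: cvg0_param => e e0.
exists (fun n => n%:R * rho n / e + c n * (C + n%:R * beta n)).
  rewrite (_ : 0 = 0 / e + 0 * (C + 0)); last by ring.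
  by cvg_arith; [exact: cvg_rsqrt|exact: cvg_singular_mass].
near=> n; have n0 : (0 < n)%N by near: n; exact: nbhs_infty_gt.
have sn0 : 0 < Num.sqrt n%:R :> R by rewrite sqrtr_gt0 ltr0n.
have nHn : n%:R * H n <= C by near: n.
have cs : c n * Num.sqrt n%:R = 1 by rewrite mulVf// gt_eqF.
have cn : n%:R * c n = Num.sqrt n%:R by exact: rsqrt_inv.
have c0 : 0 < c n by rewrite invr_gt0.
have ec0 : 0 < e * c n by rewrite mulr_gt0.
have y := Rintegral_young (remL2 n0) (L2_cst P 1) ec0.
have E1 : \int[P]_x (cst 1 x) ^+ 2 = 1.
  rewrite -[RHS](Rintegral1_probability P).
  by apply: eq_Rintegral => x _; rewrite /= expr1n.
have E2 : \int[P]_x (cst 1 x * (h n x - t * c n * g x / 2)) =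
    \int[P]_x h n x - t * c n / 2 * \int[P]_x g x.
  rewrite (eq_Rintegral_lincomb (s := [:: (1, h n); (- (t * c n / 2), g)])) /=; first by ring.
  - by split; [exact/L2_integrable/h2|split => //; exact: L2_integrable].
  - by move=> x; field.
rewrite E1 E2 mulr1 in y.
have /andP[m1 m2] := local_density_mass (hQ n0).
have mh : \int[P]_x cut_density (h n) x <= 1 + 2 * (\int[P]_x h n x) + H n.
  have := @le_Rintegral_lincomb _ _ _ P (cut_density (h n))
    [:: (1, cst 1); (2, h n); (1, fun x => h n x ^+ 2)] _ _ _.
  rewrite /= Rintegral1_probability mulr1 mul1r addr0 -addrA addrA; apply.
  - exact: integrable_cut_density (h2 n0) (h_ge n0).
  - split; first exact: integrable_cst.
    by split; [exact/L2_integrable/h2|split => //; case: (h2 n0)].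
  - move=> x; rewrite /cut_density addr0; case: ifPn => _; first by lra.
    by have := sqr_ge0 (1 + h n x); lra.
have np := perturbation_mean_le n0.
have b0 : 0 <= beta n by lra.
have h3 : `|2 * \int[P]_x h n x| <= H n + beta n.
  by have := H0 n; rewrite ler_norml => ?; apply/andP; split; lra.
have DE : D = Num.sqrt n%:R * (2 * \int[P]_x h n x) - Num.sqrt n%:R *
    (2 * (\int[P]_x h n x - t * c n / 2 * \int[P]_x g x)).
  transitivity (t * (c n * Num.sqrt n%:R) * \int[P]_x g x); first by rewrite cs mulr1.
  by field.
rewrite DE; apply: le_trans (ler_normB _ _) _.
rewrite [`|Num.sqrt _ * (2 * \int[P]_x h n x)|]normrM.
rewrite [`|Num.sqrt _ * (2 * (_ - _))|]normrM (ger0_norm (ltW sn0)).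
have b1 := ler_wpM2l (ltW sn0) h3; have b2 := ler_wpM2l (ltW sn0) y.
apply: le_trans (lerD b1 b2) _.
have hr := hg n0.
have t1 : Num.sqrt n%:R * (H n + beta n) <= c n * (C + n%:R * beta n).
  by rewrite -cn (mulrC n%:R) -mulrA ler_wpM2l ?(ltW c0)// mulrDr lerD2r.
have t2 : Num.sqrt n%:R * (e * c n + (\int[P]_x (h n x - t * c n * g x / 2) ^+ 2) / (e * c n))
    <= e + n%:R * rho n / e.
  rewrite mulrDr; apply: lerD.
    by rewrite mulrCA [Num.sqrt _ * _]mulrC cs mulr1.
  have -> : Num.sqrt n%:R * ((\int[P]_x (h n x - t * c n * g x / 2) ^+ 2) / (e * c n)) =
    n%:R * (\int[P]_x (h n x - t * c n * g x / 2) ^+ 2) / e.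
    have sE : n%:R = Num.sqrt n%:R * Num.sqrt n%:R :> R by rewrite -expr2 sqr_sqrtr.
    set J := \int[P]_x _; rewrite [in RHS]sE /c /rsqrt; field; by rewrite !gt_eqF.
  by rewrite ler_wpM2r ?invr_ge0 ?(ltW e0)// ler_wpM2l.
lra.
Unshelve. all: by end_near. Qed.

End local_asymptotics.

(** * Contiguity and the central limit theorem under local alternatives *)

Section replacement.
Context d (X : measurableType d) (R : realType).
Implicit Types (P Q : probability X R) (k : X -> R).

(** The lower bound is the one-sided scheme for [1 - v], which takes values in [0, 1] as well. *)
Lemma prob_power_sum_bound Q k (v : nat -> R -> R) (e : R) :
  measurable_fun setT k -> (forall m, measurable_fun setT (v m)) ->
  (forall m w, 0 <= v m w <= 1) ->
  (forall m w, `|\int[Q]_x v m (w + k x) - v m.+1 w| <= e) ->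
  forall n w,
  `|\int[prob_power Q n]_x v 0%N (w + \sum_(i < n) k (tnth x i)) - v n w|
    <= n%:R * e.
Proof.
move=> mk mv v01 vQ n w.
have e0 : 0 <= e := le_trans (normr_ge0 _) (vQ 0%N 0).
have mvk m u : measurable_fun setT (fun x => v m (u + k x)).
  by apply: measurableT_comp => //; exact: measurable_funD.
have ivk m u : Q.-integrable setT (EFin \o (fun x => v m (u + k x))).
  apply: (@integrable_bounded _ _ _ _ _ 1) => // x.
  by have /andP[? ?] := v01 m (u + k x); rewrite ger0_norm.
have msum : measurable_fun setT
    (fun x : n.-tuple X => v 0%N (w + \sum_(i < n) k (tnth x i))).
  apply: measurableT_comp => //; apply: measurable_funD => //.
  exact: measurable_sum_tnth.
have isum : (prob_power Q n).-integrable setT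
    (EFin \o (fun x : n.-tuple X => v 0%N (w + \sum_(i < n) k (tnth x i)))).
  apply: (@integrable_bounded _ _ _ _ _ 1) => // x.
  by have /andP[? ?] := v01 0%N (w + \sum_(i < n) k (tnth x i)); rewrite ger0_norm.
have i1 (p : probability (n.-tuple X) R) : p.-integrable setT (EFin \o cst 1).
  exact: integrable_cst.
have i1Q : Q.-integrable setT (EFin \o cst 1) by exact: integrable_cst.
rewrite ler_distl; apply/andP; split; last first.
  rewrite -lee_fin EFin_Rintegral//.
  have v0 m u : 0 <= v m u by have /andP[] := v01 m u.
  apply: (prob_power_sum_le e0 mk mv v0 _ n w) => m u.
  rewrite -EFin_Rintegral// lee_fin.
  by have := vQ m u; rewrite ler_distl => /andP[].
have H a1 a2 a3 := @prob_power_sum_le _ _ _ Q k (fun m u => 1 - v m u) e e0 mk a1 a2 a3 n w.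
have E : (\int[prob_power Q n]_x (1 - v 0%N (w + \sum_(i < n) k (tnth x i)))%:E)%E =
  (1 - \int[prob_power Q n]_x v 0%N (w + \sum_(i < n) k (tnth x i)))%:E.
  rewrite -[in RHS](Rintegral1_probability (prob_power Q n)) -RintegralB//.
  by rewrite EFin_Rintegral//; exact: (integrableB measurableT (i1 _) isum).
  exact: i1.
rewrite E lee_fin in H.
suff : 1 - \int[prob_power Q n]_x v 0%N (w + \sum_(i < n) k (tnth x i)) <=
   1 - v n w + n%:R * e by lra.
apply: H => [m|m u|m u].
- exact: measurable_funB.
- by rewrite subr_ge0; have /andP[] := v01 m u.
have E1 : (\int[Q]_x (1 - v m (u + k x))%:E)%E = (1 - \int[Q]_x v m (u + k x))%:E.
  rewrite -[in RHS](Rintegral1_probability Q) -RintegralB//.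
  by rewrite EFin_Rintegral//; exact: (integrableB measurableT i1Q (ivk m u)).
rewrite E1 lee_fin.
by have := vQ m u; rewrite ler_distl => /andP[]; lra.
Qed.

End replacement.

Section local_limit_theorems.
Context d (X : measurableType d) (R : realType).
Variables (P : probability X R) (Q : nat -> probability X R).
Variables (h : nat -> X -> R) (beta : nat -> R).
Hypothesis hQ : forall n, (0 < n)%N -> local_density P (Q n) (h n) (beta n).
Hypothesis nbeta : n%:R * beta n @[n --> \oo] --> (0 : R).
Let c := @rsqrt R.

(** The product density has second moment at most [(1 + B / n)^n <= expR B], so the region where it
    exceeds [L] contributes at most [expR B / L], which is [e] for the [L] chosen; the mass missing
    from the product is at most [n * beta]. *)
Lemma contiguity (B : R) (A : forall n, set (n.-tuple X)) :
  (\forall n \near \oo, \int[P]_x cut_density (h n) x ^+ 2 <= 1 + B / n%:R) ->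
  (forall n, measurable (A n)) ->
  prob_power P n (A n) @[n --> \oo] --> 0%E ->
  fine (prob_power (Q n) n (A n)) @[n --> \oo] --> (0 : R).
Proof.
move=> sqB mA PA.
have {}PA : fine (prob_power P n (A n)) @[n --> \oo] --> (0 : R).
  exact: fine_cvg.
apply: cvg0_param => e e0.
pose L := expR B / e.
have L0 : 0 < L by rewrite divr_gt0// expR_gt0.
exists (fun n => L * fine (prob_power P n (A n)) + n%:R * beta n).
  rewrite (_ : 0 = L * 0 + 0); last by ring.
  by cvg_arith.
near=> n; have n0 : (0 < n)%N by near: n; exact: nbhs_infty_gt.
have nR0 : 0 < n%:R :> R by rewrite ltr0n.
have ld := hQ n0; have [h2 h1 QP] := ld.
have mh : measurable_fun setT (h n) by case: h2.
have sq : \int[P]_x cut_density (h n) x ^+ 2 <= 1 + B / n%:R by near: n.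
have /andP[m01 m0b] := local_density_mass ld.
have b0 : 0 <= beta n by lra.
rewrite ger0_norm ?fine_ge0//.
have mAn := mA n.
rewrite -lee_fin fineK; last exact: fin_num_measure.
have := @prob_power_dom _ _ _ P (Q n) (cut_density (h n)) (beta n)
  (1 + B / n%:R) L b0 L0 (measurable_cut_density mh) (cut_density_ge0 (h n)) _ _ _ n (A n) (mA n).
move=> dom; apply: le_trans (dom _ _ _) _.
- rewrite -EFin_Rintegral ?lee_fin//.
  exact: integrable_cut_density.
- rewrite -EFin_Rintegral ?lee_fin//.
  by case: (L2_cut_density h2 h1).
- move=> F mF F01.
  have iF : (Q n).-integrable setT (EFin \o F).
    apply: (@integrable_bounded _ _ _ _ _ 1) => // x.
    by have /andP[? ?] := F01 x; rewrite ger0_norm.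
  have iF' : P.-integrable setT (EFin \o F).
    apply: (@integrable_bounded _ _ _ _ _ 1) => // x.
    by have /andP[? ?] := F01 x; rewrite ger0_norm.
  have iFq := integrable_mul_cut_density h2 h1 iF'.
  by rewrite -!EFin_Rintegral// -EFinD lee_fin; have /andP[] := QP F mF F01.
have PE : prob_power P n (A n) = (fine (prob_power P n (A n)))%:E.
  by rewrite fineK// fin_num_measure//; exact: mA.
rewrite {1}PE -EFinM -EFinD lee_fin.
have Bn0 : 0 <= 1 + B / n%:R.
  by apply: le_trans sq; apply: Rintegral_ge0 => x _; exact: sqr_ge0.
have : (1 + B / n%:R) ^+ n / L <= e.
  rewrite ler_pdivrMr// (_ : e * L = expR B); last first.
    by rewrite /L; field; rewrite gt_eqF.
  have -> : expR B = expR (B / n%:R) ^+ n.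
    by rewrite -expRM_natl; congr expR; field; rewrite gt_eqF.
  by rewrite lerXn2r ?nnegrE ?expR_ge0//; exact: expR_ge1Dx.
lra.
Unshelve. all: by end_near. Qed.

(** Each of the [n] replacements adds [c n ^+ 2 * S] to the variance, from [eta] up to [eta + S]. No
    step goes below [eta], so one constant [C] serves all of them. *)
Lemma local_clt (k : X -> R) (mu eta w : R) : L2 P k -> 0 < eta ->
  \int[P]_x cut_density (h n) x @[n --> \oo] --> (1 : R) ->
  Num.sqrt n%:R * \int[P]_x (k x * cut_density (h n) x) @[n --> \oo] --> mu ->
  \int[P]_x (k x ^+ 2 * cut_density (h n) x) @[n --> \oo] -->
    \int[P]_x k x ^+ 2 ->
  \int[prob_power (Q n) n]_x
     heat eta (w + (c n * \sum_(i < n) k (tnth x i) - mu)) @[n --> \oo] -->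
  heat (eta + \int[P]_x k x ^+ 2) w.
Proof.
move=> k2 eta0 lim0 lim1 lim2; set S := \int[P]_x k x ^+ 2 in lim2 *.
have S0 : 0 <= S by apply: Rintegral_ge0 => x _; exact: sqr_ge0.
have mk : measurable_fun setT k by case: k2.
have [C C0 HC] := @heat_one_step d X R eta eta0.
have cc : c n @[n --> \oo] --> (0 : R) by exact: cvg_rsqrt.
have cc2 : c n ^+ 2 @[n --> \oo] --> (0 : R).
  rewrite -[X in _ --> X](mulr0 (0 : R)).
  by apply: (cvgM (f := c) (g := c)).
apply/subr_cvg0; apply: cvg0_param => e e0.
(* After summation over [n] steps the tail contributes [8 * C * T], the one error that does not
   vanish with [n]; [K] makes it at most [e]. *)
have [|K K0 KT] := @sq_tail_small _ _ _ P k (e / (8 * C + 1)) k2.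
  by rewrite divr_gt0// ltr_wpDl// mulr_ge0.
set T := \int[P]_x sq_tail K k x in KT.
pose m0 n := \int[P]_x cut_density (h n) x.
pose m1 n := \int[P]_x (k x * cut_density (h n) x).
pose m2 n := \int[P]_x (k x ^+ 2 * cut_density (h n) x).
pose r n := 2 * (n%:R * beta n) + C * `|Num.sqrt n%:R * m1 n - mu * m0 n|
  + C / 2 * `|m2 n - 2 * c n ^+ 2 * mu * (Num.sqrt n%:R * m1 n)
     + c n ^+ 2 * mu ^+ 2 * m0 n - S|
  + 4 * C * (2 * c n ^+ 2 * mu ^+ 2
     + c n * (K + `|mu|) * (2 * S + 2 * c n ^+ 2 * mu ^+ 2))
  + C * c n ^+ 2 * S ^+ 2.
exists r.
  have -> : 0 = 2 * 0 + C * `|mu - mu * 1| + C / 2 * `|S - 2 * 0 * mu * mu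
     + 0 * mu ^+ 2 * 1 - S| + 4 * C * (2 * 0 * mu ^+ 2
     + 0 * (K + `|mu|) * (2 * S + 2 * 0 * mu ^+ 2)) + C * 0 * S ^+ 2 :> R.
    have -> : mu - mu * 1 = 0 by ring.
    have -> : S - 2 * 0 * mu * mu + 0 * mu ^+ 2 * 1 - S = 0 by ring.
    by rewrite normr0; ring.
  by rewrite /r; cvg_arith.
near=> n; have n0 : (0 < n)%N by near: n; exact: nbhs_infty_gt.
pose Y x := c n * k x - c n ^+ 2 * mu.
have mY : measurable_fun setT Y by apply: measurable_funB => //; exact: measurable_funM.
pose v m u := heat (eta + m%:R * (c n ^+ 2 * S)) u.
have cS : c n ^+ 2 * S <= eta.
  near: n.
  have cv : c n ^+ 2 * S @[n --> \oo] --> 0 * S by apply: cvgM => //; exact: cvg_cst.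
  by apply: (cvgr_le _ cv); rewrite mul0r.
have cS0 : 0 <= c n ^+ 2 * S by rewrite mulr_ge0 ?sqr_ge0.
pose E := one_step_error P (h n) k C (beta n) mu S (c n) K.
have step m u : `|\int[Q n]_x v m (u + Y x) - v m.+1 u| <= E.
  have -> : v m.+1 u = heat (eta + m%:R * (c n ^+ 2 * S) + c n ^+ 2 * S) u.
    by rewrite /v -natr1 mulrDl mul1r addrA.
  apply: HC => //.
  - exact: hQ.
  - by rewrite rsqrt_ge0 rsqrt_le1.
  - by rewrite cS0.
  - by rewrite lerDl mulr_ge0.
have v01 m u : 0 <= v m u <= 1 by rewrite heat_ge0 heat_le1.
have mv m : measurable_fun setT (v m) by exact: measurable_heat.
have := prob_power_sum_bound mY mv v01 step n w.
have -> : v n w = heat (eta + S) w.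
  by rewrite /v mulrA rsqrt_sq// mul1r.
have -> : \int[prob_power (Q n) n]_x v 0%N (w + \sum_(i < n) Y (tnth x i)) =
   \int[prob_power (Q n) n]_x heat eta (w + (c n * \sum_(i < n) k (tnth x i) - mu)).
  apply: eq_Rintegral => x _; rewrite /v mul0r addr0; congr (heat eta (w + _)).
  rewrite /Y sumrB mulr_sumr; congr (_ - _).
  by rewrite sumr_const card_ord -mulr_natl mulrA rsqrt_sq// mul1r.
move=> /le_trans; apply.
have cs : c n * Num.sqrt n%:R = 1 by rewrite mulVf// gt_eqF// sqrtr_gt0 ltr0n.
have nc2 := @rsqrt_sq R n n0.
have nc := @rsqrt_inv R n n0.
have nR0 : 0 < n%:R :> R by rewrite ltr0n.
have -> : n%:R * E = 8 * C * T + r n.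
  have n3 : n%:R * c n ^+ 3 = c n by rewrite exprSr mulrA nc2 mul1r.
  have n4 : n%:R * c n ^+ 4 = c n ^+ 2 by rewrite (exprD _ 2 2) mulrA nc2 mul1r.
  rewrite /E /one_step_error -/(m0 n) -/(m1 n) -/(m2 n) -/T -/S.
  have A1 : n%:R * `|c n * m1 n - c n ^+ 2 * mu * m0 n| =
     `|Num.sqrt n%:R * m1 n - mu * m0 n|.
    rewrite -[X in X * _](ger0_norm (ltW nR0)) -normrM; congr `|_|.
    transitivity ((n%:R * c n) * m1 n - (n%:R * c n ^+ 2) * mu * m0 n); first by ring.
    by rewrite nc nc2 mul1r.
  have A2 : n%:R * `|c n ^+ 2 * m2 n - 2 * c n ^+ 3 * mu * m1 n +
      c n ^+ 4 * mu ^+ 2 * m0 n - c n ^+ 2 * S| =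
    `|m2 n - 2 * c n ^+ 2 * mu * (Num.sqrt n%:R * m1 n)
     + c n ^+ 2 * mu ^+ 2 * m0 n - S|.
    rewrite -[X in X * _](ger0_norm (ltW nR0)) -normrM; congr `|_|.
    transitivity ((n%:R * c n ^+ 2) * m2 n - 2 * (n%:R * c n ^+ 3) * mu * m1 n +
      (n%:R * c n ^+ 4) * mu ^+ 2 * m0 n - (n%:R * c n ^+ 2) * S); first by ring.
    have c2s : c n ^+ 2 * Num.sqrt n%:R = c n by rewrite expr2 -mulrA cs mulr1.
    rewrite nc2 n3 n4 (_ : 2 * c n ^+ 2 * mu * (_ * m1 n) =
      2 * (c n ^+ 2 * Num.sqrt n%:R) * mu * m1 n); last by ring.
    by rewrite c2s; ring.
  rewrite /r.
  transitivity (2 * (n%:R * beta n)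
   + C * (n%:R * `|c n * m1 n - c n ^+ 2 * mu * m0 n|)
   + C / 2 * (n%:R * `|c n ^+ 2 * m2 n - 2 * c n ^+ 3 * mu * m1 n +
      c n ^+ 4 * mu ^+ 2 * m0 n - c n ^+ 2 * S|)
   + 4 * C * (2 * (n%:R * c n ^+ 2) * T + 2 * (n%:R * c n ^+ 4) * mu ^+ 2
     + c n * (K + `|mu|) * (2 * (n%:R * c n ^+ 2) * S + 2 * (n%:R * c n ^+ 4) * mu ^+ 2))
   + C * (n%:R * c n ^+ 4) * S ^+ 2); first by ring.
  by rewrite A1 A2 nc2 n4; ring.
rewrite lerD2r; apply: le_trans (ler_wpM2l _ KT) _; first by rewrite mulr_ge0.
rewrite mulrCA ler_piMr ?(ltW e0)// ler_pdivrMr ?ltr_wpDl ?mulr_ge0// mul1r.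
by rewrite lerDl.
Unshelve. all: by end_near. Qed.

End local_limit_theorems.

(** * Projections on convex cones *)

Section L2_geometry.
Context d (X : measurableType d) (R : realType).
Variable P : probability X R.
Implicit Types (f g h u v : X -> R) (A : set (X -> R)).

Lemma sq_int_ge0 f : 0 <= \int[P]_x f x ^+ 2.
Proof. by apply: Rintegral_ge0 => x _; exact: sqr_ge0. Qed.

Lemma normL2_lt f (e : R) : L2 P f -> 0 < e ->
  (normL2 P f < e%:E)%E = (\int[P]_x f x ^+ 2 < e ^+ 2).
Proof.
move=> f2 e0; rewrite /normL2 L2_normL2// lte_fin.
rewrite -{1}[e](ger0_norm (ltW e0)) -sqrtr_sqr ltr_sqrt//.
by rewrite exprn_gt0.
Qed.

Lemma normL2_le f g : L2 P f -> L2 P g ->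
  (normL2 P f <= normL2 P g)%E = (\int[P]_x f x ^+ 2 <= \int[P]_x g x ^+ 2).
Proof.
move=> f2 g2; rewrite /normL2 !L2_normL2// lee_fin ler_sqrt//.
exact: sq_int_ge0.
Qed.

Lemma sq_int_eq0 f : L2 P f -> \int[P]_x f x ^+ 2 = 0 -> f = cst 0 %[ae P].
Proof.
move=> [mf f2] fR0.
have f0 : (\int[P]_x (f x ^+ 2)%:E = 0)%E by rewrite -EFin_Rintegral// fR0.
have I0 : (\int[P]_x `|(f x ^+ 2)%:E| = 0)%E.
  by rewrite -f0; apply: eq_integral => x _; rewrite gee0_abs// lee_fin sqr_ge0.
have mf2 : measurable_fun setT (fun x => (f x ^+ 2)%:E).
  by apply/measurable_EFinP; exact: measurable_funX.
have := (ae_eq_integral_abs P measurableT mf2).1 I0.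
apply: filterS => x xE _; have [/eqP] := xE I.
by rewrite sqrf_eq0 => /eqP.
Qed.

Definition L2_set A := forall g, A g -> L2 P g.

Lemma closureL2P A h : L2_set A -> closureL2 P A h <->
  L2 P h /\ forall e : R, 0 < e -> exists2 g, A g & \int[P]_x (h x - g x) ^+ 2 <= e.
Proof.
move=> A2; split => [[/Lfun2P h2 H]|[h2 H]]; split => //; last 2 first.
- exact/Lfun2P.
- move=> e e0; have [|g Ag ge] := H (e ^+ 2 / 2).
    by rewrite divr_gt0// exprn_gt0.
  exists g => //; rewrite normL2_lt//; last exact: L2B (A2 _ Ag).
  apply: le_lt_trans ge _; have : 0 < e ^+ 2 by rewrite exprn_gt0.
  lra.
move=> e e0; have [|g Ag] := H (Num.sqrt e); first by rewrite sqrtr_gt0.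
rewrite normL2_lt ?sqrtr_gt0//; last exact: L2B (A2 _ Ag).
by rewrite sqr_sqrtr ?(ltW e0)// => /ltW; exists g.
Qed.

Lemma dotL2_lin u f g (a b : R) : L2 P u -> L2 P f -> L2 P g ->
  dotL2 P u (fun x => a * f x + b * g x) = a * dotL2 P u f + b * dotL2 P u g.
Proof.
move=> u2 f2 g2; rewrite /dotL2.
rewrite (eq_Rintegral_lincomb (s := [:: (a, fun x => u x * f x); (b, fun x => u x * g x)])).
- by rewrite /= addr0.
- by split; [exact: L2_mul|split => //; exact: L2_mul].
- by move=> x /=; ring.
Qed.

Lemma dotL2_linl u f g (a b : R) : L2 P u -> L2 P f -> L2 P g ->
  dotL2 P (fun x => a * f x + b * g x) u = a * dotL2 P f u + b * dotL2 P g u.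
Proof.
move=> u2 f2 g2; rewrite /dotL2.
rewrite (eq_Rintegral_lincomb (s := [:: (a, fun x => f x * u x); (b, fun x => g x * u x)])).
- by rewrite /= addr0.
- by split; [exact: L2_mul|split => //; exact: L2_mul].
- by move=> x /=; ring.
Qed.

Lemma dotL2_closure A u h (e : R) : L2_set A -> L2 P u -> closureL2 P A h ->
  0 < e -> exists2 g, A g & `|dotL2 P u h - dotL2 P u g| <= e.
Proof.
move=> A2 u2 /(closureL2P _ A2)[h2 H] e0.
pose U := \int[P]_x u x ^+ 2; have U0 : 0 <= U by exact: sq_int_ge0.
pose b := e / (U + 1).
have b0 : 0 < b by rewrite divr_gt0// ltr_wpDl.
have [|g Ag ge] := H (b * e); first by rewrite mulr_gt0.
exists g => //; have hg2 := L2B h2 (A2 _ Ag).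
have := Rintegral_young hg2 u2 b0; rewrite -/U.
have -> : \int[P]_x (u x * (h x - g x)) = dotL2 P u h - dotL2 P u g.
  have := dotL2_lin 1 (-1) u2 h2 (A2 _ Ag); rewrite mul1r mulN1r => <-.
  by apply: eq_Rintegral => x _; congr (_ * _); ring.
rewrite normrM ger0_norm// => le.
have : b * U <= e.
  rewrite /b mulrAC ler_pdivrMr ?ltr_wpDl//.
  by rewrite ler_wpM2l ?(ltW e0)// lerDl.
have : (\int[P]_x (h x - g x) ^+ 2) / b <= e by rewrite ler_pdivrMr// mulrC.
lra.
Qed.

(** First variation of the squared distance: expand, divide by [e], let [e] tend to 0. The range
    [e <= 1] admits the direction [v = - h], along which [(1 - e) * h] must stay in the cone. *)
Lemma projection_variation u v : L2 P u -> L2 P v ->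
  (forall e : R, 0 < e <= 1 ->
    \int[P]_x u x ^+ 2 <= \int[P]_x (u x - e * v x) ^+ 2) ->
  dotL2 P u v <= 0.
Proof.
move=> u2 v2 H; pose V := \int[P]_x v x ^+ 2.
have V0 : 0 <= V by exact: sq_int_ge0.
have key e : 0 < e <= 1 -> 2 * dotL2 P u v <= e * V.
  move=> /[dup] /H + /andP[e0 _].
  rewrite (eq_Rintegral_lincomb (f := fun x => (u x - e * v x) ^+ 2)
    (s := [:: (1, fun x => u x ^+ 2); (- (2 * e), fun x => u x * v x);
              (e ^+ 2, fun x => v x ^+ 2)])) /=.
  - rewrite -/V -/(dotL2 P u v) => le.
    rewrite -(ler_pM2l e0); lra.
  - by split; [case: u2|split; [exact: L2_mul|split => //; case: v2]].
  - by move=> x; ring.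
rewrite leNgt; apply/negP => uv0.
pose e := Num.min 1 (dotL2 P u v / (V + 1)).
have e0 : 0 < e by rewrite lt_min ltr01 divr_gt0// ltr_wpDl.
have e1 : e <= 1 by rewrite ge_min lexx.
have := key e; rewrite e0 e1 => /(_ isT).
have : e * V <= dotL2 P u v.
  apply: le_trans (_ : dotL2 P u v / (V + 1) * V <= _).
    by rewrite ler_wpM2r// ge_min lexx orbT.
  rewrite mulrAC ler_pdivrMr ?ltr_wpDl//.
  by rewrite ler_wpM2l ?(ltW uv0)// lerDl.
lra.
Qed.

Lemma closureL2_L2 A h : L2_set A -> closureL2 P A h -> L2 P h.
Proof. by move=> A2 /(closureL2P _ A2)[]. Qed.

Lemma closureL2_cone A h g (a b : R) : L2_set A -> convex_cone A ->
  closureL2 P A h -> A g -> 0 <= a -> 0 <= b ->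
  closureL2 P A (fun x => a * h x + b * g x).
Proof.
move=> A2 cA /(closureL2P _ A2)[h2 H] Ag a0 b0; apply/closureL2P => //.
split; first exact: L2D (A2 _ Ag).
move=> e e0; have [|g' Ag' ge] := H (e / (a ^+ 2 + 1)).
  by rewrite divr_gt0// ltr_wpDl// sqr_ge0.
exists (fun x => a * g' x + b * g x); first exact: cA.
rewrite (eq_Rintegral_lincomb (s := [:: (a ^+ 2, fun x => (h x - g' x) ^+ 2)])) /=.
- rewrite addr0; apply: le_trans (ler_wpM2l (sqr_ge0 a) ge) _.
  rewrite mulrCA ler_piMr ?(ltW e0)// ler_pdivrMr ?ltr_wpDl ?sqr_ge0// mul1r.
  by rewrite lerDl.
- by split => //; have [] := L2B h2 (A2 _ Ag').
- by move=> x; ring.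
Qed.

Section cone_projection.
Variables (A : set (X -> R)) (f h : X -> R).
Hypotheses (A2 : L2_set A) (cA : convex_cone A) (f2 : L2 P f).
Hypothesis proj : is_projection P (closureL2 P A) f h.

Let h2 : L2 P h. Proof. by case: proj => /(closureL2_L2 A2). Qed.
Let fh2 : L2 P (f \- h). Proof. exact: L2B. Qed.

Let variation v : L2 P v ->
  (forall e : R, 0 < e <= 1 -> closureL2 P A (fun x => h x + e * v x)) ->
  dotL2 P (f \- h) v <= 0.
Proof.
move=> v2 H; apply: projection_variation => // e /H clo.
have := proj.2 _ clo; rewrite normL2_le//; last first.
  exact: (L2B f2 (closureL2_L2 A2 clo)).
move=> /le_trans; apply; rewrite le_eqVlt; apply/orP; left; apply/eqP.
by apply: eq_Rintegral => x _ /=; congr (_ ^+ 2); ring.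
Qed.

Lemma projection_cone_le0 g : A g -> dotL2 P (f \- h) g <= 0.
Proof.
move=> Ag; apply: variation => [|e /andP[e0 _]]; first exact: A2.
have := @closureL2_cone A h g 1 e A2 cA proj.1 Ag ler01 (ltW e0).
by congr (closureL2 P A); apply/funext => x; ring.
Qed.

(** A cone contains the ray through [h], so [h] can be varied in both directions [h] and [- h]. *)
Lemma projection_cone_orthogonal : dotL2 P (f \- h) h = 0.
Proof.
(* Any element of the cone, to fill the second argument of [closureL2_cone] with coefficient 0. *)
have [g Ag _] := ((closureL2P h A2).1 proj.1).2 1 ltr01.
apply/eqP; rewrite eq_le; apply/andP; split.
  apply: variation => // e /andP[e0 e1].
  have := @closureL2_cone A h g (1 + e) 0 A2 cA proj.1 Ag _ (lexx _).
  rewrite addr_ge0 ?(ltW e0)// => /(_ isT).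
  by congr (closureL2 P A); apply/funext => x; ring.
rewrite -oppr_le0.
have -> : - dotL2 P (f \- h) h = dotL2 P (f \- h) (fun x => -1 * h x + 0 * h x).
  by rewrite dotL2_lin//; ring.
apply: variation; first exact: L2D.
move=> e /andP[e0 e1].
have := @closureL2_cone A h g (1 - e) 0 A2 cA proj.1 Ag _ (lexx _).
rewrite subr_ge0 e1 => /(_ isT).
by congr (closureL2 P A); apply/funext => x; ring.
Qed.

End cone_projection.

Lemma span_L2 A : L2_set A -> L2_set (linear_span A).
Proof.
move=> A2 h [n [c [g [Ag ->]]]]; elim: n c g Ag => [|n IH] c g Ag.
  have := L2_cst P 0; congr (L2 P); apply/funext => x.
  by rewrite big_ord0.
have := L2D 1 (c ord_max) (IH (fun i => c (widen_ord (leqnSn n) i))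
  (fun i => g (widen_ord (leqnSn n) i)) (fun i => Ag _)) (A2 _ (Ag ord_max)).
by congr (L2 P); apply/funext => x; rewrite big_ord_recr/= mul1r.
Qed.

Lemma sub_linear_span A : A `<=` linear_span A.
Proof.
move=> g Ag; exists 1%N, (fun=> 1), (fun=> g); split => //.
by apply/funext => x; rewrite big_ord1 mul1r.
Qed.

Lemma dotL2_span_eq0 A u : L2_set A -> L2 P u ->
  (forall g, A g -> dotL2 P u g = 0) ->
  forall h, linear_span A h -> dotL2 P u h = 0.
Proof.
move=> A2 u2 u0 h [n [c [g [Ag ->]]]]; elim: n c g Ag => [|n IH] c g Ag.
  rewrite /dotL2 /Rintegral integral0_eq// => x _.
  by rewrite big_ord0 mulr0.
have S2 : L2 P (fun x => \sum_(i < n) c (widen_ord (leqnSn n) i) *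
    g (widen_ord (leqnSn n) i) x).
  by apply: (span_L2 A2); exists n, (fun i => c (widen_ord (leqnSn n) i)),
    (fun i => g (widen_ord (leqnSn n) i)).
have := dotL2_lin 1 (c ord_max) u2 S2 (A2 _ (Ag ord_max)).
have z := IH (fun i => c (widen_ord (leqnSn n) i))
  (fun i => g (widen_ord (leqnSn n) i)) (fun i => Ag _).
rewrite z (u0 _ (Ag ord_max)) !mulr0 addr0; apply: etrans.
by congr dotL2; apply/funext => x; rewrite big_ord_recr/= mul1r.
Qed.

Lemma dotL2_closure_eq0 A u : L2_set A -> L2 P u ->
  (forall g, A g -> dotL2 P u g = 0) ->
  forall h, closureL2 P A h -> dotL2 P u h = 0.
Proof.
move=> A2 u2 u0 h clo; apply/eqP; rewrite -normr_le0; apply/ler_addgt0Pr => e e0.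
rewrite add0r.
have [g Ag] := dotL2_closure A2 u2 clo e0.
by rewrite (u0 _ Ag) subr0.
Qed.

Lemma closureL2_sub A B : A `<=` B -> closureL2 P A `<=` closureL2 P B.
Proof.
move=> AB h [h2 H]; split => // e /H[g Ag ge].
by exists g => //; exact: AB.
Qed.

Lemma dotL2B u v f : L2 P u -> L2 P v -> L2 P f ->
  dotL2 P (u \- v) f = dotL2 P u f - dotL2 P v f.
Proof.
move=> u2 v2 f2; have := dotL2_linl 1 (-1) f2 u2 v2.
rewrite mul1r mulN1r => <-; congr dotL2; apply/funext => x /=; ring.
Qed.

(* If [f - h] were orthogonal to the cone, [h] would be the projection on the
   linear span as well. *)
Lemma exists_direction A f h k : L2_set A -> convex_cone A -> L2 P f ->
  is_projection P (closureL2 P A) f h ->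
  is_orthogonal_projection P (closureL2 P (linear_span A)) f k ->
  ~ (h = cst 0 %[ae P]) -> ~ (k = h %[ae P]) ->
  exists2 g, A g & 0 < dotL2 P f g < dotL2 P h g.
Proof.
move=> A2 cA f2 proj [clok orth] h0 kh.
have h2 : L2 P h by case: proj => /(closureL2_L2 A2).
have k2 : L2 P k := closureL2_L2 (span_L2 A2) clok.
have cloh : closureL2 P (linear_span A) h.
  by apply: closureL2_sub proj.1; exact: sub_linear_span.
have fh2 : L2 P (f \- h) by exact: L2B.
have [g2 Ag2 g2neg] : exists2 g, A g & dotL2 P (f \- h) g < 0.
  apply/not_exists2P => neg; apply: kh.
  have zero g : A g -> dotL2 P (f \- h) g = 0.
    move=> Ag; apply/eqP; rewrite eq_le (projection_cone_le0 A2 cA f2 proj Ag)/= leNgt.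
    by apply/negP => gneg; case: (neg g).
  have z1 := dotL2_closure_eq0 (span_L2 A2) fh2 (dotL2_span_eq0 A2 fh2 zero).
  have kh2 : L2 P (k \- h) by exact: L2B.
  have d0 v : closureL2 P (linear_span A) v -> dotL2 P (k \- h) v = 0.
    move=> clov; have v2 := closureL2_L2 (span_L2 A2) clov.
    have := orth v clov; have := z1 v clov; rewrite !dotL2B//.
    lra.
  have : \int[P]_x ((k \- h) x) ^+ 2 = 0.
    transitivity (dotL2 P (k \- h) (fun x => 1 * k x + -1 * h x)).
      by apply: eq_Rintegral => x _ /=; ring.
    by rewrite dotL2_lin// !d0// !mulr0 addr0.
  move=> /(sq_int_eq0 kh2); apply: filterS => x /= /(_ I) xE _.
  by apply/eqP; rewrite -subr_eq0 xE.
have hh : 0 < dotL2 P h h.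
  have hhE : dotL2 P h h = \int[P]_x h x ^+ 2.
    by apply: eq_Rintegral => x _; rewrite expr2.
  rewrite hhE lt_neqAle sq_int_ge0 andbT; apply/negP => /eqP E.
  by apply: h0; apply: sq_int_eq0.
have fh : dotL2 P f h = dotL2 P h h.
  by have := projection_cone_orthogonal A2 cA f2 proj; rewrite dotL2B//; lra.
have [g1 Ag1 g1e] : exists2 g, A g & `|dotL2 P f h - dotL2 P f g| <= dotL2 P h h / 2.
  by apply: dotL2_closure => //; [exact: proj.1|rewrite divr_gt0].
have fg1 : 0 < dotL2 P f g1.
  by move: g1e; rewrite fh ler_norml => /andP[_]; lra.
(* Small enough that adding [e * g2] costs at most half of [dotL2 P f g1]. Strictness of the second
   inequality comes from [g2] alone, with any [e > 0]. *)
pose e := dotL2 P f g1 / (2 * (`|dotL2 P f g2| + 1)).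
have e0 : 0 < e by rewrite divr_gt0// mulr_gt0// ltr_wpDl.
exists (fun x => 1 * g1 x + e * g2 x); first by apply: cA => //; exact: ltW.
rewrite !dotL2_lin ?A2//; try exact: A2.
have l1 := projection_cone_le0 A2 cA f2 proj Ag1.
move: l1 g2neg; rewrite !dotL2B ?A2//; try exact: A2.
move=> l1 l2; apply/andP; split; last first.
  have : dotL2 P f g2 < dotL2 P h g2 by lra.
  by rewrite -(ltr_pM2l e0); lra.
have : e * `|dotL2 P f g2| <= dotL2 P f g1 / 2.
  rewrite /e mulrAC ler_pdivrMr ?mulr_gt0 ?ltr_wpDl//.
  by have := normr_ge0 (dotL2 P f g2); nra.
have : - `|dotL2 P f g2| <= dotL2 P f g2 by rewrite lerNl ler_normr lexx orbT.
move=> /(ler_wpM2l (ltW e0)); lra.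
Qed.

End L2_geometry.

(** * Paths and estimators *)

Section paths.
Context d (X : measurableType d) (R : realType).
Implicit Types (P : probability X R) (Q : R -> probability X R) (g : X -> R).

Lemma cvg_at_right0 (u : nat -> R) : u n @[n --> \oo] --> (0 : R) ->
  (\forall n \near \oo, 0 < u n) -> u n @[n --> \oo] --> 0^'+.
Proof.
move=> cu pu A; rewrite /at_right /within /= => nA.
have := cu _ nA; rewrite !nbhs_simpl/=.
near_simpl => H; near=> n.
have : 0 < u n by near: n.
by near: n.
Unshelve. all: by end_near. Qed.

Lemma cvg_local_parameter (t : R) : 0 < t ->
  (t * rsqrt n) @[n --> \oo] --> 0^'+.
Proof.
move=> t0; apply: cvg_at_right0.
  rewrite -[X in _ --> X](mulr0 t).
  by apply: cvgM; [exact: cvg_cst|exact: cvg_rsqrt].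
near=> n; have n0 : (0 < n)%N by near: n; exact: nbhs_infty_gt.
by rewrite mulr_gt0// invr_gt0 sqrtr_gt0 ltr0n.
Unshelve. all: by end_near. Qed.

(** Each [n] has its own dominating measure and its own [h n]; only the estimates are common. As
    [Num.sqrt (rho n)] is [o(s)] at [s = t * rsqrt n], squaring gives [rho n = o(1 / n)]. *)
Lemma path_expansion PP P g Q (t : R) : is_path PP P g Q -> 0 < t ->
  exists (h : nat -> X -> R) (rho : nat -> R),
  [/\ forall n, 0 <= rho n,
      forall n, local_density P (Q (t * rsqrt n)) (h n)
        (8 * rho n + 2 * (t * rsqrt n) ^+ 2 * \int[P]_x cut_tail (h n) g x),
      forall n, \int[P]_x (h n x - t * rsqrt n * g x / 2) ^+ 2 <= rho n,
      forall n, \int[P]_x (1 + h n x) ^+ 2 <= 1 &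
      n%:R * rho n @[n --> \oo] --> (0 : R)].
Proof.
move=> [/Lfun2P g2 _ rem0] t0.
pose W n (p : (X -> R) * R) := [/\
  sqrt_remainder P (Q (t * rsqrt n)) g (t * rsqrt n) = (Num.sqrt p.2)%:E, 0 <= p.2,
  local_density P (Q (t * rsqrt n)) p.1
        (8 * p.2 + 2 * (t * rsqrt n) ^+ 2 * \int[P]_x cut_tail p.1 g x),
  \int[P]_x (p.1 x - t * rsqrt n * g x / 2) ^+ 2 <= p.2 &
  \int[P]_x (1 + p.1 x) ^+ 2 <= 1].
have [p pW] : {p & forall n, W n (p n)}.
  apply: choice => n.
  have [rho re [rho0 [h [h2 h1 hr hle hF]]]] :=
    hellinger_density (Q (t * rsqrt n)) (t * rsqrt n) g2.
  exists (h, rho); split => //; split => // F mF F01.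
  by have [-> ->] := hF F mF F01.
exists (fun n => (p n).1), (fun n => (p n).2); split=> [n|n|n|n|].
- by have [] := pW n.
- by have [] := pW n.
- by have [] := pW n.
- by have [] := pW n.
have cv : (sqrt_remainder P (Q (t * rsqrt n)%R) g (t * rsqrt n)%R *
    ((t * rsqrt n)^-1)%:E)%E @[n --> \oo] --> (0 : \bar R).
  exact: cvg_comp (cvg_local_parameter t0) rem0.
have {}cv : (Num.sqrt (p n).2 / (t * rsqrt n)) @[n --> \oo] --> (0 : R).
  move/fine_cvgP : cv => [_]; apply: cvg_trans.
  apply: near_eq_cvg; apply: nearW => n /=.
  by have [-> _ _ _ _] := pW n.
have cv2 : t ^+ 2 * (Num.sqrt (p n).2 / (t * rsqrt n) *
    (Num.sqrt (p n).2 / (t * rsqrt n))) @[n --> \oo] --> t ^+ 2 * (0 * 0).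
  by apply: cvgM; [exact: cvg_cst|exact: cvgM].
rewrite !mulr0 in cv2; apply: cvg_trans cv2; apply: near_eq_cvg.
near=> n; have n0 : (0 < n)%N by near: n; exact: nbhs_infty_gt.
have s0 : 0 < Num.sqrt n%:R :> R by rewrite sqrtr_gt0 ltr0n.
have [_ rho0 _ _ _] := pW n.
rewrite -expr2 expr_div_n sqr_sqrtr// /rsqrt -[in RHS](@sqr_sqrtr R n%:R)//.
by field; rewrite !gt_eqF.
Unshelve. all: by end_near. Qed.

End paths.

(** * From smoothed sums to the error probability of the estimator *)

Section estimator_limit.
Context d (X : measurableType d) (R : realType).

Lemma Rintegral_indicator (d' : measure_display) (T : measurableType d')
    (Q : probability T R) (A : set T) :
  measurable A -> \int[Q]_x (\1_A x) = fine (Q A).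
Proof. by move=> mA; rewrite /Rintegral integral_indic// setIT. Qed.

Lemma integrable_indicator (d' : measure_display) (T : measurableType d')
    (Q : probability T R) (A : set T) :
  measurable A -> Q.-integrable setT (EFin \o (\1_A : T -> R)).
Proof.
move=> mA; apply: (@integrable_bounded _ _ _ _ _ 1) => // x.
by rewrite indicE ger0_norm// lern1 leq_b1.
Qed.

(** Here [e] is the margin around the threshold. Smoothing with variance [e ^+ 4] has standard
    deviation [e ^+ 2], negligible at distance [e]: since [e / Num.sqrt (e ^+ 4)] is [e^-1], the
    smoothed indicator tends to 1 and 0 on the two sides. *)
Lemma heat_limits (S y : R) : 0 < S ->
  [/\ heat (e ^+ 4 + S) (y + 3 * e) @[e --> 0^'+] --> gauss_cdf (y / Num.sqrt S),
      heat (e ^+ 4 + S) (y - 3 * e) @[e --> 0^'+] --> gauss_cdf (y / Num.sqrt S),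
      gauss_cdf (e / Num.sqrt (e ^+ 4)) @[e --> 0^'+] --> (1 : R) &
      gauss_cdf (- e / Num.sqrt (e ^+ 4)) @[e --> 0^'+] --> (0 : R)].
Proof.
move=> S0; have FF : Filter (0:R)^'+ by exact: at_right_proper_filter.
have cid : e @[e --> (0:R)^'+] --> (0 : R) by exact: cvg_at_right_filter.
have c4 : Num.sqrt (e ^+ 4 + S) @[e --> (0:R)^'+] --> Num.sqrt S.
  apply: (continuous_cvg _ (@sqrt_continuous R S)).
  rewrite -[X in _ --> X]add0r; apply: cvgD; last exact: cvg_cst.
  apply: cvg_at_right_filter; have := @exprn_continuous R 4 0.
  by rewrite /continuous_at expr0n.
have S1 : Num.sqrt S != 0 by rewrite gt_eqF// sqrtr_gt0.
have ci := cvgV S1 c4.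
have inv e : 0 < e -> e / Num.sqrt (e ^+ 4) = e^-1.
  move=> e0; rewrite (_ : e ^+ 4 = (e ^+ 2) ^+ 2); last by rewrite -exprM.
  by rewrite sqrtr_sqr ger0_norm ?sqr_ge0//; field; rewrite gt_eqF.
have pos : \forall e \near (0:R)^'+, 0 < e by exact: nbhs_right_gt.
have c3 : 3 * e @[e --> (0:R)^'+] --> 3 * (0:R).
  by apply: cvgM => //; exact: cvg_cst.
rewrite mulr0 in c3.
split.
- apply: continuous_cvg; first exact: continuous_gauss_cdf.
  apply: cvgM; last exact: ci.
  by rewrite -[X in _ --> X]addr0; apply: cvgD => //; exact: cvg_cst.
- apply: continuous_cvg; first exact: continuous_gauss_cdf.
  apply: cvgM; last exact: ci.
  by rewrite -[X in _ --> X]subr0; apply: cvgB => //; exact: cvg_cst.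
- have : gauss_cdf e^-1 @[e --> (0:R)^'+] --> (1 : R).
    apply: (cvg_comp (fun e : R => e^-1) _ _ gauss_cdf_cvgy).
    apply/(cvgrVy (f := id)) => //; exact: nbhs_right_gt.
  by apply: cvg_trans; apply: near_eq_cvg; apply: filterS pos => e e0; rewrite inv.
- have : gauss_cdf (- e)^-1 @[e --> (0:R)^'+] --> (0 : R).
    apply: (cvg_comp (fun e : R => (- e)^-1) _ _ gauss_cdf_cvgNy).
    apply/(cvgrVNy (f := -%R)).
      by near do rewrite oppr_lt0; exact: nbhs_right_gt.
    by rewrite -[X in _ --> X]oppr0; exact: cvgN.
  apply: cvg_trans; apply: near_eq_cvg; apply: filterS pos => e e0.
  by rewrite mulNr inv// invrN.
Unshelve. all: by end_near. Qed.

Section covering.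
Context (d' : measure_display) (T : measurableType d') (Q : probability T R).
Variables (A B : set T) (f : T -> R) (eps : R).
Hypotheses (mA : measurable A) (mB : measurable B).
Hypotheses (mf : measurable_fun setT f) (f01 : forall x, 0 <= f x <= 1).
Hypothesis eps0 : 0 <= eps.

Let iA := integrable_indicator Q mA.
Let iB := integrable_indicator Q mB.
Let i1 : Q.-integrable setT (EFin \o cst 1). Proof. exact: integrable_cst. Qed.
Let if0 : Q.-integrable setT (EFin \o f).
Proof.
by apply: (@integrable_bounded _ _ _ _ _ 1) => // x; have /andP[? ?] := f01 x;
  rewrite ger0_norm.
Qed.

(** Applied with [A] the event of interest, [B] the set where the expansion of the estimator fails
    and [f] a smoothed indicator. *)
Lemma prob_le_cover : (forall x, A x -> ~ B x -> 1 <= f x + eps) ->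
  fine (Q A) <= fine (Q B) + \int[Q]_x f x + eps.
Proof.
move=> ABf; have le := @le_Rintegral_lincomb _ _ _ Q (\1_A)
  [:: (1, \1_B); (1, f); (eps, cst 1)] iA (conj iB (conj if0 (conj i1 I))).
rewrite /= Rintegral1_probability !Rintegral_indicator// in le.
rewrite addr0 !mul1r mulr1 addrA in le; apply: le => x.
have /andP[f0 _] := f01 x; rewrite !mul1r !indicE.
have [xA|_] := boolP (x \in A); last by rewrite !addr_ge0.
have [_|xB] := boolP (x \in B); first by rewrite lerDl addr_ge0.
rewrite add0r; apply: ABf; first by rewrite inE in xA.
by move=> xB'; rewrite notin_setE in xB.
Qed.

Lemma integral_le_cover : (forall x, ~ A x -> ~ B x -> f x <= eps) ->
  \int[Q]_x f x <= fine (Q A) + fine (Q B) + eps.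
Proof.
move=> ABf; have le := @le_Rintegral_lincomb _ _ _ Q f
  [:: (1, \1_A); (1, \1_B); (eps, cst 1)] if0 (conj iA (conj iB (conj i1 I))).
rewrite /= Rintegral1_probability !Rintegral_indicator// in le.
rewrite addr0 !mul1r mulr1 addrA in le; apply: le => x.
have /andP[f0 f1] := f01 x; rewrite !mul1r !indicE.
have [_|xA] := boolP (x \in A); first by rewrite (le_trans f1)// lerDl addr_ge0.
have [_|xB] := boolP (x \in B); first by rewrite add0r (le_trans f1)// lerDl.
rewrite !add0r; apply: ABf.
  by rewrite notin_setE in xA.
by rewrite notin_setE in xB.
Qed.

End covering.

Lemma squeeze_eighths (L e : R) : 0 < e ->
  [/\ L + e / 8 < L + e / 4, L - e / 4 < L - e / 8 &
  forall a b u v : R, a <= b + u + e / 8 -> v <= a + b + e / 8 -> b <= e / 8 ->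
  u <= L + e / 4 -> L - e / 4 <= v -> `|a - L| <= e].
Proof.
by move=> e0; split => [||a b u v h1 h2 h3 h4 h5]; [lra|lra|rewrite ler_norml; lra].
Qed.

Section event.
Variables (s e T0 T W al dl eta eps : R).
Hypotheses (s0 : 0 < s) (eta0 : 0 < eta) (dl0 : 0 < dl) (dal : dl <= al / 3).
Hypothesis sT : `|s * (T - T0) - al| <= dl.
Hypothesis close : `|s * positive_part (e - T0) - positive_part W| <= dl.

(** The point where [al > 0] enters: [T - T0] is then nonnegative, and [e <= T] can be read off the
    positive part, which is all that the assumption on the estimator controls. *)
Let eE : (e <= T) = (s * positive_part (e - T0) <= s * (T - T0)).
Proof.
have aT : 0 <= T - T0.
  rewrite -(pmulr_rge0 _ s0); have := dl0; have := dal.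
  by move: sT; rewrite ler_norml => /andP[h1 h2] h3 h4; lra.
by rewrite ler_pM2l// /positive_part ge_max aT andbT lerD2r.
Qed.

Let rs0 : 0 <= (Num.sqrt eta)^-1. Proof. by rewrite invr_ge0. Qed.

(** Of the [3 * dl], one [dl] pays for [sT], one for [close], and the third keeps the argument of
    [heat] at least [dl] away from 0. *)
Lemma accept_le_heat : 1 - eps <= gauss_cdf (dl / Num.sqrt eta) -> e <= T ->
  1 <= heat eta (al + 3 * dl - W) + eps.
Proof.
rewrite eE -lerBlDr => d3 eT; apply: le_trans d3 _.
apply: gauss_cdf_nondecreasing; rewrite ler_wpM2r//.
have : W <= positive_part W by rewrite le_max lexx.
move: sT close; rewrite !ler_norml => /andP[_ h1] /andP[h2 _]; lra.
Qed.

Lemma heat_le_reject : gauss_cdf (- dl / Num.sqrt eta) <= eps -> ~ (e <= T) ->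
  heat eta (al - 3 * dl - W) <= eps.
Proof.
move=> d4 eT; apply: le_trans d4.
apply: gauss_cdf_nondecreasing; rewrite ler_wpM2r// leNgt.
apply/negP => Wlt; apply: eT; rewrite eE.
have : positive_part W <= al - 2 * dl.
  by have h1 := dal; have h2 := dl0; rewrite ge_max; apply/andP; split; lra.
move: sT close; rewrite !ler_norml => /andP[h1 _] /andP[_ h2]; lra.
Qed.

End event.

Variables (P : probability X R) (Q : nat -> probability X R) (k : X -> R).
Hypothesis mk : measurable_fun setT k.
Variables (S m : R).
Hypothesis S0 : 0 < S.
Hypothesis contig : forall A : forall n, set (n.-tuple X),
  (forall n, measurable (A n)) -> prob_power P n (A n) @[n --> \oo] --> 0%E ->
  fine (prob_power (Q n) n (A n)) @[n --> \oo] --> (0 : R).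
Hypothesis clt : forall eta w : R, 0 < eta ->
  \int[prob_power (Q n) n]_x
     heat eta (w - rsqrt n * \sum_(i < n) k (tnth x i)) @[n --> \oo] -->
  heat (eta + S) (w - m).

(** The set [B] where the expansion fails is small under [P] by assumption, hence under the
    alternatives by contiguity. Off [B] the event is sandwiched between two smoothed indicators with
    thresholds [al + 3 * dl] and [al - 3 * dl], whose integrals converge for fixed [dl]. *)
Lemma estimator_limit (E : forall n, {mfun n.-tuple X >-> R}) (T0 al : R)
    (T : nat -> R) : 0 < al ->
  Num.sqrt n%:R * (T n - T0) @[n --> \oo] --> al ->
  tends_to_0_in_prob P (fun n x => Num.sqrt n%:R * positive_part (E n x - T0)
    - positive_part ((Num.sqrt n%:R)^-1 * \sum_(i < n) k (tnth x i))) ->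
  prob_power (Q n) n [set x | E n x <= T n] @[n --> \oo] -->
    (gauss_cdf ((al - m) / Num.sqrt S))%:E.
Proof.
move=> al0 Tal ER.
set L := gauss_cdf _.
pose A n := [set x : n.-tuple X | E n x <= T n].
have mA n : measurable (A n).
  rewrite -[A n]setTI.
  have mEn : measurable_fun setT (E n) by [].
  have := mEn measurableT `]-oo, T n]%classic (measurable_itv _).
  by congr (measurable (_ `&` _)); apply/seteqP; split => x /=; rewrite in_itv.
have mW n : measurable_fun setT
    (fun x : n.-tuple X => rsqrt n * \sum_(i < n) k (tnth x i)).
  by apply: measurable_funM => //; exact: measurable_sum_tnth.
pose Y n (x : n.-tuple X) := Num.sqrt n%:R * positive_part (E n x - T0)
    - positive_part (rsqrt n * \sum_(i < n) k (tnth x i)).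
have mY n : measurable_fun setT (Y n).
  apply: measurable_funB; last by apply: measurable_maxr => //; exact: mW.
  apply: measurable_funM => //; apply: measurable_maxr => //.
  exact: measurable_funB.
pose B e n := [set x : n.-tuple X | e < `|Y n x|].
have mB e n : measurable (B e n).
  rewrite -[B e n]setTI.
  have mYn : measurable_fun setT (fun x => `|Y n x|).
    by apply: measurableT_comp => //; exact: mY.
  have := mYn measurableT `]e, +oo[%classic (measurable_itv _).
  by congr (measurable (_ `&` _)); apply/seteqP; split => x; rewrite /B/= in_itv/= andbT.
suff cvA : fine (prob_power (Q n) n (A n)) @[n --> \oo] --> L.
  apply/fine_cvgP; split => //.
  by apply: nearW => n; rewrite fin_num_measure//; exact: mA.
apply/subr_cvg0; apply: cvg0_param => e e0.
have [h1 h2 h3 h4] := heat_limits (al - m) S0.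
have e8 : 0 < e / 8 by rewrite divr_gt0.
have [Le8 Le8' arith] := squeeze_eighths L e0.
have [dl [/andP[dl0 dal] d1 d2 d3 d4]] : exists dl, [/\ 0 < dl <= al / 3,
    heat (dl ^+ 4 + S) (al - m + 3 * dl) <= L + e / 8,
    L - e / 8 <= heat (dl ^+ 4 + S) (al - m - 3 * dl),
    1 - e / 8 <= gauss_cdf (dl / Num.sqrt (dl ^+ 4)) &
    gauss_cdf (- dl / Num.sqrt (dl ^+ 4)) <= e / 8].
  suff /filter_ex[dl] : \forall dl \near (0:R)^'+, [/\ 0 < dl <= al / 3,
    heat (dl ^+ 4 + S) (al - m + 3 * dl) <= L + e / 8,
    L - e / 8 <= heat (dl ^+ 4 + S) (al - m - 3 * dl),
    1 - e / 8 <= gauss_cdf (dl / Num.sqrt (dl ^+ 4)) &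
    gauss_cdf (- dl / Num.sqrt (dl ^+ 4)) <= e / 8] by exists dl.
  near=> dl; split.
  - apply/andP; split; near: dl; first exact: nbhs_right_gt.
    by apply: nbhs_right_le; exact: divr_gt0.
  - near: dl; apply: (cvgr_le _ h1); rewrite ltrDl//.
  - near: dl; apply: (cvgr_ge _ h2); rewrite ltrBlDr ltrDl//.
  - near: dl; apply: (cvgr_ge _ h3); rewrite ltrBlDr ltrDl//.
  - near: dl; exact: (cvgr_le _ h4).
pose eta := dl ^+ 4.
have eta0 : 0 < eta by rewrite exprn_gt0.
have cB := contig (mB dl) (ER dl dl0).
have c1 := @clt eta (al + 3 * dl) eta0; have c2 := @clt eta (al - 3 * dl) eta0.
exists (fun=> 0); first exact: cvg_cst.
near=> n; have n0 : (0 < n)%N by near: n; exact: nbhs_infty_gt.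
have s0 : 0 < Num.sqrt n%:R :> R by rewrite sqrtr_gt0 ltr0n.
have sT : `|Num.sqrt n%:R * (T n - T0) - al| <= dl.
  rewrite distrC; near: n; by move/cvgrPdist_le : Tal; apply.
have lB : fine (prob_power (Q n) n (B dl n)) <= e / 8 by near: n; exact: (cvgr_le _ cB).
have l1 : \int[prob_power (Q n) n]_x heat eta
    (al + 3 * dl - rsqrt n * \sum_(i < n) k (tnth x i)) <= L + e / 4.
  near: n; apply: (cvgr_le _ c1); apply: (le_lt_trans _ Le8).
  by rewrite (_ : al + 3 * dl - m = al - m + 3 * dl); [exact: d1|ring].
have l2 : L - e / 4 <= \int[prob_power (Q n) n]_x heat eta
    (al - 3 * dl - rsqrt n * \sum_(i < n) k (tnth x i)).
  near: n; apply: (cvgr_ge _ c2); apply: (lt_le_trans Le8').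
  by rewrite (_ : al - 3 * dl - m = al - m - 3 * dl); [exact: d2|ring].
have mh w : measurable_fun setT
    (fun x : n.-tuple X => heat eta (w - rsqrt n * \sum_(i < n) k (tnth x i))).
  apply: (measurableT_comp (measurable_heat eta)); apply: measurable_funB => //.
  exact: mW.
have h01 w (x : n.-tuple X) :
    0 <= heat eta (w - rsqrt n * \sum_(i < n) k (tnth x i)) <= 1.
  by rewrite heat_ge0 heat_le1.
have close x : ~ B dl n x -> `|Y n x| <= dl.
  by move=> xB; rewrite leNgt; apply/negP => xB'.
have U := prob_le_cover (prob_power (Q n) n) (mA n) (mB dl n)
  (mh (al + 3 * dl)) (h01 (al + 3 * dl)) (ltW e8)
  (fun x xA xB => accept_le_heat s0 dl0 dal sT (close x xB) d3 xA).
have V := integral_le_cover (prob_power (Q n) n) (mA n) (mB dl n)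
  (mh (al - 3 * dl)) (h01 (al - 3 * dl)) (ltW e8)
  (fun x xA xB => heat_le_reject s0 dl0 dal sT (close x xB) d4 xA).
rewrite addr0.
exact: (arith _ _ _ _ U V lB l1 l2).
Unshelve. all: by end_near. Qed.

End estimator_limit.

(** * Tangents, gradients and the limit of the error probability *)

Section main.
Context (R : realType) (d : measure_display) (X : measurableType d).
Variables (PP : set (probability X R)) (P : probability X R).

Lemma tangent_set_L2 : L2_set P (tangent_set PP P).
Proof. by move=> g [Q [/Lfun2P]]. Qed.

Lemma tangent_mean_zero g : tangent_set PP P g -> \int[P]_x g x = 0.
Proof.
move=> Ag; have g2 := tangent_set_L2 Ag; have [Q pathQ] := Ag.
have [h [rho [r0 hQ hg h1 nrho]]] := path_expansion pathQ ltr01.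
exact: (@expansion_mean_zero _ _ _ P (fun n => Q (1 * rsqrt n)) g 1 h rho g2
  (fun n _ => r0 n) (fun n _ => hQ n) (fun n _ => hg n) (fun n _ => h1 n) nrho ltr01).
Qed.

Lemma closure_tangent_mean_zero k : closureL2 P (tangent_set PP P) k ->
  \int[P]_x k x = 0.
Proof.
move=> clok.
have <- : dotL2 P (cst 1) k = 0; last first.
  by apply: eq_Rintegral => x _; rewrite mul1r.
apply: (dotL2_closure_eq0 tangent_set_L2 (L2_cst P 1) _ clok) => g Ag.
by rewrite -(tangent_mean_zero Ag); apply: eq_Rintegral => x _; rewrite mul1r.
Qed.

Lemma gradient_limit (T : probability X R -> R) kappa g Q (t : R) :
  is_gradient PP P T kappa -> is_path PP P g Q -> 0 < t ->
  Num.sqrt n%:R * (T (Q (t * rsqrt n)) - T P) @[n --> \oo] -->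
    t * dotL2 P kappa g.
Proof.
move=> [_ grad] pathQ t0; apply/cvgrPdist_le => e e0.
have /eqoP lo := grad g Q pathQ.
have near_s : \forall n \near \oo,
    `|T (Q (t * rsqrt n)) - (T P + t * rsqrt n * dotL2 P kappa g)| <=
    e / t * `|t * rsqrt n|.
  exact: (cvg_local_parameter t0 (lo _ (divr_gt0 e0 t0))).
near=> n; have n0 : (0 < n)%N by near: n; exact: nbhs_infty_gt.
have sn0 : 0 < Num.sqrt n%:R :> R by rewrite sqrtr_gt0 ltr0n.
have cs : rsqrt n * Num.sqrt n%:R = 1 :> R by rewrite mulVf// gt_eqF.
have : `|T (Q (t * rsqrt n)) - (T P + t * rsqrt n * dotL2 P kappa g)| <=
    e / t * `|t * rsqrt n| by near: n; exact: near_s.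
set Tn := T (Q _); set a := dotL2 P kappa g => le.
have -> : t * a - Num.sqrt n%:R * (Tn - T P) =
   Num.sqrt n%:R * - (Tn - (T P + t * rsqrt n * a)).
  have -> : t * a = t * (rsqrt n * Num.sqrt n%:R) * a by rewrite cs mulr1.
  by ring.
rewrite normrM normrN (ger0_norm (ltW sn0)).
apply: le_trans (ler_wpM2l (ltW sn0) le) _.
have rn0 : 0 < rsqrt n :> R by rewrite invr_gt0.
rewrite ger0_norm ?mulr_ge0 ?(ltW t0) ?(ltW rn0)//.
rewrite (_ : Num.sqrt n%:R * (e / t * (t * rsqrt n)) = e * (rsqrt n * Num.sqrt n%:R)).
  by rewrite cs mulr1.
by field; rewrite gt_eqF.
Unshelve. all: by end_near. Qed.

(* Le Cam's third lemma *)
Lemma local_power_limit (T : probability X R -> R) kappa k g Q (t : R)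
    (E : forall n, {mfun n.-tuple X >-> R}) :
  is_gradient PP P T kappa -> closureL2 P (tangent_set PP P) k ->
  0 < \int[P]_x k x ^+ 2 -> is_path PP P g Q -> 0 < t -> 0 < dotL2 P kappa g ->
  tends_to_0_in_prob P (fun n x => Num.sqrt n%:R * positive_part (E n x - T P)
    - positive_part ((Num.sqrt n%:R)^-1 * \sum_(i < n) k (tnth x i))) ->
  prob_power (local_alternative Q t n) n
    [set x | E n x <= T (local_alternative Q t n)] @[n --> \oo] -->
  (gauss_cdf (t * (dotL2 P kappa g - dotL2 P k g)
    / Num.sqrt (\int[P]_x k x ^+ 2)))%:E.
Proof.
move=> grad clok S0 pathQ t0 a0 ER.
have k2 : L2 P k := closureL2_L2 tangent_set_L2 clok.
have g2 : L2 P g by case: pathQ => /Lfun2P.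
have mk : measurable_fun setT k by case: k2.
have [h [rho [r0 hQ hg h1 nrho]]] := path_expansion pathQ t0.
pose Qn n := Q (t * rsqrt n).
have hQ' n (_ : (0 < n)%N) : local_density P (Qn n) (h n)
  (8 * rho n + 2 * (t * rsqrt n) ^+ 2 * \int[P]_x cut_tail (h n) g x) := hQ n.
have r0' n (_ : (0 < n)%N) : 0 <= rho n := r0 n.
have hg' n (_ : (0 < n)%N) :
  \int[P]_x (h n x - t * rsqrt n * g x / 2) ^+ 2 <= rho n := hg n.
have h1' n (_ : (0 < n)%N) : \int[P]_x (1 + h n x) ^+ 2 <= 1 := h1 n.
have nbeta := cvg_singular_mass g2 r0' hQ' hg' nrho.
have lim0 := cvg_density_mass g2 r0' hQ' hg' nrho.
have [B sqB] := density_sq_bound g2 hQ' hg' h1' nrho.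
(* The limit theorem is applied to [- k]: the event bounds the sum from above, whereas [heat]
   increases in its argument. *)
have Nk2 : L2 P (fun x => - k x).
  by have := L2Z (-1) k2; congr L2; apply/funext => x; rewrite mulN1r.
have Nk0 : \int[P]_x - k x = 0.
  rewrite (eq_Rintegral_lincomb (s := [:: (-1, k)])) /=.
  - by rewrite (closure_tangent_mean_zero clok) mulr0 addr0.
  - by split => //; exact: L2_integrable.
  - by move=> x; rewrite addr0 mulN1r.
have lim1 := cvg_moment1 g2 Nk2 Nk0 hQ' hg' nrho.
have lim2 := cvg_moment2 g2 Nk2 hQ' hg' nrho.
have NkS : \int[P]_x (- k x) ^+ 2 = \int[P]_x k x ^+ 2.
  by apply: eq_Rintegral => x _; rewrite sqrrN.
have Nkg : \int[P]_x (- k x * g x) = - dotL2 P k g.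
  rewrite (eq_Rintegral_lincomb (s := [:: (-1, fun x => k x * g x)])) /=.
  - by rewrite addr0 mulN1r.
  - by split => //; exact: L2_mul.
  - by move=> x; ring.
have clt (eta w : R) : 0 < eta -> \int[prob_power (Qn n) n]_x
     heat eta (w - rsqrt n * \sum_(i < n) k (tnth x i)) @[n --> \oo] -->
     heat (eta + \int[P]_x k x ^+ 2) (w - t * dotL2 P k g).
  move=> eta0.
  have := @local_clt _ _ _ P Qn h _ hQ' nbeta _ _ eta (w - t * dotL2 P k g)
    Nk2 eta0 lim0 lim1 lim2.
  rewrite NkS Nkg; apply: cvg_trans; apply: near_eq_cvg; apply: nearW => n.
  apply: eq_Rintegral => x _; congr heat.
  by rewrite sumrN; ring.
have al0 : 0 < t * dotL2 P kappa g by rewrite mulr_gt0.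
have := @estimator_limit _ _ _ P Qn k mk _ _ S0
  (fun A mA PA => contiguity hQ' nbeta sqB mA PA) clt E (T P) _
  (fun n => T (Qn n)) al0 (gradient_limit grad pathQ t0) ER.
by rewrite -mulrBr.
Qed.

End main.

Theorem proposition3p5 (R : realType) (d : measure_display)
    (X : measurableType d)
    (PP : set (probability X R)) (P : probability X R)
    (T : probability X R -> R)
    (kappa kappa_tilde kappa_bar : X -> R)
    (Pg : (X -> R) -> R -> probability X R) :
  PP P ->
  convex_cone (tangent_set PP P) ->
  (forall g, tangent_set PP P g -> is_path PP P g (Pg g)) ->
  is_gradient PP P T kappa ->
  is_projection P (closureL2 P (tangent_set PP P)) kappa kappa_tilde ->
  is_orthogonal_projection P (closureL2 P (linear_span (tangent_set PP P)))
    kappa kappa_bar ->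
  ~ (kappa_tilde = cst 0 %[ae P]) ->
  ~ (kappa_bar = cst 0 %[ae P]) ->
  ~ (kappa_bar = kappa_tilde %[ae P]) ->
  exists g0 : X -> R,
    [/\ tangent_set PP P g0,
        0 < dotL2 P kappa g0 &
        forall S : forall n : nat, {mfun n.-tuple X >-> R},
          tends_to_0_in_prob P (fun n x =>
            Num.sqrt n%:R * positive_part (S n x - T P)
            - positive_part ((Num.sqrt n%:R)^-1
                             * \sum_(i < n) kappa_tilde (tnth x i))) ->
          let err (t : R) (n : nat) : \bar R :=
            prob_power (local_alternative (Pg g0) t n) n
              [set x | S n x <= T (local_alternative (Pg g0) t n)] in
          (forall t : R, 0 < t -> cvgn (err t)) /\
          ereal_inf [set limn (err t) | t in [set t : R | 0 < t]] = 0%E].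
Proof.
move=> _ cone path grad proj orth kt0 _ kbt.
have A2 := @tangent_set_L2 R d X PP P.
have k2 : L2 P kappa by case: grad => /Lfun2P.
have [g0 Ag0 /andP[a0 ab]] := exists_direction A2 cone k2 proj orth kt0 kbt.
exists g0; split => // S ES err.
have kt2 : L2 P kappa_tilde := closureL2_L2 A2 proj.1.
have S0 : 0 < \int[P]_x kappa_tilde x ^+ 2.
  rewrite lt_neqAle sq_int_ge0 andbT; apply/negP => /eqP E.
  by apply: kt0; apply: sq_int_eq0.
set a := dotL2 P kappa g0 in a0 ab; set b := dotL2 P kappa_tilde g0 in ab.
set s := Num.sqrt (\int[P]_x kappa_tilde x ^+ 2).
have s0 : 0 < s by rewrite sqrtr_gt0.
have errL t : 0 < t -> err t n @[n --> \oo] --> (gauss_cdf (t * (a - b) / s))%:E.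
  by move=> t0; exact: local_power_limit grad proj.1 S0 (path g0 Ag0) t0 a0 ES.
split=> [t t0|]; first by apply/cvg_ex; eexists; exact: errL.
apply/eqP; rewrite eq_le; apply/andP; split; last first.
  apply/ereal_infP => _ [t t0 <-]; rewrite (cvg_lim _ (errL t t0))//.
  by rewrite lee_fin gauss_cdf_ge0.
apply/lee_addgt0Pr => e e0; rewrite add0e.
have [M [_ HM]] : \forall x \near -oo, gauss_cdf x <= e :> R.
  exact: (cvgr_le _ gauss_cdf_cvgNy).
(* Solves [t * (a - b) / s = - (|M| + 1)], a point below [M]. *)
pose t := (`|M| + 1) * s / (b - a).
have ba0 : 0 < b - a by rewrite subr_gt0.
have t0 : 0 < t by rewrite divr_gt0// mulr_gt0// ltr_wpDl.
apply: le_trans (_ : limn (err t) <= _)%E.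
  by apply: ereal_inf_lbound; exists t.
rewrite (cvg_lim _ (errL t t0))// lee_fin; apply: HM.
have -> : t * (a - b) / s = - (`|M| + 1).
  by rewrite /t; field; rewrite !gt_eqF.
by have := ler_norm (- M); rewrite normrN; lra.
Qed.
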